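(* Let $X=(X_t,t\ge 0)$ be a Lévy process in $\mathbb{R}^d$ without Gaussian component, with characteristic exponent determined by $b_0\in\mathbb{R}^d$ and Lévy measure $\nu\not\equiv 0$ as in the context. Assume that $X$ has finite expectation and is centered, i.e. $\mathbb{E}(X_t)=0$, and that there exists a constant $K$ such that for every $R>0$, $$M(R)\le K\frac{V(R)}{R}.$$ Let $A>0$ be a constant. Then for all $b>0$, all $c,t>0$ such that $R=h_c(t)$ satisfies $$\overline{\nu}(R)\le A\frac{V(R)}{R^2},$$ and every 1-Lipschitz function $f:\mathbb{R}^d\to\mathbb{R}$ (with respect to the Euclidean norm), $$\mathbb{P}\left(f(X_t)-\mathbb{E}f(X_t)\ge(b+cK)h_c(t)\right)\le Ac+\exp\left[b-(b+c)\log\left(1+\frac{b}{c}\right)\right].$$ In particular, if $0<q\le 2$, then for every $t>0$ such that $R=h_{q/2A}(t)$ satisfies $\overline{\nu}(R)\le A\,V(R)/R^2$, for every 1-Lipschitz function $f:\mathbb{R}^d\to\mathbb{R}$, and for every $x$ such that $$x\ge\left[\frac{qK}{2A}+g_{q/2A}(q/2)\right]h_{q/2A}(t),$$ we have $$\mathbb{P}(f(X_t)-\mathbb{E}f(X_t)\ge x)\le q.$$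
   Context: $\langle\cdot,\cdot\rangle$ and $\|\cdot\|$ are the Euclidean inner product and norm on $\mathbb{R}^d$. The law of the Lévy process $X$ (with $X_0=0$) is given by $\mathbb{E}\exp(i\langle u,X_t\rangle)=\exp(t\psi_X(u))$ for $u\in\mathbb{R}^d$, $t\ge 0$, where $$\psi_X(u)=i\langle u,b_0\rangle+\int_{\mathbb{R}^d}\left(e^{i\langle u,y\rangle}-1-i\langle u,y\rangle\mathbf{1}_{\|y\|\le 1}\right)\nu(dy),$$ with $b_0\in\mathbb{R}^d$ and $\nu\not\equiv 0$ a positive Borel measure on $\mathbb{R}^d$ without atom at the origin satisfying $\int(\|y\|^2\wedge 1)\,\nu(dy)<+\infty$. For $R>0$ put $V(R)=\int_{\|x\|\le R}\|x\|^2\,\nu(dx)$, $M(R)=\int_{\|x\|>R}\|x\|\,\nu(dx)$ and $\overline{\nu}(R)=\int_{\|x\|>R}\nu(dx)$. For $c,t>0$ put $$h_c(t)=\inf\left\{x>0:\frac{V(x)}{x^2}=\frac{c}{t}\right\};$$ only those $c,t$ are considered for which $h_c(t)\in(0,\infty)$, so that the expressions involving $h_c(t)$ are meaningful. For $c>0$ and $0<x\le 1$, $g_c(x)$ denotes the nonnegative solution $y\ge 0$ of the equation $y-(y+c)\log\left(1+\frac{y}{c}\right)=\log(x)$ (the left-hand side is a decreasing bijection of $[0,\infty)$ onto $(-\infty,0]$). The subscript $q/2A$ means $q/(2A)$. A function $f$ is 1-Lipschitz if $|f(x)-f(y)|\le\|x-y\|$ for all $x,y$. *)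

(* Defs.v *)
From HB Require Import structures.
From mathcomp Require Import all_boot all_order all_algebra.
From mathcomp Require Import all_classical all_reals all_analysis.
From mathcomp Require Import complex.

Set Implicit Arguments.
Unset Strict Implicit.
Unset Printing Implicit Defensive.

Import Order.TTheory GRing.Theory Num.Theory.
Import numFieldNormedType.Exports.

Local Open Scope classical_set_scope.
Local Open Scope ring_scope.

(* Borel sigma-algebra of R^d; the sup-norm topology that the library puts on
   row vectors is the Euclidean one. *)
HB.instance Definition _ (R : realType) (d : nat) :=
  @isMeasurable.Build (sigma_display (@open 'rV[R]_d)) 'rV[R]_d <<s open >>
    (@sigma_algebra0 _ setT open) (@sigma_algebraC _ open)
    (@sigma_algebra_bigcup _ setT open).

Section euclidean.
Context {R : realType} {d : nat}.
Implicit Types x y : 'rV[R]_d.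

Definition dotp x y : R := \sum_(i < d) x 0 i * y 0 i.

(* The library's norm `|x| on row vectors is the sup norm. *)
Definition norm2 x : R := Num.sqrt (dotp x x).

Definition lipschitz1 (f : 'rV[R]_d -> R) :=
  forall x y, `|f x - f y| <= norm2 (x - y).

End euclidean.

Section complex_valued.
Local Open Scope complex_scope.
Context {R : realType}.

Definition cexp (z : R[i]) : R[i] :=
  (expR (complex.Re z) * cos (complex.Im z)) +i*
  (expR (complex.Re z) * sin (complex.Im z)).

Definition cintegral {dT} {T : measurableType dT}
    (mu : {measure set T -> \bar R}) (f : T -> R[i]) : R[i] :=
  (\int[mu]_x complex.Re (f x)) +i* (\int[mu]_x complex.Im (f x)).

End complex_valued.

Section levy_process.
Context {dT} {T : measurableType dT} {R : realType} (P : probability T R).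
Context {d : nat}.

Definition mutually_independent n (Y : 'I_n -> T -> 'rV[R]_d) :=
  forall A : 'I_n -> set 'rV[R]_d, (forall i, measurable (A i)) ->
  P (\bigcap_i (Y i @^-1` A i)) = (\prod_(i < n) P (Y i @^-1` A i))%E.

(* Time ranges over [0, +oo[: the values of X at negative times play no role. *)
Record levy_process (X : R -> {RV P >-> 'rV[R]_d}) : Prop := {
  levy_start : {ae P, forall w, X 0 w = 0} ;
  levy_independent : forall n (s : nat -> R), 0 <= s 0%N ->
    (forall i, s i <= s i.+1) ->
    mutually_independent (fun (i : 'I_n) w => X (s i.+1) w - X (s i) w) ;
  levy_stationary : forall s t, 0 <= s -> s <= t ->
    forall A, measurable A ->
    P [set w | A (X t w - X s w)] = P [set w | A (X (t - s) w)] ;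
  levy_cadlag : {ae P, forall w,
    (forall t, 0 <= t -> X s w @[s --> t^'+] --> X t w) /\
    (forall t, 0 < t -> cvg (X s w @[s --> t^'-])) } }.

Definition centered (Y : T -> 'rV[R]_d) : Prop :=
  ('E_P[fun w => norm2 (Y w)] < +oo)%E /\
  forall i, ('E_P[fun w => Y w ord0 i] = 0)%E.

End levy_process.

Section levy_measure.
Context {R : realType} {d : nat}.
Implicit Types (nu : {measure set 'rV[R]_d -> \bar R}).

Definition levy_measure nu : Prop :=
  [/\ nu [set 0] = 0%E, nu setT != 0%E &
      (\int[nu]_y (Num.min (norm2 y ^+ 2) 1)%:E < +oo)%E].

Local Open Scope complex_scope.

(* [x *i] is the imaginary number i x, with its real part 0; the constant ['i]
   of numClosedFieldType is avoided, being only some square root of -1. *)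
Definition char_exponent (b0 : 'rV[R]_d) nu (u : 'rV[R]_d) : R[i] :=
  (dotp u b0) *i +
  cintegral nu (fun y =>
    cexp ((dotp u y) *i) - 1 - (dotp u y * \1_[set z | norm2 z <= 1] y) *i).

Local Open Scope ereal_scope.

Definition V_ nu (r : R) : \bar R :=
  \int[nu]_(x in [set x | (norm2 x <= r)%R]) (norm2 x ^+ 2)%:E.

Definition M_ nu (r : R) : \bar R :=
  \int[nu]_(x in [set x | (r < norm2 x)%R]) (norm2 x)%:E.

Definition nubar nu (r : R) : \bar R := nu [set x | (r < norm2 x)%R].

(* Extended-real infimum, so that inf of the empty set is +oo. *)
Definition h_ nu (c t : R) : \bar R :=
  ereal_inf [set x%:E | x in
    [set x : R | (0 < x)%R /\ V_ nu x * ((x ^+ 2)^-1)%:E = (c / t)%:E]].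

End levy_measure.

(* For 0 < c and 0 < x <= 1 the solution exists and is unique; 0 is a dummy
   value outside that range. *)
Definition g_ {R : realType} (c x : R) : R :=
  xget 0 [set y | 0 <= y /\ y - (y + c) * ln (1 + y / c) = ln x].

(* Main.v *)
Require Import Defs.
From HB Require Import structures.
From mathcomp Require Import all_boot all_order all_algebra.
From mathcomp Require Import all_classical all_reals all_analysis.
From mathcomp Require Import measurable_realfun complex.
From mathcomp Require Import ring lra.

(** Cut [X_t] into [n] independent increments with the law [Q_n] of [X_(t/n)],
    replace by [0] every increment longer than a level [l] slightly above
    [R = h_c(t)], and let [S] be the sum of the truncated increments. Three
    facts give the deviation bound.

    - [S] differs from [X_t] only if some increment is longer than [l], an event
      of probability at most [n Q_n(|y| > l)].
    - [E f(S)] exceeds [E f(X_t)] by at most [n] times the integral of [|y|]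
      over [|y| > l] against [Q_n], since [f] is 1-Lipschitz.
    - As a function of one increment, the others being fixed, [f] oscillates by
      at most the norm of that increment, hence by at most [l]. Integrating the
      increments out one after the other and using that [(e^x - 1 - x) / x^2]
      is nondecreasing (Bennett), the logarithm of
      [E exp (lam (f(S) - E f(S)))] is at most
      [v (e^(lam l) - 1 - lam l) / l^2], where [v] is [n] times the integral of
      [|y|^2] over [|y| <= l] against [Q_n]. These are [bennett_step] and
      [psum_mgf].

    [truncated_deviation] combines them by Markov's inequality. It remains to
    let [n] tend to infinity: up to an arbitrarily small error, the three
    quantities above are bounded by [t nubar(R)], [t M(R)] and [t V(R)]. With
    [t V(R) = c R^2] ([h_attained]) and the two hypotheses on [nu], they become
    [A c], [c K R] and [c R^2], and the choice [lam = ln (1 + b/c) / R] gives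
    the announced expression ([deviation]).

    The limit is a statement on [mu_s / s], where [mu_s] is the law of [X_s],
    as [s] decreases to [0]: it converges to [nu] against radial continuous
    functions that vanish near the origin and grow at most linearly, and also
    against [|y|^2] near the origin. No uniqueness theorem for characteristic
    functions is used. By
    [char_exponent_gap], [1 - cos <u,y>] is integrated by [mu_s] and by [s nu]
    up to an error [s^2 C (|u|^2 + |u|^4)], which is explicit in [u].
    A product of cosines is an average of functions [cos <u,y>] over the steps
    of a random walk, and the error stays bounded as the steps become small
    with a fixed variance; so the same estimate holds for the Gaussians
    [1 - exp (- a |y|^2)] ([gap_gauss]). Radial functions are then handled by
    Bernstein polynomials in [z = exp (- a |y|^2)], whose error carries a factor
    [1 - z] that makes up for the infinite mass of [nu] at the origin
    ([bernstein_approx], [small_time_cvg_radial]). For the first moment one also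
    needs uniform integrability; it comes from comparing [|y|] with the series
    of the functions [2^k (1 - cos (y_i / 2^k))], for which the errors above are
    summable in [k] ([small_time_uniform_integrability]).

    For the second assertion, [c = q / 2A] and [b = g_c(q/2)] make both terms of
    the bound equal to [q / 2]. *)

Set Implicit Arguments.
Unset Strict Implicit.
Unset Printing Implicit Defensive.

Import Order.TTheory GRing.Theory Num.Theory.
Import numFieldNormedType.Exports.

Local Open Scope classical_set_scope.
Local Open Scope ring_scope.

(** * Inequalities for cosine, sine and the exponential *)

Section elementary.
Context {R : realType}.
Implicit Types x y v : R.

Lemma MVT_at0 (f df : R -> R) x :
  (forall y, is_derive y 1 f (df y)) ->
  exists2 c, `|c| <= `|x| & f x - f 0 = df c * x.
Proof.
move=> dfP.
have fcont a b : {within `[a, b], continuous f}.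
  apply: continuous_subspaceT => y; apply: differentiable_continuous.
  by apply/derivable1_diffP; have [] := dfP y.
have [x0|x0] := leP 0 x.
- have [c cx fE] := MVT_segment x0 (fun y _ => dfP y) (fcont 0 x).
  exists c; last by rewrite fE subr0.
  by move: cx; rewrite in_itv/= => /andP[c0 cx]; rewrite !ger0_norm.
- have [c cx fE] := MVT_segment (ltW x0) (fun y _ => dfP y) (fcont x 0).
  exists c; last by rewrite -opprB fE sub0r mulrN opprK.
  move: cx; rewrite in_itv/= => /andP[xc c0].
  by rewrite !ler0_norm ?lerN2// ltW.
Qed.

Lemma normr_sin_le x : `|sin x| <= `|x|.
Proof.
have [c _] := @MVT_at0 sin cos x (@is_derive_sin _).
rewrite sin0 subr0 => ->; rewrite normrM -[leRHS]mul1r ler_wpM2r//.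
exact: cos_max.
Qed.

Lemma cos_half x : 1 - cos x = 2 * sin (x / 2) ^+ 2.
Proof.
have -> : cos x = cos ((x / 2) *+ 2) by congr cos; rewrite mulr2n; lra.
by rewrite cos_mulr2n cos2sin2 mulr2n; ring.
Qed.

Lemma cos_subr1_ge0 x : 0 <= 1 - cos x.
Proof. by rewrite subr_ge0 cos_le1. Qed.

Lemma cos_subr1_le2 x : 1 - cos x <= 2.
Proof. by have := cos_geN1 x; lra. Qed.

Lemma cos_subr1_le_sqr x : 1 - cos x <= x ^+ 2 / 2.
Proof.
rewrite cos_half.
have := normr_sin_le (x / 2); rewrite -ler_sqr ?nnegrE// !real_normK ?num_real//.
rewrite expr_div_n; lra.
Qed.

Lemma cos_subr1_le_norm x : 1 - cos x <= `|x|.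
Proof.
rewrite cos_half -(real_normK (num_real (sin _))).
have h1 := normr_sin_le (x / 2); have h2 := sin_max (x / 2).
rewrite normrM (ger0_norm (_ : 0 <= 2^-1)) in h1; last lra.
set s := `|sin _| in h1 h2 *.
have s0 : 0 <= s by exact: normr_ge0.
by nra.
Qed.

Lemma sin_sub_le x : `|sin x - x| <= x ^+ 2 * Num.min 1 (`|x| / 2).
Proof.
have dP y : is_derive y 1 (fun x => sin x - x) (cos y - 1).
  exact: is_deriveB.
have [c cx] := MVT_at0 x dP.
rewrite sin0 !subr0 => ->; rewrite normrM distrC (ger0_norm (cos_subr1_ge0 _)).
rewrite -(real_normK (num_real x)) expr2 -mulrA mulrC ler_wpM2l//.
have h1 := cos_subr1_le_norm c; have h2 := cos_subr1_le_sqr c.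
rewrite minElt; case: ifPn => _; first by rewrite mulr1; lra.
rewrite -(real_normK (num_real c)) in h2.
apply: (le_trans h2).
by have := normr_ge0 c; have := normr_ge0 x; nra.
Qed.

Lemma sin_sub_le_sqr x : `|sin x - x| <= x ^+ 2.
Proof.
apply: (le_trans (sin_sub_le x)); rewrite -[leRHS]mulr1 ler_wpM2l ?sqr_ge0//.
Qed.

(** From [1 - cos x = 2 sin^2 (x/2)], factoring
    [sin^2 (x/2) - (x/2)^2] as a difference of squares. *)
Lemma cos_taylor2 x : `|1 - cos x - x ^+ 2 / 2| <= x ^+ 4 / 8.
Proof.
rewrite cos_half.
have -> : 2 * sin (x / 2) ^+ 2 - x ^+ 2 / 2 =
  2 * ((sin (x / 2) - x / 2) * (sin (x / 2) + x / 2)) by field.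
rewrite normrM (ger0_norm (_ : 0 <= 2))// normrM.
have h1 : `|sin (x / 2) - x / 2| <= `|x| ^+ 3 / 16.
  apply: (le_trans (sin_sub_le _)).
  have : Num.min 1 (`|x / 2| / 2) <= `|x / 2| / 2 by rewrite ge_min lexx orbT.
  rewrite normrM (ger0_norm (_ : 0 <= 2^-1)); last lra.
  rewrite -(real_normK (num_real (x / 2))) normrM (ger0_norm (_ : 0 <= 2^-1)); last lra.
  have : 0 <= `|x| by []; set a := `|x|; set m := Num.min _ _ => a0 hm.
  have : 0 <= (a / 2) ^+ 2 by exact: sqr_ge0.
  have -> : a ^+ 3 / 16 = (a / 2)^+2 * (a / 2 / 2) by field.
  by move=> ?; rewrite ler_wpM2l.
have h2 : `|sin (x / 2) + x / 2| <= `|x|.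
  have := normr_sin_le (x / 2); have := ler_normD (sin (x/2)) (x / 2).
  rewrite normrM (ger0_norm (_ : 0 <= 2^-1)); last lra.
  lra.
have -> : x ^+ 4 / 8 = 2 * (`|x| ^+ 3 / 16 * `|x|).
  have -> : x ^+ 4 = `|x| ^+ 4.
    by rewrite -normrX ger0_norm// exprn_even_ge0.
  by field.
by rewrite ler_pM2l// ler_pM.
Qed.

Lemma expRN_ge v : 1 - v <= expR (- v).
Proof. exact: expR_ge1Dx. Qed.

Lemma expRN_le v : 0 <= v -> expR (- v) <= 1 - v + v ^+ 2.
Proof.
move=> v0; rewrite expRN.
have h : 1 + v <= expR v by exact: expR_ge1Dx.
have : (expR v)^-1 <= (1 + v)^-1 by rewrite lef_pV2 ?posrE ?expR_gt0//; lra.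
move=> /le_trans; apply; rewrite -div1r ler_pdivrMr; last lra.
by nra.
Qed.

Lemma expRN_le1 v : 0 <= v -> expR (- v) <= 1.
Proof. by move=> v0; rewrite expR_le1 oppr_le0. Qed.

Lemma exprn_sub_le n (a b : R) : `|a| <= 1 -> `|b| <= 1 ->
  `|a ^+ n - b ^+ n| <= n%:R * `|a - b|.
Proof.
move=> a1 b1; elim: n => [|n IH]; first by rewrite !expr0 subrr normr0 mul0r.
have -> : a ^+ n.+1 - b ^+ n.+1 = a * (a ^+ n - b ^+ n) + (a - b) * b ^+ n.
  by rewrite !exprS; ring.
apply: (le_trans (ler_normD _ _)); rewrite !normrM -natr1 mulrDl mul1r lerD//.
  by apply: le_trans IH; rewrite ler_piMl.
by rewrite ler_piMr// normrX exprn_ile1.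
Qed.

(** Comparing [cos (x / m)] with [exp (- x^2 / (2 m^2))] factor by factor is
    enough: there are [m^2] factors and each of them errs by [O(m^-4)]. *)
Lemma cvg_cos_pow x :
  cos (x / m.+1%:R) ^+ (m.+1 * m.+1) @[m --> \oo] --> expR (- (x ^+ 2 / 2)).
Proof.
apply/cvgrPdist_le => e e0.
have [N hN] : exists N : nat, x ^+ 4 / 2 <= N%:R * e.
  exists (Num.bound (x ^+ 4 / 2 / e)).
  rewrite -ler_pdivrMr// ltW// archi_boundP//.
  by rewrite !divr_ge0 ?exprn_even_ge0 ?ltW.
exists N => // m /= Nm.
have m0 : 0 < m.+1%:R :> R by rewrite ltr0n.
set M : R := m.+1%:R in m0 *.
set v := (x / M) ^+ 2 / 2.
have v0 : 0 <= v by rewrite divr_ge0// sqr_ge0.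
have -> : expR (- (x ^+ 2 / 2)) = expR (- v) ^+ (m.+1 * m.+1).
  rewrite -expRM_natl; congr expR; rewrite natrM -/M /v.
  by field; rewrite gt_eqF.
apply: le_trans (exprn_sub_le _ _ _) _.
- by rewrite ger0_norm ?expR_ge0// expRN_le1.
- exact: cos_max.
have h1 := cos_taylor2 (x / M).
have h2 := expRN_ge v; have h3 := expRN_le v0.
have h4 : `|expR (- v) - cos (x / M)| <= (x / M) ^+ 4 / 2.
  rewrite (_ : (x / M) ^+ 4 = 4 * v ^+ 2); last by rewrite /v; field; rewrite gt_eqF.
  rewrite (_ : (x / M) ^+ 4 = 4 * v ^+ 2) -/v in h1;
    last by rewrite /v; field; rewrite gt_eqF.
  move: h1; rewrite ler_norml => /andP[h1 h1'].
  rewrite ler_norml.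
  by have v2 := sqr_ge0 v; apply/andP; split; lra.
apply: le_trans (ler_wpM2l _ h4) _; first by rewrite ler0n.
rewrite natrM -/M.
have -> : M * M * ((x / M) ^+ 4 / 2) = x ^+ 4 / 2 / (M * M).
  by field; rewrite gt_eqF.
rewrite ler_pdivrMr ?mulr_gt0//; apply: (le_trans hN).
rewrite mulrC ler_wpM2l ?(ltW e0)//.
have NM : N%:R <= M by rewrite ler_nat (leq_trans Nm).
have M1 : 1 <= M by rewrite ler1n.
by apply: (le_trans NM); rewrite ler_peMl// (le_trans ler01).
Qed.

(** The power series of [e^x - 1 - x] starts at [x^2], and
    [x^k <= (x/y)^2 y^k] for [k >= 2]; so [(e^x - 1 - x) / x^2] is
    nondecreasing. *)
Lemma expR_sub_le x y : 0 < y -> `|x| <= y ->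
  expR x - 1 - x <= (x / y) ^+ 2 * (expR y - 1 - y).
Proof.
move=> y0 xy.
have y_neq0 : y != 0 by rewrite gt_eqF.
pose T (z : R) n := \sum_(0 <= k < n) exp_coeff z k.+2.
have hs (z : R) : T z n @[n --> \oo] --> expR z - 1 - z.
  have -> : T z = fun n => series (exp_coeff z) (n + 2)%N - 1 - z.
    apply/funext => n; rewrite /T /series/= addn2 !big_nat_recl//.
    by rewrite /exp_coeff/= expr0 expr1 !divr1; ring.
  apply: cvgB; last exact: cvg_cst.
  apply: cvgB; last exact: cvg_cst.
  have /cvg_ex[/= l lP] := @is_cvg_series_exp_coeff R z.
  rewrite (_ : expR z = l); last exact/cvg_lim.
  exact: cvg_comp (cvg_addnr 2) lP.
have hr : (x / y) ^+ 2 * T y n @[n --> \oo] --> (x / y) ^+ 2 * (expR y - 1 - y).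
  by apply: cvgMr; exact: hs.
apply: ler_cvg_to (hs x) hr _; apply: nearW => n.
rewrite /T mulr_sumr; apply: ler_sum => k _.
rewrite /exp_coeff/= mulrA ler_pM2r ?invr_gt0 ?ltr0n ?fact_gt0//.
rewrite -[k.+2]addn2 !exprD.
have -> : (x / y) ^+ 2 * (y ^+ k * y ^+ 2) = y ^+ k * x ^+ 2 by field.
apply: ler_wpM2r; first exact: sqr_ge0.
by rewrite (le_trans (ler_norm _))// normrX lerXn2r ?nnegrE// ltW.
Qed.

End elementary.

(** * The Euclidean norm and the Borel sets of row vectors *)

Section euclidean_norm.
Context {R : realType} {d : nat}.
Implicit Types x y u : 'rV[R]_d.

Lemma dotpxx_ge0 x : 0 <= dotp x x.
Proof. by apply: sumr_ge0 => i _; rewrite -expr2 sqr_ge0. Qed.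

Lemma norm2_ge0 x : 0 <= norm2 x.
Proof. exact: sqrtr_ge0. Qed.

Lemma sqr_norm2 x : norm2 x ^+ 2 = dotp x x.
Proof. by rewrite sqr_sqrtr// dotpxx_ge0. Qed.

Lemma sqr_norm2E x : norm2 x ^+ 2 = \sum_(i < d) (x 0 i) ^+ 2.
Proof. by rewrite sqr_norm2; apply: eq_bigr => i _; rewrite expr2. Qed.

Lemma normr_coord_le x i : `|x 0 i| <= norm2 x.
Proof.
rewrite -ler_sqr ?nnegrE ?norm2_ge0// real_normK ?num_real// sqr_norm2E.
by rewrite (bigD1 i)//= lerDl sumr_ge0// => j _; rewrite sqr_ge0.
Qed.

Lemma norm2_le_sum x : norm2 x <= \sum_(i < d) `|x 0 i|.
Proof.
have s0 : 0 <= \sum_(i < d) `|x 0 i| by exact: sumr_ge0.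
rewrite -ler_sqr ?nnegrE ?norm2_ge0// sqr_norm2E expr2 mulr_suml.
apply: ler_sum => i _; rewrite -real_normK ?num_real// expr2 ler_wpM2l//.
by rewrite (bigD1 i)//= lerDl sumr_ge0.
Qed.

Lemma norm2_0 : norm2 (0 : 'rV[R]_d) = 0.
Proof.
apply/eqP; rewrite -sqrf_eq0 sqr_norm2E big1// => i _.
by rewrite mxE expr0n.
Qed.

Lemma norm2N x : norm2 (- x) = norm2 x.
Proof.
by rewrite /norm2; congr Num.sqrt; apply: eq_bigr => i _; rewrite mxE mulrNN.
Qed.

Lemma dotp_le_norm2 x y : `|dotp x y| <= norm2 x * norm2 y.
Proof.
rewrite -ler_sqr ?nnegrE ?mulr_ge0 ?norm2_ge0// real_normK ?num_real//.
rewrite exprMn !sqr_norm2.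
have key (p q : R) :
    p ^+ 2 * dotp y y - (2 * p * q) * dotp x y + q ^+ 2 * dotp x x =
    \sum_(i < d) (p * y 0 i - q * x 0 i) ^+ 2.
  rewrite /dotp !mulr_sumr -sumrB -big_split/=.
  by apply: eq_bigr => i _; ring.
set a := dotp x x; set b := dotp y y; set c := dotp x y.
have a0 : 0 <= a by exact: dotpxx_ge0.
have : 0 <= a * (a * b - c ^+ 2).
  have -> : a * (a * b - c ^+ 2) = \sum_(i < d) (a * y 0 i - c * x 0 i) ^+ 2.
    have -> : a * (a * b - c ^+ 2) =
      a ^+ 2 * dotp y y - (2 * a * c) * dotp x y + c ^+ 2 * dotp x x.
      by rewrite -/a -/b -/c; ring.
    exact: key.
  by apply: sumr_ge0 => i _; exact: sqr_ge0.
move: a0; rewrite le_eqVlt => /predU1P[a0 _|a0].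
  suff -> : c = 0 by rewrite -a0 mul0r expr0n.
  rewrite /c /dotp big1// => i _; suff -> : x 0 i = 0 by rewrite mul0r.
  apply/eqP; rewrite -normr_le0 (le_trans (normr_coord_le x i))//.
  by rewrite /norm2 -/a -a0 sqrtr0.
by rewrite pmulr_rge0// subr_ge0.
Qed.

Lemma dotp0l x : dotp 0 x = 0.
Proof. by rewrite /dotp big1// => i _; rewrite mxE mul0r. Qed.

Lemma dotpDl u v y : dotp (u + v) y = dotp u y + dotp v y.
Proof.
by rewrite /dotp -big_split/=; apply: eq_bigr => i _; rewrite mxE mulrDl.
Qed.

Lemma dotpDr u x y : dotp u (x + y) = dotp u x + dotp u y.
Proof.
by rewrite /dotp -big_split/=; apply: eq_bigr => i _; rewrite mxE mulrDr.
Qed.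

Lemma dotpC x y : dotp x y = dotp y x.
Proof. by apply: eq_bigr => i _; rewrite mulrC. Qed.

Lemma dotpNl u y : dotp (- u) y = - dotp u y.
Proof. by rewrite /dotp -sumrN; apply: eq_bigr => i _; rewrite mxE mulNr. Qed.

Lemma dotpZl (a : R) u y : dotp (a *: u) y = a * dotp u y.
Proof.
by rewrite /dotp mulr_sumr; apply: eq_bigr => i _; rewrite mxE mulrA.
Qed.

Lemma dotp_delta i y : dotp (delta_mx 0 i) y = y 0 i.
Proof.
rewrite /dotp (bigD1 i)//= mxE !eqxx mul1r big1 ?addr0// => j ji.
by rewrite mxE (negbTE ji) andbF mul0r.
Qed.

Lemma norm2D x y : norm2 (x + y) <= norm2 x + norm2 y.
Proof.
rewrite -ler_sqr ?nnegrE ?addr_ge0 ?norm2_ge0// sqr_norm2.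
rewrite dotpDl !dotpDr (dotpC y x) sqrrD !sqr_norm2.
have := le_trans (ler_norm _) (dotp_le_norm2 x y); lra.
Qed.

Lemma norm2_sum n (z : 'I_n -> 'rV[R]_d) :
  norm2 (\sum_(i < n) z i) <= \sum_(i < n) norm2 (z i).
Proof.
elim/big_ind2 : _ => //; first by rewrite norm2_0.
by move=> a1 a2 b1 b2 h1 h2; rewrite (le_trans (norm2D _ _)) ?lerD.
Qed.

Lemma lipschitz1_growth (f : 'rV[R]_d -> R) x :
  lipschitz1 f -> `|f x| <= `|f 0| + norm2 x.
Proof.
move=> /(_ x 0); rewrite subr0 => fx; rewrite -[f x](subrK (f 0)) addrC.
by rewrite (le_trans (ler_normD _ _))// lerD2l.
Qed.

End euclidean_norm.

Section measurability.
Context {R : realType} {d : nat}.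

Lemma rV_continuous_measurable (f : 'rV[R]_d -> R) :
  continuous f -> measurable_fun setT f.
Proof.
move=> /continuousP cf; apply: (measurability _ (RGenOpens.measurableE R)).
move=> _ [_ [a [b ->]] <-]; rewrite setTI; apply: sub_sigma_algebra.
exact/cf/interval_open.
Qed.

Lemma measurable_coord i : measurable_fun setT (fun y : 'rV[R]_d => y 0 i).
Proof. by apply: rV_continuous_measurable => y; exact: coord_continuous. Qed.

(** Every open set is a countable union of rational boxes, so the Borel
    sigma-algebra is generated by the coordinates. *)
Lemma measurable_fun_rV dT (T : measurableType dT) (g : T -> 'rV[R]_d) :
  (forall i, measurable_fun setT (fun w => g w 0 i)) -> measurable_fun setT g.
Proof.
move=> mg; apply: (@measurability _ _ _ _ setT g open erefl).
move=> _ [U oU <-]; rewrite setTI.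
pose box (q : 'rV[rat]_d * nat) : set 'rV[R]_d :=
  [set y | forall i, `|ratr (q.1 0 i) - y 0 i| < q.2.+1%:R^-1].
have -> : U = \bigcup_q (if asbool (box q `<=` U) then box q else set0).
  apply/seteqP; split => [y Uy|y [q _]]; last by case: asboolP => [h /h|].
  have /nbhs_ballP[e /= e0 eU] : nbhs y U.
    by apply: open_nbhs_nbhs; split.
  have [n ne] : exists n : nat, n.+1%:R^-1 < e / 2.
    exists (Num.bound (2 / e)).
    rewrite -[e / 2]invrK ltf_pV2 ?posrE ?ltr0n ?invr_gt0 ?divr_gt0//.
    rewrite invf_div (lt_trans (archi_boundP _)) ?divr_ge0 ?(ltW e0)//.
    by rewrite ltr_nat.
  have n0 : 0 < n.+1%:R^-1 :> R by rewrite invr_gt0 ltr0n.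
  have /choice[q qP] i : exists q : rat, `|ratr q - y 0 i| < n.+1%:R^-1.
    have /rat_in_itvoo[q] : y 0 i - n.+1%:R^-1 < y 0 i + n.+1%:R^-1.
      by rewrite ltrBlDr -addrA ltrDl addr_gt0.
    by rewrite in_itv/= => qi; exists q; rewrite ltr_distl.
  exists (\row_i q i, n) => //; case: asboolP => [_|] /=.
    by move=> i /=; rewrite mxE.
  case=> z /= hz; apply: eU; split => // i j; rewrite (ord1 i) /ball /= .
  have := hz j; rewrite mxE => h1; have h2 := qP j.
  rewrite distrC in h2.
  apply: le_lt_trans (ler_distD (ratr (q j)) _ _) _.
  by rewrite [e]splitr ltrD// (lt_trans _ ne).
rewrite preimage_bigcup; apply: countable_bigcupT_measurable => [|q].
  exact: countableP.
case: asboolP => _; last by rewrite preimage_set0.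
rewrite (_ : _ @^-1` _ = \bigcap_(i in [set: 'I_d])
    ((fun w => g w 0 i) @^-1` [set r | `|ratr (q.1 0 i) - r| < q.2.+1%:R^-1])).
  apply: fin_bigcap_measurable => [|i _]; first exact: finite_finset.
  rewrite -[_ @^-1` _]setTI; apply: mg => //.
  set c : R := ratr _; set e : R := _^-1.
  rewrite (_ : [set r | _] = `]c - e, c + e[%classic)//.
  by apply/seteqP; split => r /=; rewrite in_itv/= distrC ltr_distl.
by apply/seteqP; split => w /= h i => [_|]; exact: h.
Qed.

Lemma measurable_rVD dT (T : measurableType dT) (g h : T -> 'rV[R]_d) :
  measurable_fun setT g -> measurable_fun setT h ->
  measurable_fun setT (fun w => g w + h w).
Proof.
move=> mg mh; apply: measurable_fun_rV => i.
under eq_fun do rewrite mxE.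
by apply: measurable_funD; apply: (measurableT_comp (measurable_coord i)).
Qed.

Lemma measurable_rVB dT (T : measurableType dT) (g h : T -> 'rV[R]_d) :
  measurable_fun setT g -> measurable_fun setT h ->
  measurable_fun setT (fun w => g w - h w).
Proof.
move=> mg mh; apply: measurable_fun_rV => i.
under eq_fun do rewrite !mxE.
by apply: measurable_funB; apply: (measurableT_comp (measurable_coord i)).
Qed.

Lemma measurable_dotp u : measurable_fun setT (@dotp R d u).
Proof.
rewrite /dotp; apply: measurable_sum => i.
by apply: measurable_funM; [exact: measurable_cst|exact: measurable_coord].
Qed.

Lemma measurable_norm2 : measurable_fun setT (@norm2 R d).
Proof.
rewrite (_ : norm2 = Num.sqrt \o (fun y => dotp y y))//.
apply: measurableT_comp.
  by apply: continuous_measurable_fun; exact: sqrt_continuous.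
rewrite /dotp; apply: measurable_sum => i.
by apply: measurable_funM; exact: measurable_coord.
Qed.

Lemma measurable_norm2_lt r : measurable [set y : 'rV[R]_d | r < norm2 y].
Proof.
rewrite -[X in measurable X]setTI (_ : [set y | _] = norm2 @^-1` `]r, +oo[).
  exact: measurable_norm2.
by apply/seteqP; split => y /=; rewrite in_itv/= andbT.
Qed.

Lemma measurable_norm2_le r : measurable [set y : 'rV[R]_d | norm2 y <= r].
Proof.
rewrite -[X in measurable X]setTI (_ : [set y | _] = norm2 @^-1` `]-oo, r]).
  exact: measurable_norm2.
by apply/seteqP; split => y /=; rewrite in_itv.
Qed.

Lemma lipschitz1_measurable (f : 'rV[R]_d -> R) :
  lipschitz1 f -> measurable_fun setT f.
Proof.
move=> lf; apply: rV_continuous_measurable => x A /=.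
move=> /(nbhs_ballP (f x))[e /= e0 eA]; apply/nbhs_ballP.
exists (e / d.+1%:R) => /=; first by rewrite divr_gt0.
move=> y [_ xy]; apply: eA; rewrite /ball/=; apply: (le_lt_trans (lf x y)).
apply: (le_lt_trans (norm2_le_sum _)).
apply: (@le_lt_trans _ _ (\sum_(i < d) (e / d.+1%:R))).
  apply: ler_sum => i _; have := xy 0 i; rewrite /ball/= !mxE => /ltW//.
rewrite sumr_const card_ord -[_ *+ d]mulr_natr -mulrA gtr_pMr// mulrC.
by rewrite ltr_pdivrMr ?ltr0n// mul1r ltr_nat.
Qed.

End measurability.

(** * Test functions dominated by [min(|y|^2, 1)] *)

Section levy_dominated.
Context {R : realType} {d : nat} (nu : {measure set 'rV[R]_d -> \bar R}).
Hypothesis nu_levy : levy_measure nu.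
Implicit Types F G : 'rV[R]_d -> R.

Definition levy_weight (y : 'rV[R]_d) : R := Num.min (norm2 y ^+ 2) 1.

Lemma levy_weight_ge0 y : 0 <= levy_weight y.
Proof. by rewrite le_min sqr_ge0 ler01. Qed.

Lemma levy_weight_le1 y : levy_weight y <= 1.
Proof. by rewrite ge_min lexx orbT. Qed.

Lemma measurable_levy_weight : measurable_fun setT levy_weight.
Proof.
apply: measurable_minr; last exact: measurable_cst.
by apply: measurable_funX; exact: measurable_norm2.
Qed.

Definition levy_dom F := measurable_fun setT F /\
  exists C, forall y, `|F y| <= C * levy_weight y.

Lemma levy_domW : levy_dom levy_weight.
Proof.
split; first exact: measurable_levy_weight.
by exists 1 => y; rewrite mul1r ger0_norm// levy_weight_ge0.
Qed.

Lemma levy_domD F G : levy_dom F -> levy_dom G -> levy_dom (fun y => F y + G y).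
Proof.
move=> [mF [C hC]] [mG [D hD]]; split; first exact: measurable_funD.
exists (C + D) => y; rewrite mulrDl (le_trans (ler_normD _ _))// lerD//.
Qed.

Lemma levy_domZ (a : R) F : levy_dom F -> levy_dom (fun y => a * F y).
Proof.
move=> [mF [C hC]]; split; first by apply: measurable_funM.
by exists (`|a| * C) => y; rewrite normrM -mulrA ler_wpM2l.
Qed.

Lemma levy_domB F G : levy_dom F -> levy_dom G -> levy_dom (fun y => F y - G y).
Proof.
move=> hF /(levy_domZ (-1)) hG; have := levy_domD hF hG.
by under eq_fun do rewrite mulN1r.
Qed.

Lemma levy_dom0 : levy_dom (fun=> 0).
Proof.
by split; [exact: measurable_cst|exists 0 => y; rewrite normr0 mul0r].
Qed.

Lemma levy_weight_integrable : nu.-integrable setT (EFin \o levy_weight).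
Proof.
case: nu_levy => _ _ hfin; apply/integrableP; split.
  by apply/measurable_EFinP; exact: measurable_levy_weight.
apply: le_lt_trans hfin; rewrite le_eqVlt; apply/orP; left; apply/eqP.
by apply: eq_integral => y _; rewrite /= ger0_norm ?levy_weight_ge0.
Qed.

Lemma levy_dom_integrable F : levy_dom F -> nu.-integrable setT (EFin \o F).
Proof.
move=> [mF [C hC]].
apply: (@le_integrable _ _ _ _ _ _ _ (EFin \o (fun y => C * levy_weight y))) => //.
- exact/measurable_EFinP.
- move=> y _ /=; rewrite lee_fin (le_trans (hC y))// ler_norm//.
- rewrite (_ : _ \o _ = (fun y => C%:E * (EFin \o levy_weight) y)%E)//.
  by apply: integrableZl => //; exact: levy_weight_integrable.
Qed.

Lemma bounded_integrable (mu : probability 'rV[R]_d R) F (C : R) :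
  measurable_fun setT F -> (forall y, `|F y| <= C) ->
  mu.-integrable setT (EFin \o F).
Proof.
move=> mF hC; apply: measurable_bounded_integrable => //.
  by rewrite (le_lt_trans (probability_le1 _ _))// ltry.
by exists C; split; [exact: num_real|move=> x Cx y _; exact: (le_trans (hC y) (ltW Cx))].
Qed.

Lemma levy_dom_bounded F : levy_dom F -> exists C, forall y, `|F y| <= C.
Proof.
move=> [_ [C hC]]; exists `|C| => y; apply: (le_trans (hC y)).
apply: (@le_trans _ _ (`|C| * levy_weight y)).
  by rewrite ler_wpM2r ?levy_weight_ge0// ler_norm.
by rewrite ler_piMr// levy_weight_le1.
Qed.

Lemma levy_dom_integrable_proba (mu : probability 'rV[R]_d R) F :
  levy_dom F -> mu.-integrable setT (EFin \o F).
Proof.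
by move=> dF; have [C hC] := levy_dom_bounded dF; case: dF => mF _;
   exact: bounded_integrable hC.
Qed.

(** Meant for the law [mu] of the process at a small time [s], for which it is
    to be [o(s)]. *)
Definition gap (mu : probability 'rV[R]_d R) (s : R) F : R :=
  \int[mu]_y F y - s * \int[nu]_y F y.

Section gap.
Variables (mu : probability 'rV[R]_d R) (s : R).

Lemma gapD F G : levy_dom F -> levy_dom G ->
  gap mu s (fun y => F y + G y) = gap mu s F + gap mu s G.
Proof.
move=> dF dG; rewrite /gap !RintegralD//;
  by [exact: levy_dom_integrable|exact: levy_dom_integrable_proba|ring].
Qed.

Lemma gapZ a F : levy_dom F -> gap mu s (fun y => a * F y) = a * gap mu s F.
Proof.
move=> dF; rewrite /gap !RintegralZl//;
  by [exact: levy_dom_integrable|exact: levy_dom_integrable_proba|ring].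
Qed.

Lemma gapB F G : levy_dom F -> levy_dom G ->
  gap mu s (fun y => F y - G y) = gap mu s F - gap mu s G.
Proof.
move=> dF dG; rewrite /gap !RintegralB//;
  by [exact: levy_dom_integrable|exact: levy_dom_integrable_proba|ring].
Qed.

Lemma gap0 : gap mu s (fun=> 0) = 0.
Proof. by rewrite /gap !Rintegral_cst// !mul0r mulr0 subrr. Qed.

Lemma gap_cvg (F : nat -> 'rV[R]_d -> R) G C :
  (forall n, measurable_fun setT (F n)) ->
  (forall n y, `|F n y| <= C * levy_weight y) ->
  (forall y, F n y @[n --> \oo] --> G y) ->
  levy_dom G /\ gap mu s (F n) @[n --> \oo] --> gap mu s G.
Proof.
move=> mF hF FG.
have mG : measurable_fun setT G.
  by apply: (measurable_fun_cvg mF) => y _; exact: FG.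
have dW : levy_dom (fun y => C * levy_weight y).
  exact/levy_domZ/levy_domW.
have dG : levy_dom G.
  split => //; exists C => y.
  apply: ler_cvg_to (cvg_norm (FG y)) (cvg_cst _) _.
  by apply: nearW => n; exact: hF.
split => //.
have key (m : {measure set 'rV[R]_d -> \bar R}) :
    m.-integrable setT (EFin \o (fun y => C * levy_weight y)) ->
    m.-integrable setT (EFin \o G) ->
    \int[m]_y F n y @[n --> \oo] --> \int[m]_y G y.
  move=> iW iG.
  have [_ _] : [/\ m.-integrable setT (EFin \o G),
    (\int[m]_y `|(F n y)%:E - (G y)%:E|)%E @[n --> \oo] --> 0%E &
    (\int[m]_y (F n y)%:E)%E @[n --> \oo] --> (\int[m]_y (G y)%:E)%E].
    apply: (@dominated_convergence _ _ _ m setT measurableT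
      (fun n => EFin \o F n) (EFin \o G)
      (EFin \o (fun y => C * levy_weight y))) => //.
    - by move=> n; apply/measurable_EFinP.
    - exact/measurable_EFinP.
    - apply: aeW => y _; apply: cvg_EFin; first exact: nearW.
      exact: FG.
    - by apply: aeW => y n _; rewrite /= lee_fin; exact: hF.
  move=> h; apply: fine_cvg; rewrite fineK; first exact: h.
  exact: integrable_fin_num.
apply: cvgB; first by apply: key; exact: levy_dom_integrable_proba.
by apply: cvgMr; apply: key; exact: levy_dom_integrable.
Qed.

End gap.
End levy_dominated.

(** * Gaussian test functions as limits of products of cosines *)

Lemma cvg_prodr {R : realType} {I : Type} (r : seq I) (f : nat -> I -> R)
    (l : I -> R) :
  (forall i, f m i @[m --> \oo] --> l i) ->
  \prod_(i <- r) f m i @[m --> \oo] --> \prod_(i <- r) l i.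
Proof.
move=> fl; elim: r => [|i r IH].
  by rewrite big_nil; under eq_fun do rewrite big_nil; exact: cvg_cst.
by rewrite big_cons; under eq_fun do rewrite big_cons; exact: cvgM.
Qed.

Section gaussian_test.
Context {R : realType} {d : nat} (nu : {measure set 'rV[R]_d -> \bar R}).
Hypothesis nu_levy : levy_measure nu.
Implicit Types (u v y : 'rV[R]_d) (L : seq ('I_d * R)).

Definition cos_prod L y : R := \prod_(p <- L) cos (p.2 * y 0 p.1).

Definition cos_test v L y : R := 1 - cos (dotp v y) * cos_prod L y.

(** With independent signs in front of the steps [p.2 e_(p.1)], the expectation
    of [cos <U, y>] for the resulting sum [U] is [cos_prod L y], and that of
    [|U|^2] is [variance L]. *)
Definition variance L : R := \sum_(p <- L) p.2 ^+ 2.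

Lemma variance_ge0 L : 0 <= variance L.
Proof. by apply: sumr_ge0 => p _; exact: sqr_ge0. Qed.

Lemma cos_prod_max L y : `|cos_prod L y| <= 1.
Proof.
rewrite /cos_prod; elim: L => [|p L IH]; first by rewrite big_nil normr1.
by rewrite big_cons normrM mulr_ile1// cos_max.
Qed.

Lemma measurable_cos_prod L : measurable_fun setT (cos_prod L).
Proof.
elim: L => [|p L IH].
  rewrite (_ : cos_prod _ = cst 1); first exact: measurable_cst.
  by apply/funext => y; rewrite /cos_prod big_nil.
rewrite (_ : cos_prod _ = (fun y => cos (p.2 * y 0 p.1) * cos_prod L y)); last first.
  by apply/funext => y; rewrite /cos_prod big_cons.
apply: measurable_funM => //; apply: measurableT_comp.
  by apply: continuous_measurable_fun; exact: continuous_cos.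
by apply: measurable_funM => //; exact: measurable_coord.
Qed.

(** It makes [1 - cos_prod] subadditive in the factors, so that products of
    cosines are dominated uniformly in the number of factors. *)
Lemma cos_test_bound (a b : R) : `|a| <= 1 -> `|b| <= 1 ->
  `|1 - a * b| <= (1 - a) + (1 - b).
Proof. by rewrite !ler_norml => /andP[? ?] /andP[? ?]; apply/andP; split; nra. Qed.

Lemma cos_prod_le L y : 1 - cos_prod L y <= variance L / 2 * norm2 y ^+ 2.
Proof.
elim: L => [|p L IH].
  by rewrite /cos_prod /variance !big_nil subrr mul0r mul0r.
rewrite /cos_prod /variance !big_cons -/(cos_prod L y) -/(variance L).
have := cos_test_bound (cos_max (p.2 * y 0 p.1)) (cos_prod_max L y).
move=> /(le_trans (ler_norm _)) /le_trans; apply.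
rewrite mulrDl mulrDl lerD//.
apply: (le_trans (cos_subr1_le_sqr _)).
rewrite exprMn mulrAC ler_wpM2l//; first by rewrite divr_ge0// sqr_ge0.
by rewrite -(real_normK (num_real (y 0 _))) lerXn2r ?nnegrE ?norm2_ge0// normr_coord_le.
Qed.

Lemma cos_test_dom v L y :
  `|cos_test v L y| <= (2 + norm2 v ^+ 2 + variance L) * levy_weight y.
Proof.
have k0 := variance_ge0 L; have v0 := sqr_ge0 (norm2 v).
rewrite /levy_weight minElt; case: ifP => _.
  apply: (le_trans (cos_test_bound (cos_max _) (cos_prod_max L y))).
  have h1 := cos_prod_le L y; have h2 := cos_subr1_le_sqr (dotp v y).
  have h3 : dotp v y ^+ 2 <= norm2 v ^+ 2 * norm2 y ^+ 2.
    rewrite -(real_normK (num_real (dotp _ _))) -exprMn.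
    by rewrite lerXn2r ?nnegrE ?mulr_ge0 ?norm2_ge0// dotp_le_norm2.
  by have y0 := sqr_ge0 (norm2 y); nra.
rewrite mulr1 (le_trans (ler_normB _ _))// normr1 normrM.
apply: (@le_trans _ _ 2); last by rewrite -addrA lerDl addr_ge0.
by rewrite -[2]/(1 + 1) lerD2l mulr_ile1// ?cos_max// cos_prod_max.
Qed.

Lemma measurable_cos_dotp u : measurable_fun setT (fun y => cos (dotp u y)).
Proof.
apply: measurableT_comp; last exact: measurable_dotp.
by apply: continuous_measurable_fun; exact: continuous_cos.
Qed.

Lemma levy_dom_cos_test v L : levy_dom (cos_test v L).
Proof.
split; last by exists (2 + norm2 v ^+ 2 + variance L) => y; exact: cos_test_dom.
apply: measurable_funB; first exact: measurable_cst.
apply: measurable_funM; [exact: measurable_cos_dotp|exact: measurable_cos_prod].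
Qed.

Lemma levy_dom_cos v : levy_dom (fun y => 1 - cos (dotp v y)).
Proof.
suff -> : (fun y => 1 - cos (dotp v y)) = cos_test v [::].
  exact: levy_dom_cos_test.
by apply/funext => y; rewrite /cos_test /cos_prod big_nil mulr1.
Qed.

Section fixed_time.
Variables (mu : probability 'rV[R]_d R) (s C : R).
Hypothesis C0 : 0 <= C.
Hypothesis mu_cos : forall u, `|gap nu mu s (fun y => 1 - cos (dotp u y))| <=
  s ^+ 2 * (C * (norm2 u ^+ 2 + norm2 u ^+ 4)).

Let B (k : R) v := (norm2 v ^+ 2 + k) +
  (norm2 v ^+ 4 + 6 * k * norm2 v ^+ 2 + 3 * k ^+ 2).

(** By the addition formula, an additional factor [cos (th * y_i)] replaces the
    test function by its average over the shifts [v + th e_i] and [v - th e_i].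
    [B] bounds the expectation of [|v + U|^2 + |v + U|^4] for the sum [U] of
    these random steps; it depends on the steps only through their variance. *)
Lemma gap_cos_test v L :
  `|gap nu mu s (cos_test v L)| <= s ^+ 2 * (C * B (variance L) v).
Proof.
elim: L v => [|[i th] L IH] v.
  rewrite (_ : cos_test v _ = (fun y => 1 - cos (dotp v y))); last first.
    by apply/funext => y; rewrite /cos_test /cos_prod big_nil mulr1.
  apply: (le_trans (mu_cos v)); rewrite ler_wpM2l ?sqr_ge0// ler_wpM2l//.
  by rewrite /B /variance big_nil; nra.
set k := variance L in IH *.
have k0 : 0 <= k by exact: variance_ge0.
have -> : variance ((i, th) :: L) = th ^+ 2 + k by rewrite /variance big_cons.
set e : 'rV[R]_d := th *: delta_mx 0 i.
rewrite (_ : cos_test v _ =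
  (fun y => 2^-1 * cos_test (v + e) L y + 2^-1 * cos_test (v - e) L y)); last first.
  apply/funext => y; rewrite /cos_test /cos_prod big_cons -/(cos_prod L y).
  rewrite !dotpDl dotpNl dotpZl dotp_delta cosB cosD /=.
  by field.
have dc v' := levy_dom_cos_test v' L.
rewrite gapD//; [|exact: levy_domZ|exact: levy_domZ].
rewrite !gapZ// (le_trans (ler_normD _ _))// !normrM ger0_norm; last lra.
have h1 := IH (v + e); have h2 := IH (v - e).
suff : 2^-1 * B k (v + e) + 2^-1 * B k (v - e) <= B (th ^+ 2 + k) v.
  move=> h3; apply: (le_trans (lerD (ler_wpM2l _ h1) (ler_wpM2l _ h2))); [lra|lra|].
  apply: (@le_trans _ _
    (s ^+ 2 * (C * (2^-1 * B k (v + e) + 2^-1 * B k (v - e))))).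
    by rewrite le_eqVlt; apply/orP; left; apply/eqP; ring.
  by rewrite ler_wpM2l ?sqr_ge0// ler_wpM2l.
rewrite /B.
have sq (w : 'rV[R]_d) : norm2 w ^+ 4 = (norm2 w ^+ 2) ^+ 2 by rewrite -exprM.
rewrite !sq.
have -> : norm2 (v + e) ^+ 2 = norm2 v ^+ 2 + 2 * th * v 0 i + th ^+ 2.
  rewrite !sqr_norm2 dotpDl !dotpDr /e (dotpC v) !dotpZl (dotpC _ (_ *: _)).
  by rewrite dotpZl !dotp_delta mxE !eqxx mulr1 ?mxE; ring.
have -> : norm2 (v - e) ^+ 2 = norm2 v ^+ 2 - 2 * th * v 0 i + th ^+ 2.
  rewrite !sqr_norm2 dotpDl !dotpDr !dotpNl !(dotpC _ (- e)) !dotpNl /e.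
  rewrite !dotpZl (dotpC _ (_ *: _)) dotpZl !dotp_delta !mxE !eqxx mulr1; ring.
have : (v 0 i) ^+ 2 <= norm2 v ^+ 2.
  rewrite -(real_normK (num_real (v 0 i))).
  by rewrite lerXn2r ?nnegrE ?norm2_ge0// normr_coord_le.
have := sqr_ge0 (norm2 v); have := sqr_ge0 th.
set N := norm2 v ^+ 2; set T := th ^+ 2; set q := v 0 i => T0 N0 qN.
have tq : T * q ^+ 2 <= T * N by rewrite ler_wpM2l.
have -> : 2^-1 * (N + 2 * th * q + T + k + ((N + 2 * th * q + T) ^+ 2 +
    6 * k * (N + 2 * th * q + T) + 3 * k ^+ 2)) +
  2^-1 * (N - 2 * th * q + T + k + ((N - 2 * th * q + T) ^+ 2 +
    6 * k * (N - 2 * th * q + T) + 3 * k ^+ 2)) =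
  N + T + k + (N + T) ^+ 2 + 4 * (T * q ^+ 2) + 6 * k * (N + T) + 3 * k ^+ 2.
  by rewrite /T; field.
have T2 : 0 <= T ^+ 2 by exact: sqr_ge0.
have -> : N + (T + k) + (N ^+ 2 + 6 * (T + k) * N + 3 * (T + k) ^+ 2) =
  N + T + k + (N + T) ^+ 2 + 4 * (T * N) + 6 * k * (N + T) + 3 * k ^+ 2
  + 2 * T ^+ 2 by ring.
lra.
Qed.

Definition gauss_var (a : R) : R := d%:R * (2 * a).

(** The Gaussian is a limit of products of cosines of the same variance, and
    [gap_cos_test] is uniform over them. *)
Lemma gap_gauss (a : R) : 0 <= a ->
  levy_dom (fun y => 1 - expR (- (a * norm2 y ^+ 2))) /\
  `|gap nu mu s (fun y => 1 - expR (- (a * norm2 y ^+ 2)))| <=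
    s ^+ 2 * (C * (gauss_var a + 3 * gauss_var a ^+ 2)).
Proof.
move=> a0.
(* [(m+1)^2] steps of length [th / (m+1)] along each axis; the factor 2 comes
   from [cos (x/m)^(m^2)] tending to [exp (- x^2 / 2)]. *)
set th := Num.sqrt (2 * a).
have th2 : th ^+ 2 = 2 * a by rewrite sqr_sqrtr// mulr_ge0.
pose L (m : nat) : seq ('I_d * R) := flatten
  [seq nseq (m.+1 * m.+1) (i, th / m.+1%:R) | i <- enum 'I_d].
have varL m : variance (L m) = gauss_var a.
  have hN i : \sum_(p <- nseq (m.+1 * m.+1) (i : 'I_d, th / m.+1%:R)) p.2 ^+ 2
      = 2 * a.
    have m0 : m.+1%:R != 0 :> R by rewrite pnatr_eq0.
    rewrite big_nseq iter_addr addr0 /= expr_div_n th2.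
    by rewrite -(mulr_natr (_ / _)) natrM; field.
  rewrite /variance /L big_flatten big_map /gauss_var.
  rewrite (eq_bigr _ (fun i _ => hN i)) big_enum/= sumr_const card_ord.
  by rewrite -(mulr_natl (2 * a)).
have cosL m y : cos_prod (L m) y =
    \prod_(i < d) cos (th * y 0 i / m.+1%:R) ^+ (m.+1 * m.+1).
  have hN i : \prod_(p <- nseq (m.+1 * m.+1) (i, th / m.+1%:R))
      cos (p.2 * y 0 p.1) = cos (th * y 0 i / m.+1%:R) ^+ (m.+1 * m.+1).
    by rewrite big_nseq iter_mulr mulr1/= mulrAC.
  by rewrite /cos_prod /L big_flatten big_map (eq_bigr _ (fun i _ => hN i)) big_enum.
have lim y : cos_test 0 (L m) y @[m --> \oo] --> 1 - expR (- (a * norm2 y ^+ 2)).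
  apply: cvgB; first exact: cvg_cst.
  rewrite dotp0l cos0; under eq_fun do rewrite mul1r cosL.
  rewrite sqr_norm2E mulr_sumr -sumrN expR_sum.
  apply: cvg_prodr => i.
  have := @cvg_cos_pow R (th * y 0 i).
  by rewrite exprMn th2 (_ : 2 * a * y 0 i ^+ 2 / 2 = a * y 0 i ^+ 2)//; field.
have [|m y|dG cG] := @gap_cvg _ _ nu nu_levy mu s (fun m => cos_test 0 (L m)) _
  (2 + gauss_var a) _ _ lim.
- by move=> m; have [] := levy_dom_cos_test 0 (L m).
- by have := cos_test_dom 0 (L m) y; rewrite norm2_0 expr0n addr0 varL.
split=> //; apply: ler_cvg_to (cvg_norm cG) (cvg_cst _) _.
apply: nearW => m; apply: (le_trans (gap_cos_test 0 (L m))).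
by rewrite varL /B norm2_0 !expr0n/= !(mulr0, add0r).
Qed.

End fixed_time.
End gaussian_test.

(** * Bernstein polynomials *)

Section bernstein.
Context {R : realType}.
Implicit Types (f : R -> R) (z w : R).

(** The [n]-th Bernstein operator: the expectation of [h (k + S)], as a
    polynomial in the parameter of the binomial variable [S]. The recursion on
    the number of trials replaces binomial identities. *)
Fixpoint bernstein (n : nat) (h : nat -> R) (k : nat) : {poly R} :=
  if n is n'.+1 then
    'X * bernstein n' h k.+1 + (1 - 'X) * bernstein n' h k
  else (h k)%:P.

(** If [h] is within [a + b (j - x)^2] of a constant, its average is within
    [a + b E (k + S - x)^2] of it; the expectation is the squared bias plus the
    variance [n z (1 - z)]. *)
Lemma bernstein_le n (h : nat -> R) (a b c x z : R) k :
  0 <= z <= 1 ->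
  (forall j, (k <= j <= k + n)%N -> `|h j - c| <= a + b * (j%:R - x) ^+ 2) ->
  `|(bernstein n h k).[z] - c| <=
    a + b * ((k%:R + n%:R * z - x) ^+ 2 + n%:R * z * (1 - z)).
Proof.
move=> /andP[z0 z1]; elim: n k => [|n IH] k hc /=.
  by rewrite hornerC !mul0r !addr0 hc// leqnn addn0 leqnn.
rewrite hornerD !hornerM hornerD hornerN hornerX hornerE.
have -> : z * (bernstein n h k.+1).[z] + (1 - z) * (bernstein n h k).[z] - c =
  z * ((bernstein n h k.+1).[z] - c) + (1 - z) * ((bernstein n h k).[z] - c).
  by ring.
have z1' : 0 <= 1 - z by rewrite subr_ge0.
rewrite (le_trans (ler_normD _ _))// !normrM (ger0_norm z0) (ger0_norm z1').
have h1 : `|(bernstein n h k.+1).[z] - c| <=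
    a + b * ((k.+1%:R + n%:R * z - x) ^+ 2 + n%:R * z * (1 - z)).
  by apply: IH => j /andP[kj jn]; rewrite hc// ltnW//= addnS -addSn.
have h2 : `|(bernstein n h k).[z] - c| <=
    a + b * ((k%:R + n%:R * z - x) ^+ 2 + n%:R * z * (1 - z)).
  by apply: IH => j /andP[kj jn]; rewrite hc// kj addnS ltnW.
apply: (le_trans (lerD (ler_wpM2l z0 h1) (ler_wpM2l z1' h2))).
by rewrite le_eqVlt; apply/orP; left; apply/eqP; rewrite -!natr1; ring.
Qed.

(** Uniform continuity on the unit interval, where the second point is allowed
    to leave it. *)
Lemma heine01 f e : continuous f -> 0 < e ->
  exists2 del : R, 0 < del & forall z w, 0 <= z <= 1 -> `|z - w| < del ->
    `|f z - f w| <= e.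
Proof.
move=> cf e0.
have /compact_near_coveringP ncov := @segment_compact R 0 1.
have : \forall del \near (0 : R)^'+, `[(0 : R), 1] `<=`
    (fun del z => forall w, `|z - w| < del -> `|f z - f w| <= e) del.
  apply: ncov => z _.
  have [r r0 hr] : exists2 r : R, 0 < r &
      forall w, `|z - w| < r -> `|f z - f w| < e / 2.
    have /cvgrPdist_lt/(_ (e / 2))[] := cf z; first by rewrite divr_gt0.
    by move=> r /= r0 hr; exists r.
  exists (ball z (r / 2), [set del | del < r / 2]) => /=.
    split; first by apply: nbhsx_ballx; rewrite divr_gt0.
    by apply: nbhs_right_lt; rewrite divr_gt0.
  move=> [z' del] /= [zz' hdel] w z'w.
  have zz1 : `|z - z'| < r / 2 by exact: zz'.
  have h1 : `|f z - f z'| < e / 2 by apply: hr; lra.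
  have h2 : `|f z - f w| < e / 2.
    have hd : del < r / 2 by exact: hdel.
    apply: hr; have := ler_distD z' z w; lra.
  have := ler_distD (f z) (f z') (f w); rewrite (distrC (f z') (f z)); lra.
move=> hnear; have [del []] : exists del : R, 0 < del /\ `[(0 : R), 1] `<=`
    (fun z => forall w, `|z - w| < del -> `|f z - f w| <= e).
  by near (0 : R)^'+ => del; exists del; split; [|near: del].
move=> del0 hdel; exists del => // z w z01; apply: hdel.
by rewrite /= in_itv/=.
Unshelve. all: by end_near. Qed.

Lemma bounded01 f : continuous f ->
  exists2 M : R, 0 <= M & forall z, 0 <= z <= 1 -> `|f z| <= M.
Proof.
move=> cf.
have cn : {within `[(0 : R), 1], continuous (fun z => `|f z|)}.
  apply: continuous_subspaceT => z; apply: continuous_comp; first exact: cf.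
  exact: norm_continuous.
have [c _ hc] := EVT_max ler01 cn.
by exists `|f c| => // z z01; apply: hc; rewrite in_itv.
Qed.

(** Bernstein's proof of the Weierstrass theorem. The variance of the binomial
    law has a factor [1 - z], and so has the oscillation bound of [f] because
    [f] vanishes near [1]; hence the factor [1 - z] in the error. *)
Lemma bernstein_approx f (z1 e : R) : continuous f -> z1 < 1 ->
  (forall z, z1 <= z -> f z = 0) -> 0 < e ->
  exists2 p : {poly R}, p.[1] = 0 &
    forall z, 0 <= z <= 1 -> `|p.[z] - f z| <= e * (1 - z).
Proof.
move=> cf z11 f0 e0.
pose g := (1 - z1) / 2.
have g0 : 0 < g by rewrite /g; lra.
have [del0 del00 hdel] := heine01 cf (mulr_gt0 (divr_gt0 e0 (ltr0n _ 2)) g0).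
have [M M0 hM] := bounded01 cf.
pose del := Num.min del0 g.
have del_gt0 : 0 < del by rewrite lt_min del00.
pose C := 2 * M / del ^+ 2.
have C0 : 0 <= C by rewrite divr_ge0 ?sqr_ge0 ?mulr_ge0.
(* A modulus of continuity of quadratic type; it integrates to a variance. *)
have osc z w : 0 <= z <= 1 -> 0 <= w <= 1 ->
    `|f w - f z| <= e / 2 * (1 - z) + C * (w - z) ^+ 2.
  move=> z01 w01; have /andP[_ zle1] := z01.
  have z1' : 0 <= e / 2 * (1 - z) by rewrite mulr_ge0 ?subr_ge0// divr_ge0// ltW.
  have C1 : 0 <= C * (w - z) ^+ 2 by rewrite mulr_ge0 ?sqr_ge0.
  have [wz|wz] := leP del `|w - z|.
    rewrite (@le_trans _ _ (C * (w - z) ^+ 2))// ?lerDr//.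
    rewrite (@le_trans _ _ (2 * M))//.
      rewrite (le_trans (ler_normB _ _))// mulr2n mulrDl !mul1r lerD// hM//.
    rewrite /C -mulrA ler_peMr ?mulr_ge0// mulrC ler_pdivlMr ?exprn_gt0//.
    rewrite mul1r -(real_normK (num_real (w - z))).
    by rewrite lerXn2r ?nnegrE// ltW.
  have [gz|gz] := leP g (1 - z).
    rewrite (@le_trans _ _ (e / 2 * (1 - z)))// ?lerDl//.
    rewrite (@le_trans _ _ (e / 2 * g))//.
      by rewrite hdel// (lt_le_trans wz)// ge_min lexx.
    by rewrite ler_wpM2l// divr_ge0// ltW.
  have hg : `|w - z| < g by rewrite (lt_le_trans wz)// ge_min lexx orbT.
  move: hg; rewrite ltr_distl => /andP[hg _].
  rewrite !f0 ?subrr ?normr0 ?addr_ge0// ltW//; rewrite /g in gz hg; lra.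
have [N hN] : exists N : nat, C / (e / 2) < N.+1%:R.
  exists (Num.bound (C / (e / 2))).
  rewrite (lt_trans (archi_boundP _)) ?ltr_nat// divr_ge0// divr_ge0// ltW//.
have N0 : 0 < N.+1%:R :> R by rewrite ltr0n.
set n := N.+1 in hN N0 *.
pose p := bernstein n (fun j => f (j%:R / n%:R)) 0.
have approx z : 0 <= z <= 1 -> `|p.[z] - f z| <= e * (1 - z).
  move=> z01; have /andP[z0 zle1] := z01.
  have := @bernstein_le n (fun j => f (j%:R / n%:R)) (e / 2 * (1 - z))
    (C / n%:R ^+ 2) (f z) (n%:R * z) z 0 z01.
  rewrite -/p add0r subrr expr0n/= !add0r => h; apply: (le_trans (h _)).
    move=> j jn; rewrite (le_trans (osc _ _ _ _))//.
      by rewrite divr_ge0//= ler_pdivrMr// mul1r ler_nat.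
    rewrite lerD2l -mulrA ler_wpM2l// [leRHS]mulrC ler_pdivlMr ?exprn_gt0//.
    by rewrite -exprMn mulrBl divfK ?gt_eqF// (mulrC z).
  have -> : C / n%:R ^+ 2 * (n%:R * z * (1 - z)) = C / n%:R * z * (1 - z).
    by field; rewrite gt_eqF.
  rewrite -mulrDl ler_wpM2r ?subr_ge0//.
  have hC : C / n%:R <= e / 2.
    by rewrite ler_pdivrMr// mulrC -ler_pdivrMr ?divr_gt0// ltW.
  have : 0 <= C / n%:R by rewrite divr_ge0// ltW.
  set q := C / n%:R in hC * => q0; nra.
exists p => //.
have := approx 1; rewrite lexx ler01 subrr mulr0 (f0 1 (ltW z11)) subr0 => /(_ isT).
by rewrite normr_le0 => /eqP.
Qed.

End bernstein.

(** * Convergence to the Levy measure at small times *)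

Section small_time.
Context {R : realType} {d : nat} (nu : {measure set 'rV[R]_d -> \bar R}).
Hypothesis nu_levy : levy_measure nu.
Variables (mu : R -> probability 'rV[R]_d R) (C : R).
Hypothesis C0 : 0 <= C.
Hypothesis mu_cos : forall (s : R) u, 0 <= s ->
  `|gap nu (mu s) s (fun y => 1 - cos (dotp u y))| <=
  s ^+ 2 * (C * (norm2 u ^+ 2 + norm2 u ^+ 4)).
Implicit Types (F G : 'rV[R]_d -> R) (e s a : R).

Definition small_time_cvg F := levy_dom F /\
  forall e, 0 < e -> \forall s \near 0^'+, `|gap nu (mu s) s F| <= e * s.

Lemma small_time_cvg0 : small_time_cvg (fun=> 0).
Proof.
split=> [|e e0]; first exact: levy_dom0.
by near=> s; rewrite gap0 normr0 mulr_ge0// ltW.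
Unshelve. all: by end_near. Qed.

Lemma small_time_cvgD F G : small_time_cvg F -> small_time_cvg G ->
  small_time_cvg (fun y => F y + G y).
Proof.
move=> [dF hF] [dG hG]; split=> [|e e0]; first exact: levy_domD.
have e2 : 0 < e / 2 by rewrite divr_gt0.
near=> s; rewrite gapD// (le_trans (ler_normD _ _))//.
rewrite [e]splitr mulrDl lerD//; near: s; [exact: hF|exact: hG].
Unshelve. all: by end_near. Qed.

Lemma small_time_cvgZ b F : small_time_cvg F ->
  small_time_cvg (fun y => b * F y).
Proof.
move=> [dF hF]; split=> [|e e0]; first exact: levy_domZ.
have b0 : 0 < `|b| + 1 by rewrite ltr_wpDl.
near=> s; rewrite gapZ// normrM.
have h : `|gap nu (mu s) s F| <= e / (`|b| + 1) * s.
  by near: s; apply: hF; rewrite divr_gt0.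
apply: (@le_trans _ _ ((`|b| + 1) * (e / (`|b| + 1) * s))).
  by apply: ler_pM => //; rewrite lerDl.
by rewrite mulrA [_ * (e / _)]mulrC divfK// gt_eqF.
Unshelve. all: by end_near. Qed.

Lemma small_time_cvgB F G : small_time_cvg F -> small_time_cvg G ->
  small_time_cvg (fun y => F y - G y).
Proof.
move=> hF /(small_time_cvgZ (-1)) hG; have := small_time_cvgD hF hG.
by under eq_fun do rewrite mulN1r.
Qed.

Lemma small_time_cvg_sum (I : Type) (r : seq I) (F : I -> 'rV[R]_d -> R) :
  (forall i, small_time_cvg (F i)) ->
  small_time_cvg (fun y => \sum_(i <- r) F i y).
Proof.
move=> hF; elim: r => [|i r IH].
  by under eq_fun do rewrite big_nil; exact: small_time_cvg0.
by under eq_fun do rewrite big_cons; exact: small_time_cvgD.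
Qed.

Lemma gap_ler s F G W : 0 <= s -> levy_dom F -> levy_dom G -> levy_dom W ->
  (forall y, `|F y - G y| <= W y) ->
  `|gap nu (mu s) s F| <= `|gap nu (mu s) s G| +
    (\int[mu s]_y W y + s * \int[nu]_y W y).
Proof.
move=> s0 dF dG dW FGW.
have dFG := levy_domB dF dG.
have -> : gap nu (mu s) s F = gap nu (mu s) s G + gap nu (mu s) s (fun y => F y - G y).
  by rewrite gapB//; ring.
rewrite (le_trans (ler_normD _ _))// lerD2l /gap (le_trans (ler_normB _ _))//.
rewrite normrM (ger0_norm s0) lerD//.
  rewrite (le_trans (le_normr_Rintegral _ _))//; first exact: levy_dom_integrable_proba.
  apply: le_Rintegral => //.
  - apply: levy_dom_integrable_proba; split; last first.
      case: dFG => _ [c hc]; exists c => y; rewrite normr_id; exact: hc.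
    by apply: measurableT_comp => //; case: dFG.
  - exact: levy_dom_integrable_proba.
rewrite ler_wpM2l// (le_trans (le_normr_Rintegral _ _))//; first exact: levy_dom_integrable.
apply: le_Rintegral => //.
- apply: (levy_dom_integrable nu_levy); split; last first.
    case: dFG => _ [c hc]; exists c => y; rewrite normr_id; exact: hc.
  by apply: measurableT_comp => //; case: dFG.
- exact: levy_dom_integrable.
Qed.

(** The class is closed under approximation with a relative error. *)
Lemma small_time_cvg_approx F W : measurable_fun setT F -> small_time_cvg W ->
  (forall y, 0 <= W y) ->
  (forall e, 0 < e -> exists2 G, small_time_cvg G &
    forall y, `|F y - G y| <= e * W y) ->
  small_time_cvg F.
Proof.
move=> mF gW W0 hF; have [dW hW] := gW.
have dF : levy_dom F.
  have [G [[_ [c hc]] _] hG] := hF 1 ltr01; have [_ [c' hc']] := dW.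
  split => //; exists (c' + c) => y.
  rewrite -[F y](subrK (G y)) mulrDl (le_trans (ler_normD _ _))// lerD//.
  by rewrite (le_trans (hG y))// mul1r (le_trans _ (hc' y))// ler_norm.
split=> // e e0.
pose I := \int[nu]_y W y.
have I0 : 0 <= I by exact: Rintegral_ge0.
pose r := e / 2 / (2 * I + 1).
have r0 : 0 < r by rewrite !divr_gt0// ltr_wpDl// mulr_ge0.
have [G gG FG] := hF r r0; have [dG hG] := gG.
near=> s.
have s0 : 0 < s by [].
have h1 : `|gap nu (mu s) s G| <= e / 2 * s.
  by near: s; apply: hG; rewrite divr_gt0.
have h2 : `|gap nu (mu s) s W| <= 1 * s by near: s; exact: hW.
have := gap_ler (ltW s0) dF dG (levy_domZ r dW) FG.
move=> /le_trans; apply.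
rewrite [e]splitr mulrDl lerD// !RintegralZl//; last 2 first.
  exact: levy_dom_integrable.
  exact: levy_dom_integrable_proba.
rewrite -/I.
have h3 : \int[mu s]_y W y <= s * (I + 1).
  move: h2; rewrite /gap -/I mul1r ler_norml => /andP[_]; lra.
have -> : e / 2 * s = r * (s * (2 * I + 1)).
  by rewrite /r; field; rewrite gt_eqF// ltr_wpDl// mulr_ge0.
by rewrite mulrCA -mulrDr ler_wpM2l ?(ltW r0)//; lra.
Unshelve. all: by end_near. Qed.

Lemma small_time_cvg_gauss a : 0 <= a ->
  small_time_cvg (fun y => 1 - expR (- (a * norm2 y ^+ 2))).
Proof.
move=> a0; split=> [|e e0].
  exact: (proj1 (gap_gauss nu_levy C0 (fun u => mu_cos u (lexx 0)) a0)).
set k := C * (@gauss_var R d a + 3 * @gauss_var R d a ^+ 2).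
have k0 : 0 <= k.
  by rewrite mulr_ge0// addr_ge0// ?mulr_ge0 ?sqr_ge0.
near=> s; have s0 : 0 < s by [].
have [_ h] := gap_gauss nu_levy C0 (fun u => mu_cos u (ltW s0)) a0.
apply: (le_trans h); rewrite -/k expr2 -mulrA mulrC ler_wpM2r ?(ltW s0)//.
have h1 : s <= e / (k + 1) by near: s; apply: nbhs_right_le; rewrite divr_gt0// ltr_wpDl.
rewrite ler_pdivlMr ?ltr_wpDl// in h1.
by apply: le_trans h1; rewrite ler_wpM2l ?(ltW s0)// lerDl.
Unshelve. all: by end_near. Qed.

Let zexp a (y : 'rV[R]_d) : R := expR (- (a * norm2 y ^+ 2)).

Let zexp01 a y : 0 <= a -> 0 <= zexp a y <= 1.
Proof. by move=> a0; rewrite expR_ge0 expRN_le1// mulr_ge0// sqr_ge0. Qed.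

Lemma measurable_zexp a : measurable_fun setT (zexp a).
Proof.
apply: measurableT_comp; first exact: measurable_expR.
apply: measurableT_comp; first exact: oppr_measurable.
by apply: measurable_funM => //; apply: measurable_funX; exact: measurable_norm2.
Qed.

Lemma small_time_cvg_poly a (p : {poly R}) : 0 <= a -> p.[1] = 0 ->
  small_time_cvg (fun y => p.[zexp a y]).
Proof.
move=> a0 p1.
rewrite (_ : (fun y => p.[zexp a y]) = (fun y => \sum_(j < size p)
  (- p`_j) * (1 - expR (- ((j%:R * a) * norm2 y ^+ 2))))); last first.
  apply/funext => y; have -> : p.[zexp a y] = p.[zexp a y] - p.[1] by rewrite p1 subr0.
  rewrite !horner_coef -sumrB.
  apply: eq_bigr => j _; rewrite expr1n /zexp -expRM_natl.
  by rewrite (_ : j%:R * - (a * norm2 y ^+ 2) = - ((j%:R * a) * norm2 y ^+ 2)); ring.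
apply: small_time_cvg_sum => j; apply: small_time_cvgZ; apply: small_time_cvg_gauss.
by rewrite mulr_ge0.
Qed.

(** Bernstein polynomials approximate [f] up to [e (1 - z)], and [1 - z] is
    itself a test function of the class. *)
Lemma small_time_cvg_exp a (f : R -> R) (z1 : R) : 0 <= a -> continuous f ->
  z1 < 1 -> (forall z, z1 <= z -> f z = 0) ->
  small_time_cvg (fun y => f (zexp a y)).
Proof.
move=> a0 cf z11 f0.
apply: (@small_time_cvg_approx _ (fun y => 1 - zexp a y)).
- apply: measurableT_comp; last exact: measurable_zexp.
  exact: continuous_measurable_fun.
- exact: small_time_cvg_gauss.
- by move=> y; rewrite subr_ge0; have /andP[] := zexp01 y a0.
- move=> e e0; have [p p1 hp] := bernstein_approx cf z11 f0 e0.
  exists (fun y => p.[zexp a y]); first exact: small_time_cvg_poly.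
  by move=> y; rewrite distrC hp// zexp01.
Qed.

(** A continuous function of [|y|] that vanishes near [0] and is constant near
    infinity is a continuous function of [z = exp (- a |y|^2)] that vanishes
    near [z = 1]; cutting [z] from below at [exp (- a l^2)] keeps the logarithm
    continuous. *)
Lemma small_time_cvg_radial a (g phi : R -> R) (r0 l : R) : 0 < a -> 0 < r0 ->
  0 <= l -> continuous g -> continuous phi ->
  (forall x, x <= r0 -> phi x = 0) -> (forall x, l <= x -> phi x = phi l) ->
  small_time_cvg (fun y => g (zexp a y) * phi (norm2 y)).
Proof.
move=> a0 r00 l0 cg cphi phi0 phil.
set zl := expR (- (a * l ^+ 2)).
pose f z := g z * phi (Num.sqrt (- ln (Num.max z zl) / a)).
have zl0 : 0 < zl by exact: expR_gt0.
have cf : continuous f.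
  move=> z; apply: cvgM; first exact: cg.
  apply: continuous_comp; last exact: cphi.
  apply: continuous_comp; last exact: sqrt_continuous.
  apply: cvgM; last exact: cvg_cst.
  apply: cvgN; apply: continuous_comp.
    by apply: continuous_max => //; exact: cst_continuous.
  by apply: continuous_ln; rewrite lt_max zl0 orbT.
have ff : (fun y => f (zexp a y)) = (fun y => g (zexp a y) * phi (norm2 y)).
  apply/funext => y; rewrite /f; congr (_ * _).
  have [yl|yl] := leP (norm2 y) l.
    congr phi; rewrite max_l.
      rewrite /zexp expRK opprK mulrAC mulfV ?gt_eqF// mul1r sqrtr_sqr ger0_norm//.
      exact: norm2_ge0.
    rewrite ler_expR lerN2 ler_wpM2l ?(ltW a0)// lerXn2r ?nnegrE//.
    exact: norm2_ge0.
  rewrite max_r; last first.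
    by rewrite ler_expR lerN2 ler_wpM2l ?(ltW a0)// lerXn2r ?nnegrE ?(ltW yl)// norm2_ge0.
  rewrite /zl expRK opprK mulrAC mulfV ?gt_eqF// mul1r sqrtr_sqr ger0_norm//.
  by rewrite [RHS]phil// ltW.
rewrite -ff; apply: (@small_time_cvg_exp a f (expR (- (a * r0 ^+ 2)))) => //.
- exact: ltW.
- by rewrite expR_lt1 oppr_lt0 mulr_gt0// exprn_gt0.
move=> z hz; rewrite /f phi0 ?mulr0//.
rewrite -[leRHS]ger0_norm ?(ltW r00)// -sqrtr_sqr ler_wsqrtr//.
rewrite ler_pdivrMr// lerNl -[leLHS]expRK ler_ln ?posrE ?expR_gt0//.
  by rewrite mulrC le_max hz.
by rewrite lt_max zl0 orbT.
Qed.

End small_time.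

(** * Ramps and dyadic sums of cosines *)

Section ramp.
Context {R : realType}.
Implicit Types r l x : R.

Definition ramp r l x : R := Num.min 1 (Num.max 0 ((x - r) / (l - r))).

Lemma ramp_ge0 r l x : 0 <= ramp r l x.
Proof. by rewrite le_min ler01 le_max lexx. Qed.

Lemma ramp_le1 r l x : ramp r l x <= 1.
Proof. by rewrite ge_min lexx. Qed.

Lemma ramp_eq0 r l x : r < l -> x <= r -> ramp r l x = 0.
Proof.
move=> rl xr; rewrite /ramp max_l ?min_r//.
by rewrite pmulr_lle0 ?invr_gt0 ?subr_gt0 ?subr_le0.
Qed.

Lemma ramp_eq1 r l x : r < l -> l <= x -> ramp r l x = 1.
Proof.
move=> rl lx; have h : 1 <= (x - r) / (l - r).
  by rewrite ler_pdivlMr ?subr_gt0// mul1r lerB.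
by rewrite /ramp max_r ?min_l// (le_trans ler01).
Qed.

Lemma continuous_ramp r l : continuous (ramp r l).
Proof.
move=> x.
have h : {for x, continuous (fun x => (x - r) / (l - r))}.
  apply: cvgM; last exact: cvg_cst.
  by apply: cvgB; [exact: cvg_id|exact: cvg_cst].
apply: (@continuous_min R R (fun=> 1) (fun x => Num.max 0 ((x - r) / (l - r)))).
  exact: cst_continuous.
apply: (@continuous_max R R (fun=> 0) (fun x => (x - r) / (l - r))) => //.
exact: cst_continuous.
Qed.

End ramp.

Section dyadic_cosines.
Context {R : realType}.
Implicit Types x : R.

(** Telescoping: up to the factor 12 the summand is an increment of
    [t |-> |x| t / (t + |x|)] along [t = 2^k]. *)
Lemma sum_dyadic_cos_le x n :
  \sum_(k < n) 2 ^+ k * (1 - cos (x / 2 ^+ k)) <= 12 * (x ^+ 2 / (1 + `|x|)).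
Proof.
have [->|x0] := eqVneq x 0.
  rewrite big1 ?expr0n ?mul0r ?mulr0// => k _.
  by rewrite mul0r cos0 subrr mulr0.
have a0 : 0 < `|x| by rewrite normr_gt0.
have t0 k : 0 < 2 ^+ k :> R by rewrite exprn_gt0.
rewrite -[x ^+ 2](real_normK (num_real x)).
pose Phi (t : R) := `|x| * t / (t + `|x|).
have step (t : R) : 0 < t -> t * (1 - cos (x / t)) <= 12 * (Phi (2 * t) - Phi t).
  move=> tt; rewrite /Phi.
  have -> : 12 * (`|x| * (2 * t) / (2 * t + `|x|) - `|x| * t / (t + `|x|)) =
      12 * t * `|x| ^+ 2 / ((2 * t + `|x|) * (t + `|x|)).
    by field; rewrite !gt_eqF//; lra.
  have p0 : 0 < (2 * t + `|x|) * (t + `|x|) by rewrite mulr_gt0//; lra.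
  rewrite ler_pdivlMr// -!mulrA (mulrCA 12) ler_pM2l//.
  have c0 := cos_subr1_ge0 (x / t).
  set a := `|x| in a0 p0 *.
  have [at_|ta] := leP a t.
    apply: (@le_trans _ _ ((a / t) ^+ 2 / 2 * ((2 * t + a) * (t + a)))).
      apply: ler_wpM2r; first exact: ltW.
      apply: (le_trans (cos_subr1_le_sqr _)).
      by rewrite !expr_div_n /a (real_normK (num_real x)).
    have -> : (a / t) ^+ 2 / 2 * ((2 * t + a) * (t + a)) =
        a ^+ 2 * ((2 * t + a) * (t + a) / (2 * t ^+ 2)) by field; rewrite gt_eqF.
    rewrite mulrC ler_wpM2r ?sqr_ge0//.
    by rewrite ler_pdivrMr ?mulr_gt0 ?exprn_gt0//; nra.
  apply: (@le_trans _ _ (2 * ((2 * t + a) * (t + a)))).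
    apply: ler_wpM2r; first exact: ltW.
    exact: cos_subr1_le2.
  by nra.
apply: (@le_trans _ _ (12 * (Phi (2 ^+ n) - Phi 1))).
  elim: n => [|n IH]; first by rewrite big_ord0 expr0 subrr mulr0.
  rewrite big_ord_recr/= exprS.
  by have := step _ (t0 n); lra.
rewrite ler_pM2l//.
have -> : `|x| ^+ 2 / (1 + `|x|) = `|x| - Phi 1.
  by rewrite /Phi; field; rewrite gt_eqF//; lra.
rewrite lerD2r /Phi ler_pdivrMr; last by have := t0 n; lra.
by rewrite ler_pM2l// lerDl.
Qed.

Definition dyadic_const : R := 2 / (1 - cos 1).

Lemma cos1_lt1 : cos 1 < 1 :> R.
Proof.
rewrite -[ltRHS]cos0 ltr_cos ?ltr01// in_itv/= ?lexx ?pi_ge0// ler01/=.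
by apply: (le_trans _ (pi_ge2 R)); lra.
Qed.

Lemma dyadic_const_ge0 : 0 <= dyadic_const.
Proof. by rewrite divr_ge0// subr_ge0 ltW// cos1_lt1. Qed.

(** The single term with [2^k <= |x| < 2^(k+1)] suffices, since cosine is at most
    [cos 1] on [[1, 2]]. *)
Lemma le_sum_dyadic_cos x k0 n : 2 ^+ k0 <= `|x| -> `|x| < 2 ^+ (k0 + n) ->
  `|x| <= dyadic_const *
    \sum_(j < n) 2 ^+ (k0 + j) * (1 - cos (x / 2 ^+ (k0 + j))).
Proof.
have t0 k : 0 < 2 ^+ k :> R by rewrite exprn_gt0.
have nn k : 0 <= 2 ^+ k * (1 - cos (x / 2 ^+ k)).
  by rewrite mulr_ge0 ?cos_subr1_ge0// ltW.
move=> hk; elim: n => [|n IH] hn.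
  by move: (le_lt_trans hk hn); rewrite addn0 ltxx.
rewrite big_ord_recr/= mulrDr.
have [h|h] := ltP `|x| (2 ^+ (k0 + n)).
  by apply: (le_trans (IH h)); rewrite lerDl mulr_ge0 ?dyadic_const_ge0.
rewrite (@le_trans _ _ (dyadic_const * (2 ^+ (k0 + n) * (1 - cos (x / 2 ^+ (k0 + n))))))//.
  rewrite mulrCA -cos_norm normrM normfV (ger0_norm (ltW (t0 _))).
  set t := 2 ^+ (k0 + n) in h *.
  have tt : 0 < t by exact: t0.
  have xt : `|x| < 2 * t by move: hn; rewrite addnS exprS.
  have h1 : cos (`|x| / t) <= cos 1.
    have [->//|h1] := eqVneq (`|x| / t) 1.
    rewrite ltW// ltr_cos ?in_itv/=.
    - by rewrite lt_neqAle eq_sym h1 ler_pdivlMr// mul1r.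
    - by rewrite ler01/= (le_trans _ (pi_ge2 R))// ler1n.
    - by rewrite divr_ge0 ?(ltW tt)//= (le_trans _ (pi_ge2 R))// ler_pdivrMr// ltW.
  have c1 : 0 < 1 - cos 1 :> R by rewrite subr_gt0 cos1_lt1.
  apply: (le_trans (ltW xt)); rewrite mulrC ler_pM2l// /dyadic_const.
  rewrite -mulrA -[leLHS]mulr1 ler_pM2l// mulrC ler_pdivlMr// mul1r.
  by rewrite lerD2l lerN2.
by rewrite lerDr mulr_ge0 ?dyadic_const_ge0// sumr_ge0.
Qed.

End dyadic_cosines.

(** * Tail mass and truncated moments at small times *)

Section small_time_bounds.
Context {R : realType} {d : nat} (nu : {measure set 'rV[R]_d -> \bar R}).
Hypothesis nu_levy : levy_measure nu.
Variables (mu : R -> probability 'rV[R]_d R) (C : R).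
Hypothesis C0 : 0 <= C.
Hypothesis mu_cos : forall (s : R) u, 0 <= s ->
  `|gap nu (mu s) s (fun y => 1 - cos (dotp u y))| <=
  s ^+ 2 * (C * (norm2 u ^+ 2 + norm2 u ^+ 4)).
Implicit Types (G h : 'rV[R]_d -> R) (e k r l : R).

(** A test function [G] squeezed between [h1 / k] on [E1] and [h2] on [E2]
    transfers an integral against [nu] into one against [mu s]. *)
Lemma small_time_upper G (h1 h2 : 'rV[R]_d -> R) (E1 E2 : set 'rV[R]_d) k e :
  small_time_cvg nu mu G -> (forall y, 0 <= G y) -> 0 < k ->
  measurable E1 -> measurable E2 ->
  measurable_fun setT h1 -> measurable_fun setT h2 ->
  (forall y, 0 <= h1 y) -> (forall y, 0 <= h2 y) ->
  (forall y, E1 y -> h1 y <= k * G y) ->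
  (forall y, E2 y -> G y <= h2 y) -> (forall y, ~ E2 y -> G y = 0) ->
  (\int[nu]_(y in E2) (h2 y)%:E < +oo)%E -> 0 < e ->
  \forall s \near 0^'+, (\int[mu s]_(y in E1) (h1 y)%:E <=
    (k * (s * (fine (\int[nu]_(y in E2) (h2 y)%:E) + e)))%:E)%E.
Proof.
move=> [dG hG] G0 k0 mE1 mE2 mh1 mh2 h10 h20 h1G Gh2 Gout fin2 e0.
have [mG _] := dG.
have mEG : measurable_fun setT (EFin \o G) by exact/measurable_EFinP.
have I0 : (0 <= \int[nu]_(y in E2) (h2 y)%:E)%E.
  by apply: integral_ge0 => y _; rewrite lee_fin.
have nuG : \int[nu]_y G y <= fine (\int[nu]_(y in E2) (h2 y)%:E).
  have nuG_fin : (\int[nu]_y (G y)%:E)%E \is a fin_num.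
    by apply: integrable_fin_num => //; exact: levy_dom_integrable.
  have nuh_fin : (\int[nu]_(y in E2) (h2 y)%:E)%E \is a fin_num.
    by rewrite ge0_fin_numE.
  rewrite fine_le// [leRHS]integral_mkcond; apply: ge0_le_integral => //.
  - by move=> y _; rewrite lee_fin.
  - apply/(measurable_restrictT _ _).1 => //.
    by apply: measurable_funTS; exact/measurable_EFinP.
  - move=> y _; rewrite patchE; case: ifPn => yE.
      by rewrite lee_fin Gh2//; exact: set_mem.
    by rewrite Gout// => Ey; move: yE; rewrite mem_set.
near=> s; have s0 : 0 < s by [].
have hs : `|gap nu (mu s) s G| <= e * s by near: s; exact: hG.
have muG : \int[mu s]_y G y <= s * (fine (\int[nu]_(y in E2) (h2 y)%:E) + e).
  move: hs; rewrite /gap ler_norml => /andP[_ hs].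
  have := ler_wpM2l (ltW s0) nuG; lra.
apply: (@le_trans _ _ (\int[mu s]_(y in E1) (k%:E * (G y)%:E))%E).
  apply: ge0_le_integral => //.
  - by move=> y _; rewrite lee_fin.
  - by apply: measurable_funTS; exact/measurable_EFinP.
  - by apply: measurable_funTS; apply: measurable_funeM.
apply: (@le_trans _ _ (\int[mu s]_y (k%:E * (G y)%:E))%E).
  apply: ge0_subset_integral => //; first exact: measurable_funeM.
  by move=> y _; rewrite -EFinM lee_fin mulr_ge0// ltW.
rewrite ge0_integralZl//; last 2 first.
  by move=> y _; rewrite lee_fin.
  by rewrite lee_fin ltW.
rewrite EFinM lee_pmul2l ?lte_fin// -[leLHS]fineK; last first.
  by apply: integrable_fin_num => //; exact: levy_dom_integrable_proba.
by rewrite lee_fin.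
Unshelve. all: by end_near. Qed.

Lemma levy_tail_fin r : 0 < r -> (nubar nu r < +oo)%E.
Proof.
move=> r0; have r2 : 0 < r ^+ 2 by rewrite exprn_gt0.
pose m := Num.min (r ^+ 2) 1.
have m0 : 0 < m by rewrite lt_min r2 ltr01.
have := levy_weight_integrable nu_levy => /integrableP[mW fin].
have mE := @measurable_norm2_lt R d r.
rewrite /nubar -[X in nu X](setTI) setIC -(mul1e (nu _)) -integral_cst//; last first.
  exact: measurableI.
rewrite setIT.
have fin' : (m^-1%:E * \int[nu]_y `|(EFin \o levy_weight) y| < +oo)%E.
  by rewrite lte_mul_pinfty ?lee_fin ?invr_ge0 ?(ltW m0).
apply: le_lt_trans fin'; rewrite -ge0_integralZl//; last 2 first.
- by apply: measurableT_comp.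
- by rewrite lee_fin invr_ge0 ltW.
apply: (@le_trans _ _ (\int[nu]_(y in [set y | (r < norm2 y)%R])
    (m^-1%:E * `|(EFin \o levy_weight) y|))%E).
  apply: ge0_le_integral => //.
  - apply: measurable_funTS; apply: measurable_funeM; exact: measurableT_comp.
  - move=> y /= ry; rewrite -EFinM lee_fin ger0_norm ?levy_weight_ge0//.
    rewrite mulrC ler_pdivlMr// mul1r /levy_weight le_min2 //.
    by rewrite lerXn2r ?nnegrE ?norm2_ge0 ?(ltW r0) ?(ltW ry).
apply: ge0_subset_integral => //.
- apply: measurable_funeM; exact: measurableT_comp.
- by move=> y _; rewrite mule_ge0// lee_fin invr_ge0 ltW.
Qed.

Lemma levy_V_fin r : (V_ nu r < +oo)%E.
Proof.
have := levy_weight_integrable nu_levy => /integrableP[mW fin].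
have k0 : 0 <= 1 + r ^+ 2 by rewrite addr_ge0// sqr_ge0.
have fin' : ((1 + r ^+ 2)%:E * \int[nu]_y `|(EFin \o levy_weight) y| < +oo)%E.
  by rewrite lte_mul_pinfty ?lee_fin.
apply: le_lt_trans fin'; rewrite -ge0_integralZl//; last first.
  by apply: measurableT_comp.
apply: (@le_trans _ _ (\int[nu]_(y in [set y | (norm2 y <= r)%R])
    ((1 + r ^+ 2)%:E * `|(EFin \o levy_weight) y|))%E).
  have mE := @measurable_norm2_le R d r.
  apply: ge0_le_integral => //.
  - by move=> y _; rewrite lee_fin sqr_ge0.
  - apply: measurable_funTS; apply/measurable_EFinP.
    by apply: measurable_funX; exact: measurable_norm2.
  - apply: measurable_funTS; apply: measurable_funeM; exact: measurableT_comp.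
  - move=> y /= ry; rewrite -EFinM lee_fin ger0_norm ?levy_weight_ge0//.
    have y2 : norm2 y ^+ 2 <= r ^+ 2.
      by rewrite lerXn2r ?nnegrE ?norm2_ge0// (le_trans (norm2_ge0 y)).
    have := sqr_ge0 (norm2 y); rewrite /levy_weight minElt; case: ifP => _; nra.
apply: ge0_subset_integral => //.
- exact: measurable_norm2_le.
- apply: measurable_funeM; exact: measurableT_comp.
- by move=> y _; rewrite mule_ge0.
Qed.

Lemma small_time_tail r l e : 0 < r -> r < l -> 0 < e ->
  \forall s \near 0^'+,
    (mu s [set y | (l < norm2 y)%R] <= (s * (fine (nubar nu r) + e))%:E)%E.
Proof.
move=> r0 rl e0.
have mE q := @measurable_norm2_lt R d q.
have cv : small_time_cvg nu mu (fun y => 1 * ramp r l (norm2 y)).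
  apply: (@small_time_cvg_radial _ _ _ nu_levy _ _ C0 mu_cos 1 (fun=> 1) _ r l) => //.
  - by rewrite ltW// (lt_trans r0).
  - by move=> x; exact: cvg_cst.
  - exact: continuous_ramp.
  - by move=> x; exact: ramp_eq0.
  - by move=> x lx; rewrite !ramp_eq1.
have nE : (\int[nu]_(y in [set y | (r < norm2 y)%R]) (1 : R)%:E = nubar nu r)%E.
  by rewrite integral_cst// mul1e.
have := @small_time_upper _ (fun=> 1) (fun=> 1) [set y | (l < norm2 y)%R]
  [set y | (r < norm2 y)%R] 1 e cv _ _ _ _ _ _ _ _ _ _ _ _ e0.
rewrite nE => h; near=> s.
have : (\int[mu s]_(y in [set y | (l < norm2 y)%R]) 1%:E <=
         (1 * (s * (fine (nubar nu r) + e)))%:E)%E.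
  near: s; apply: h => //.
  - by move=> y; rewrite mul1r ramp_ge0.
  - by move=> y /= ly; rewrite !mul1r ramp_eq1// ltW.
  - by move=> y _; rewrite mul1r ramp_le1.
  - by move=> y /= /negP; rewrite -leNgt => yr; rewrite ramp_eq0// mulr0.
  - exact: levy_tail_fin.
by rewrite integral_cst// mul1e mul1r.
Unshelve. all: by end_near. Qed.

Lemma small_time_truncated_mean r l L e : 0 < r -> r < l -> l <= L -> 0 < e ->
  (M_ nu r < +oo)%E ->
  \forall s \near 0^'+,
    (\int[mu s]_(y in [set y | (l < norm2 y)%R]) (Num.min (norm2 y) L)%:E <=
     (s * (fine (M_ nu r) + e))%:E)%E.
Proof.
move=> r0 rl lL e0 Mfin.
have L0 : 0 < L by rewrite (lt_le_trans _ lL)// (lt_trans r0).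
have mE q := @measurable_norm2_lt R d q.
have mmin : measurable_fun setT (fun y : 'rV[R]_d => Num.min (norm2 y) L).
  by apply: measurable_minr; [exact: measurable_norm2|exact: measurable_cst].
have cv : small_time_cvg nu mu
    (fun y => 1 * (Num.min (norm2 y) L * ramp r l (norm2 y))).
  apply: (@small_time_cvg_radial _ _ _ nu_levy _ _ C0 mu_cos 1 (fun=> 1)
    (fun x => Num.min x L * ramp r l x) r L) => //.
  - exact: ltW.
  - by move=> x; exact: cvg_cst.
  - move=> x; apply: cvgM; last exact: continuous_ramp.
    apply: (@continuous_min R R (fun x => x) (fun=> L)); first exact: cvg_id.
    exact: cst_continuous.
  - by move=> x xr; rewrite ramp_eq0// mulr0.
  - by move=> x Lx; rewrite !ramp_eq1 ?(le_trans lL)// !min_r.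
near=> s.
rewrite -[X in (_ <= X%:E)%E]mul1r; near: s.
apply: (small_time_upper (h1 := fun y => Num.min (norm2 y) L) cv) => //.
- by move=> y; rewrite mul1r mulr_ge0 ?ramp_ge0// le_min norm2_ge0 ltW.
- exact: measurable_norm2.
- by move=> y; rewrite le_min norm2_ge0 ltW.
- exact: norm2_ge0.
- by move=> y /= ly; rewrite !mul1r ramp_eq1 ?mulr1// ltW.
- move=> y _; rewrite mul1r (@le_trans _ _ (Num.min (norm2 y) L))//.
    by rewrite ler_piMr ?ramp_le1// le_min norm2_ge0 ltW.
  by rewrite ge_min lexx.
- by move=> y /= /negP; rewrite -leNgt => yr; rewrite ramp_eq0// mulr0 mulr0.
Unshelve. all: by end_near. Qed.

(** Near the origin [|y|^2] is compared with [(1 - exp (- a |y|^2)) / a] for a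
    small [a], which absorbs the quotient [k] of the two in the error [e]. *)
Lemma small_time_second_moment r l e : 0 < r -> r < l -> 0 < e ->
  \forall s \near 0^'+,
    (\int[mu s]_(y in [set y | (norm2 y <= r)%R]) (norm2 y ^+ 2)%:E <=
     (s * (fine (V_ nu l) + e))%:E)%E.
Proof.
move=> r0 rl e0.
have mE q := @measurable_norm2_le R d q.
have V0 : 0 <= fine (V_ nu l).
  by rewrite fine_ge0// integral_ge0// => y _; rewrite lee_fin sqr_ge0.
set v := fine (V_ nu l) in V0 *.
have ve : 0 < v + e by lra.
have ve2 : 0 < v + e / 2 by lra.
have r2 : 0 < r ^+ 2 by rewrite exprn_gt0.
pose a := e / 2 / (v + e) / r ^+ 2.
have a0 : 0 < a by rewrite !divr_gt0.
pose k := (v + e) / (v + e / 2).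
have k0 : 0 < k by rewrite divr_gt0.
have ka : k * (1 - a * r ^+ 2) = 1.
  by rewrite /k /a; field; rewrite !gt_eqF//=; lra.
pose G (y : 'rV[R]_d) := a^-1 * ((1 - expR (- (a * norm2 y ^+ 2))) -
  (1 - expR (- (a * norm2 y ^+ 2))) * ramp r l (norm2 y)).
have GE y : G y = a^-1 * (1 - expR (- (a * norm2 y ^+ 2))) * (1 - ramp r l (norm2 y)).
  by rewrite /G; ring.
have cv : small_time_cvg nu mu G.
  apply: small_time_cvgZ => //.
  apply: (@small_time_cvgB _ _ _ nu_levy mu
    (fun y => 1 - expR (- (a * norm2 y ^+ 2)))
    (fun y => (1 - expR (- (a * norm2 y ^+ 2))) * ramp r l (norm2 y))).
    by apply: small_time_cvg_gauss nu_levy _ _ C0 mu_cos _ (ltW a0).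
  apply: (@small_time_cvg_radial _ _ _ nu_levy _ _ C0 mu_cos a (fun z => 1 - z) _ r l) => //.
  - by rewrite ltW// (lt_trans r0).
  - by move=> x; apply: cvgB; [exact: cvg_cst|exact: cvg_id].
  - exact: continuous_ramp.
  - by move=> x; exact: ramp_eq0.
  - by move=> x lx; rewrite !ramp_eq1.
have x0 (y : 'rV[R]_d) : 0 <= a * norm2 y ^+ 2 by exact: (mulr_ge0 (ltW a0) (sqr_ge0 _)).
have G0 (y : 'rV[R]_d) : 0 <= a^-1 * (1 - expR (- (a * norm2 y ^+ 2))).
  by apply: mulr_ge0; [rewrite invr_ge0 ltW|rewrite subr_ge0; exact: expRN_le1 (x0 y)].
have key := @small_time_upper G (fun y => norm2 y ^+ 2) (fun y => norm2 y ^+ 2)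
  [set y | (norm2 y <= r)%R] [set y | (norm2 y <= l)%R] k (e / 2) cv.
have msq : measurable_fun setT (fun y : 'rV[R]_d => norm2 y ^+ 2).
  by apply: measurable_funX; exact: measurable_norm2.
near=> s.
have -> : s * (v + e) = k * (s * (v + e / 2)).
  by rewrite mulrCA /k divfK ?gt_eqF.
near: s; apply: key => //.
- by move=> y; rewrite GE mulr_ge0// subr_ge0 ramp_le1.
- by move=> y; exact: sqr_ge0.
- by move=> y; exact: sqr_ge0.
- move=> y /= yr; rewrite GE ramp_eq0// subr0 mulr1.
  have h := expRN_le (x0 y).
  have y2 : norm2 y ^+ 2 <= r ^+ 2 by rewrite lerXn2r ?nnegrE ?norm2_ge0// ltW.
  apply: (@le_trans _ _ (k * (norm2 y ^+ 2 * (1 - a * r ^+ 2)))).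
    by rewrite mulrCA ka mulr1.
  rewrite ler_wpM2l ?(ltW k0)// mulrC ler_pdivlMl//.
  have := sqr_ge0 (norm2 y); move: h y2; set n := norm2 y ^+ 2 => h y2 n0.
  have : a * n * (a * n) <= a * n * (a * r ^+ 2).
    apply: ler_wpM2l; first exact: mulr_ge0 (ltW a0) n0.
    exact: ler_wpM2l (ltW a0) _ _ y2.
  by move: h; rewrite expr2; lra.
- move=> y _; rewrite GE.
  apply: (@le_trans _ _ (a^-1 * (1 - expR (- (a * norm2 y ^+ 2))))).
    by rewrite ler_piMr// lerBlDl lerDr ramp_ge0.
  by rewrite ler_pdivrMl// lerBlDr -lerBlDl expRN_ge.
- by move=> y /= /negP; rewrite -ltNge => yl; rewrite GE ramp_eq1 ?(ltW yl)// subrr mulr0.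
- exact: levy_V_fin.
- by rewrite divr_gt0.
Unshelve. all: by end_near. Qed.

End small_time_bounds.

(** * Uniform integrability at small times *)

(** Stop the partial sums within [e] of their supremum. *)
Lemma nneg_series_small_tail {R : realType} (h : nat -> R) (B e : R) :
  (forall k, 0 <= h k) -> (forall n, \sum_(k < n) h k <= B) -> 0 < e ->
  exists k0, forall n, \sum_(j < n) h (k0 + j)%N <= e.
Proof.
move=> h0 hB e0.
pose S := [set \sum_(k < n) h k | n in [set: nat]].
have supS : has_sup S.
  split; first by exists 0, 0%N => //; rewrite big_ord0.
  by exists B => _ [n _ <-].
have [_ [k0 _ <-] hk0] := sup_adherent e0 supS.
exists k0 => n.
have : \sum_(k < k0 + n) h k <= sup S by apply: ub_le_sup; [case: supS|exists (k0 + n)%N].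
rewrite big_split_ord/=; lra.
Qed.

Section uniform_integrability.
Context {R : realType} {d : nat} (nu : {measure set 'rV[R]_d -> \bar R}).
Hypothesis nu_levy : levy_measure nu.
Hypothesis M1 : (M_ nu 1 < +oo)%E.
Variables (mu : R -> probability 'rV[R]_d R) (C : R).
Hypothesis C0 : 0 <= C.
Hypothesis mu_cos : forall (s : R) u, 0 <= s ->
  `|gap nu (mu s) s (fun y => 1 - cos (dotp u y))| <=
  s ^+ 2 * (C * (norm2 u ^+ 2 + norm2 u ^+ 4)).
Implicit Types (y : 'rV[R]_d) (e s : R).

(** An integrable majorant of both [1 - cos <u,y>] and the dyadic series of
    cosines; it behaves like [min (|y|^2, |y|)]. *)
Definition mean_weight y : R :=
  levy_weight y + norm2 y * \1_[set y : 'rV[R]_d | 1 < norm2 y] y.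

Lemma mean_weight_ge x y : `|x| <= norm2 y -> x ^+ 2 / (1 + `|x|) <= mean_weight y.
Proof.
move=> xy; rewrite -(real_normK (num_real x)); set a := `|x| in xy *.
have a0 : 0 <= a by exact: normr_ge0.
have a1 : 0 < 1 + a by lra.
rewrite ler_pdivrMr// /mean_weight indicE.
have [y1|y1] := leP (norm2 y) 1.
  rewrite memNset ?mulr0 ?addr0/=; last by apply/negP; rewrite -leNgt.
  rewrite /levy_weight min_l; last by rewrite exprn_ile1// norm2_ge0.
  have : a ^+ 2 <= norm2 y ^+ 2 by rewrite lerXn2r ?nnegrE ?norm2_ge0.
  have := sqr_ge0 (norm2 y); nra.
rewrite mem_set//= mulr1; have := levy_weight_ge0 y; nra.
Qed.

Lemma mean_weight_integrable : nu.-integrable setT (EFin \o mean_weight).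
Proof.
rewrite (_ : EFin \o _ = (EFin \o levy_weight) \+
  (EFin \o (fun y => norm2 y * \1_[set y : 'rV[R]_d | 1 < norm2 y] y))); last first.
  by apply/funext.
apply: integrableD => //; first exact: levy_weight_integrable.
apply/integrableP; split.
  apply/measurable_EFinP; apply: measurable_funM; first exact: measurable_norm2.
  by apply: measurable_indic; exact: measurable_norm2_lt.
apply: le_lt_trans M1; rewrite /M_ [leRHS]integral_mkcond.
rewrite le_eqVlt; apply/orP; left; apply/eqP; apply: eq_integral => y _ /=.
rewrite patchE indicE; case: ifPn => _ /=.
  by rewrite mulr1 ger0_norm// norm2_ge0.
by rewrite mulr0 normr0.
Qed.

Let T (k : nat) y : R :=
  \sum_(i < d) 2 ^+ k * (1 - cos (dotp (2^-1 ^+ k *: delta_mx 0 i) y)).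

Let T_term_dom k i :
  levy_dom (fun y => 2 ^+ k * (1 - cos (dotp (2^-1 ^+ k *: delta_mx 0 i) y)) : R).
Proof. by apply: levy_domZ; exact: levy_dom_cos. Qed.

Lemma levy_dom_sum (I : Type) (r : seq I) (F : I -> 'rV[R]_d -> R) :
  (forall i, levy_dom (F i)) -> levy_dom (fun y => \sum_(i <- r) F i y).
Proof.
move=> hF; elim: r => [|i r IH].
  by under eq_fun do rewrite big_nil; exact: levy_dom0.
by under eq_fun do rewrite big_cons; exact: levy_domD.
Qed.

Lemma gap_sum s (m : probability 'rV[R]_d R) (I : Type) (r : seq I)
    (F : I -> 'rV[R]_d -> R) : (forall i, levy_dom (F i)) ->
  gap nu m s (fun y => \sum_(i <- r) F i y) = \sum_(i <- r) gap nu m s (F i).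
Proof.
move=> hF; elim: r => [|i r IH].
  by under eq_fun do rewrite big_nil; rewrite big_nil gap0.
under eq_fun do rewrite big_cons.
by rewrite big_cons gapD// ?IH//; exact: levy_dom_sum.
Qed.

Lemma Rintegral_levy_sum (I : Type) (r : seq I)
    (F : I -> 'rV[R]_d -> R) : (forall i, levy_dom (F i)) ->
  \int[nu]_y (\sum_(i <- r) F i y) = \sum_(i <- r) \int[nu]_y F i y.
Proof.
move=> hF; elim: r => [|i r IH].
  under eq_fun do rewrite big_nil.
  by rewrite big_nil Rintegral_cst// mul0r.
under eq_fun do rewrite big_cons.
rewrite big_cons RintegralD// ?IH//; first exact: levy_dom_integrable.
by apply: levy_dom_integrable => //; exact: levy_dom_sum.
Qed.

Let T_dom k : levy_dom (T k).
Proof. by apply: levy_dom_sum => i; exact: T_term_dom. Qed.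

Let T_ge0 k y : 0 <= T k y.
Proof.
by apply: sumr_ge0 => i _; rewrite mulr_ge0 ?cos_subr1_ge0// exprn_ge0.
Qed.

Let T_E k y : T k y = \sum_(i < d) 2 ^+ k * (1 - cos (y 0 i / 2 ^+ k)).
Proof.
apply: eq_bigr => i _; rewrite dotpZl dotp_delta exprVn.
by rewrite [_ * y _ _]mulrC.
Qed.

Let B : R := 2 * C * d%:R.

Let B_ge0 : 0 <= B.
Proof. by rewrite !mulr_ge0. Qed.

Let T_mu k s : 0 <= s ->
  \int[mu s]_y T k y <= s * \int[nu]_y T k y + s ^+ 2 * (B * 2^-1 ^+ k).
Proof.
move=> s0; rewrite -lerBlDl.
have -> : \int[mu s]_y T k y - s * \int[nu]_y T k y = gap nu (mu s) s (T k) by [].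
rewrite gap_sum//.
apply: (@le_trans _ _ (\sum_(i < d) s ^+ 2 * (2 * C * 2^-1 ^+ k))); last first.
  rewrite sumr_const card_ord -mulr_natr /B.
  by rewrite le_eqVlt; apply/orP; left; apply/eqP; ring.
apply: ler_sum => i _; rewrite gapZ//; last exact: levy_dom_cos.
apply: le_trans (ler_norm _) _; rewrite normrM ger0_norm ?exprn_ge0//.
apply: (le_trans (ler_wpM2l _ (mu_cos _ s0))); first by rewrite exprn_ge0.
set u := _ *: _; set q : R := 2^-1 ^+ k.
have q0 : 0 < q by rewrite exprn_gt0// invr_gt0.
have q1 : q <= 1 by rewrite exprn_ile1// ?invr_ge0// invf_le1// ler1n.
have u2 : norm2 u ^+ 2 = q ^+ 2.
  rewrite sqr_norm2 dotpZl dotpC dotpZl dotp_delta mxE !eqxx mulr1.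
  by rewrite expr2.
have u4 : norm2 u ^+ 4 = q ^+ 2 * q ^+ 2.
  by rewrite -u2 -exprD.
have kq : 2 ^+ k * q = 1 by rewrite -exprMn mulfV ?expr1n.
rewrite u4 u2 mulrCA ler_wpM2l ?sqr_ge0//.
have -> : 2 ^+ k * (C * (q ^+ 2 + q ^+ 2 * q ^+ 2)) = (2 ^+ k * q) * (C * (q * (1 + q ^+ 2))).
  by ring.
have q2 : q ^+ 2 <= 1 by rewrite exprn_ile1// ltW.
have -> : 2 * C * q = C * (q * 2) by ring.
by rewrite kq mul1r ler_wpM2l// ler_wpM2l ?(ltW q0)//; lra.
Qed.

Let sum_T_le n y : \sum_(k < n) T k y <= 12 * d%:R * mean_weight y.
Proof.
under eq_bigr do rewrite T_E.
rewrite exchange_big/=.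
apply: (@le_trans _ _ (\sum_(i < d) 12 * mean_weight y)); last first.
  rewrite sumr_const card_ord -mulr_natr.
  by rewrite le_eqVlt; apply/orP; left; apply/eqP; ring.
apply: ler_sum => i _; apply: (le_trans (sum_dyadic_cos_le _ _)).
by rewrite ler_pM2l//; exact/mean_weight_ge/normr_coord_le.
Qed.

Let le_sum_T k0 y : 2 * d.+1%:R * 2 ^+ k0 < norm2 y ->
  exists n, norm2 y <= 2 * dyadic_const * \sum_(j < n) T (k0 + j) y.
Proof.
move=> hy.
have t0 : 0 < 2 ^+ k0 :> R by rewrite exprn_gt0.
pose n := Num.bound (norm2 y).
have yn : norm2 y < 2 ^+ (k0 + n).
  apply: (@lt_trans _ _ n%:R); first exact/archi_boundP/norm2_ge0.
  by rewrite -natrX ltr_nat (leq_trans (ltn_expl _ (isT : 1 < 2)%N))// leq_exp2l// leq_addl.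
exists n.
have key : norm2 y <= d%:R * 2 ^+ k0 + dyadic_const * \sum_(j < n) T (k0 + j) y.
  apply: (le_trans (norm2_le_sum y)).
  under [X in _ <= _ + _ * X]eq_bigr do rewrite T_E.
  rewrite exchange_big/= mulr_sumr.
  have -> : d%:R * 2 ^+ k0 = \sum_(i < d) 2 ^+ k0 :> R.
    by rewrite sumr_const card_ord -[RHS]mulr_natl.
  rewrite -big_split/=; apply: ler_sum => i _.
  have [yi|yi] := leP (2 ^+ k0) `|y 0 i|.
    apply: (le_trans (le_sum_dyadic_cos yi (le_lt_trans (normr_coord_le _ _) yn))).
    by rewrite lerDr exprn_ge0.
  apply: (le_trans (ltW yi)); rewrite lerDl.
  apply: mulr_ge0; first exact: dyadic_const_ge0.
  apply: sumr_ge0 => j _; apply: mulr_ge0; first exact: exprn_ge0.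
  exact: cos_subr1_ge0.
have : d%:R * 2 ^+ k0 <= d.+1%:R * 2 ^+ k0 :> R.
  by rewrite ler_pM2r// ler_nat.
set X := \sum_(j < n) _ in key *.
move: hy key; set p := d%:R * _; rewrite -mulrA; set q := d.+1%:R * _.
rewrite -[2 * _ * X]mulrA; set w := dyadic_const * X; lra.
Qed.

(** Outside a large ball the norm is below a multiple of the sum of the
    [2^k (1 - cos (y_i / 2^k))] over [k >= k0]. Against [s nu] the tail of this
    series is small, and the errors of [mu_cos], of order [s^2 2^-k], are
    summable. *)
Lemma small_time_uniform_integrability e : 0 < e -> exists2 L : R, 0 < L &
  \forall s \near 0^'+,
    (\int[mu s]_(y in [set y | (L < norm2 y)%R]) (norm2 y)%:E <= (e * s)%:E)%E.
Proof.
move=> e0.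
pose c : R := 2 * dyadic_const.
have c0 : 0 <= c by rewrite mulr_ge0// dyadic_const_ge0.
have c1 : 0 < c + 1 by lra.
have ee : 0 < e / 2 / (c + 1) by rewrite !divr_gt0.
have [k0 hk0] : exists k0, forall n, \sum_(j < n) \int[nu]_y T (k0 + j) y <= e / 2 / (c + 1).
  apply: (@nneg_series_small_tail _ (fun k => \int[nu]_y T k y)
    (\int[nu]_y (12 * d%:R * mean_weight y))) => //.
    by move=> k; exact: Rintegral_ge0.
  move=> n; rewrite -Rintegral_levy_sum//.
  apply: le_Rintegral => //.
    by apply: levy_dom_integrable => //; exact: levy_dom_sum.
  rewrite (_ : EFin \o _ = (fun y => (12 * d%:R)%:E * (EFin \o mean_weight) y)%E)//.
  by apply: integrableZl => //; exact: mean_weight_integrable.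
exists (2 * d.+1%:R * 2 ^+ k0); first by rewrite !mulr_gt0 ?exprn_gt0.
set L := 2 * d.+1%:R * 2 ^+ k0.
have mE : measurable [set y : 'rV[R]_d | L < norm2 y] by exact: measurable_norm2_lt.
have mT k : measurable_fun setT (fun y => (c * T k y)%:E).
  by apply/measurable_EFinP; apply: measurable_funM => //; case: (T_dom k).
near=> s; have s0 : 0 < s by [].
have sB : s <= e / 2 / (c * (2 * B) + 1).
  near: s; apply: nbhs_right_le; rewrite !divr_gt0// ltr_wpDl//.
  exact: mulr_ge0 c0 (mulr_ge0 (ler0n _ 2) B_ge0).
apply: (@le_trans _ _ (\int[mu s]_(y in [set y | (L < norm2 y)%R])
    \sum_(0 <= j <oo) (c * T (k0 + j) y)%:E)%E).
  apply: ge0_le_integral => //.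
  - by move=> y _; rewrite lee_fin norm2_ge0.
  - by apply: measurable_funTS; apply/measurable_EFinP; exact: measurable_norm2.
  - apply: measurable_funTS; apply: ge0_emeasurable_sum => // j y _ _.
    by rewrite lee_fin mulr_ge0.
  - move=> y /= /le_sum_T[n hn].
    apply: le_trans (nneseries_lim_ge n _); last first.
      by move=> j _ _; rewrite lee_fin mulr_ge0.
    by rewrite sumEFin lee_fin big_mkord -mulr_sumr.
apply: (@le_trans _ _ (\int[mu s]_y \sum_(0 <= j <oo) (c * T (k0 + j) y)%:E)%E).
  apply: ge0_subset_integral => //.
  - apply: ge0_emeasurable_sum => // j y _ _.
    by rewrite lee_fin mulr_ge0.
  - by move=> y _; apply: nneseries_ge0 => j _ _; rewrite lee_fin mulr_ge0.
rewrite integral_nneseries//; last by move=> j y _; rewrite lee_fin mulr_ge0.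
apply: lime_le.
  apply: is_cvg_nneseries => j _ _; apply: integral_ge0 => y _.
  by rewrite lee_fin mulr_ge0.
apply: nearW => n.
have TE j : (\int[mu s]_y (c * T j y)%:E)%E = (c * \int[mu s]_y T j y)%:E.
  have iT := levy_dom_integrable_proba (mu s) (T_dom j).
  rewrite -RintegralZl// /Rintegral fineK//.
  have iT' := levy_dom_integrable_proba (mu s) (levy_domZ c (T_dom j)).
  exact: integrable_fin_num.
under eq_bigr do rewrite TE.
rewrite sumEFin lee_fin big_mkord -mulr_sumr.
have hs : \sum_(j < n) \int[mu s]_y T (k0 + j) y <=
    s * (e / 2 / (c + 1)) + s ^+ 2 * (2 * B).
  apply: (@le_trans _ _ (\sum_(j < n) (s * \int[nu]_y T (k0 + j) y +
      s ^+ 2 * (B * 2^-1 ^+ (k0 + j))))).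
    by apply: ler_sum => j _; exact/T_mu/ltW.
  rewrite big_split/= -!mulr_sumr lerD//; first by rewrite ler_pM2l//; exact: hk0.
  rewrite ler_wpM2l ?sqr_ge0// mulrC ler_wpM2r//.
  apply: (@le_trans _ _ (\sum_(j < n) 2^-1 ^+ j)).
    apply: ler_sum => j _; rewrite exprD ler_piMl ?exprn_ge0 ?invr_ge0//.
    by rewrite exprn_ile1// ?invr_ge0// invf_le1// ler1n.
  have -> : \sum_(j < n) 2^-1 ^+ j = 2 * (1 - 2^-1 ^+ n) :> R.
    elim: (n) => [|m IH]; first by rewrite big_ord0 expr0 subrr mulr0.
    by rewrite big_ord_recr/= IH exprS; field.
  have qn : 0 <= 2^-1 ^+ n :> R by rewrite exprn_ge0// invr_ge0.
  lra.
apply: (le_trans (ler_wpM2l c0 hs)).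
have h1 : c * (s * (e / 2 / (c + 1))) <= s * (e / 2).
  rewrite mulrCA ler_pM2l// mulrA ler_pdivrMr// mulrC ler_pM2l ?divr_gt0//.
  by rewrite lerDl.
have h2 : c * (s ^+ 2 * (2 * B)) <= s * (e / 2).
  have cB : 0 <= c * (2 * B) by exact: mulr_ge0 c0 (mulr_ge0 (ler0n _ 2) B_ge0).
  move: sB; rewrite ler_pdivlMr; last by lra.
  move=> sB; have -> : c * (s ^+ 2 * (2 * B)) = s * (s * (c * (2 * B))) by ring.
  rewrite ler_pM2l//; apply: le_trans sB; rewrite ler_pM2l//; lra.
lra.
Unshelve. all: by end_near. Qed.

End uniform_integrability.

(** * The characteristic exponent *)

Section characteristic_exponent.
Context {R : realType} {d : nat} (nu : {measure set 'rV[R]_d -> \bar R}).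
Hypothesis nu_levy : levy_measure nu.
Hypothesis M1 : (M_ nu 1 < +oo)%E.
Variable b0 : 'rV[R]_d.
Implicit Types (u y : 'rV[R]_d).

(** In absolute value, the real and the imaginary part of the exponent at [u]
    are at most [exponent_bound * (|u| + |u|^2)]. That they are [O(|u|)] for small [u], and
    not only bounded, uses the first moment of [nu] outside the unit ball; the
    dyadic errors are summable for this reason. *)
Definition exponent_bound : R := \int[nu]_y mean_weight y + norm2 b0.

Lemma mean_weight_ge0 y : 0 <= mean_weight y.
Proof. by rewrite addr_ge0 ?levy_weight_ge0 ?mulr_ge0 ?norm2_ge0. Qed.

Lemma Re_char_exponent u :
  complex.Re (char_exponent b0 nu u) = - \int[nu]_y (1 - cos (dotp u y)).
Proof.
rewrite /char_exponent /cintegral /=.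
under eq_Rintegral do rewrite expR0 mul1r oppr0 addr0 -opprB.
under eq_Rintegral do rewrite -mulN1r.
rewrite RintegralZl//; last first.
  by apply: levy_dom_integrable => //; exact: levy_dom_cos.
by rewrite add0r mulN1r.
Qed.

Let dotp_sqr u y : dotp u y ^+ 2 <= norm2 u ^+ 2 * norm2 y ^+ 2.
Proof.
rewrite -(real_normK (num_real (dotp _ _))) -exprMn.
by rewrite lerXn2r ?nnegrE ?mulr_ge0 ?norm2_ge0// dotp_le_norm2.
Qed.

Let cos_le_mean_weight u y :
  1 - cos (dotp u y) <= (norm2 u + norm2 u ^+ 2) * mean_weight y.
Proof.
have u0 := norm2_ge0 u; have y0 := norm2_ge0 y.
have h1 := cos_subr1_le_norm (dotp u y); have h2 := cos_subr1_le_sqr (dotp u y).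
have h3 := dotp_le_norm2 u y; have h4 := dotp_sqr u y.
have u2 := sqr_ge0 (norm2 u); have y2 := sqr_ge0 (norm2 y).
rewrite /mean_weight indicE; have [y1|y1] := leP (norm2 y) 1.
  rewrite memNset ?mulr0 ?addr0/=; last by apply/negP; rewrite -leNgt.
  rewrite /levy_weight min_l; last by rewrite exprn_ile1// norm2_ge0.
  by nra.
by rewrite mem_set//= mulr1; have := levy_weight_ge0 y; nra.
Qed.

Let sin_le_mean_weight u y :
  `|sin (dotp u y) - dotp u y * \1_[set z | norm2 z <= 1] y| <=
  (norm2 u + norm2 u ^+ 2) * mean_weight y.
Proof.
have u0 := norm2_ge0 u; have y0 := norm2_ge0 y.
have h1 := normr_sin_le (dotp u y); have h2 := sin_sub_le_sqr (dotp u y).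
have h3 := dotp_le_norm2 u y; have h4 := dotp_sqr u y.
have u2 := sqr_ge0 (norm2 u); have y2 := sqr_ge0 (norm2 y).
rewrite /mean_weight !indicE; have [y1|y1] := leP (norm2 y) 1.
  rewrite mem_set// memNset ?mulr0 ?addr0/=; last by apply/negP; rewrite -leNgt.
  rewrite /levy_weight min_l; last by rewrite exprn_ile1// norm2_ge0.
  by rewrite mulr1; nra.
rewrite memNset/=; last by apply/negP; rewrite -ltNge.
by rewrite mem_set//= mulr1 mulr0 subr0; have := levy_weight_ge0 y; nra.
Qed.

Let bound_integrable u : nu.-integrable setT
  (EFin \o (fun y => (norm2 u + norm2 u ^+ 2) * mean_weight y)).
Proof.
rewrite (_ : _ \o _ =
  (fun y => (norm2 u + norm2 u ^+ 2)%:E * (EFin \o mean_weight) y)%E)//.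
by apply: integrableZl => //; exact: mean_weight_integrable.
Qed.

Let u_bound u := norm2 u + norm2 u ^+ 2.

Let u_bound_ge0 u : 0 <= u_bound u.
Proof. by rewrite addr_ge0 ?norm2_ge0 ?sqr_ge0. Qed.

Let nuW_ge0 : 0 <= \int[nu]_y mean_weight y.
Proof. by apply: Rintegral_ge0 => y _; exact: mean_weight_ge0. Qed.

Lemma exponent_bound_ge0 : 0 <= exponent_bound.
Proof. by rewrite addr_ge0 ?norm2_ge0. Qed.

Lemma Re_char_exponent_le u :
  \int[nu]_y (1 - cos (dotp u y)) <= u_bound u * exponent_bound.
Proof.
apply: (@le_trans _ _ (u_bound u * \int[nu]_y mean_weight y)).
  rewrite -RintegralZl//; last exact: mean_weight_integrable.
  apply: le_Rintegral => //.
    by apply: levy_dom_integrable => //; exact: levy_dom_cos.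
  exact: bound_integrable.
by rewrite ler_wpM2l// lerDl norm2_ge0.
Qed.

Lemma Im_char_exponent_le u :
  `|complex.Im (char_exponent b0 nu u)| <= u_bound u * exponent_bound.
Proof.
rewrite /char_exponent /cintegral /=.
under eq_Rintegral do rewrite expR0 mul1r oppr0 addr0.
set F := fun y => sin (dotp u y) - dotp u y * \1_[set z | norm2 z <= 1] y.
have mF : measurable_fun setT F.
  apply: measurable_funB.
    apply: measurableT_comp; last exact: measurable_dotp.
    by apply: continuous_measurable_fun; exact: continuous_sin.
  apply: measurable_funM; first exact: measurable_dotp.
  by apply: measurable_indic; exact: measurable_norm2_le.
have iF : nu.-integrable setT (EFin \o F).
  apply: (le_integrable _ _ _ (bound_integrable u)) => //.
    exact/measurable_EFinP.
  move=> y _ /=; rewrite lee_fin (le_trans (sin_le_mean_weight u y))//.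
  by rewrite ler_norm.
rewrite (le_trans (ler_normD _ _))// /exponent_bound mulrDr addrC lerD//.
  apply: (le_trans (le_normr_Rintegral _ iF)) => //.
  rewrite -RintegralZl//; last exact: mean_weight_integrable.
  apply: le_Rintegral => //.
  - exact: (integrable_abse iF).
  - exact: bound_integrable.
  - by move=> y _; exact: sin_le_mean_weight.
rewrite (le_trans (dotp_le_norm2 _ _))// ler_wpM2r ?norm2_ge0//.
by rewrite lerDl sqr_ge0.
Qed.

(** With [x = s a] and [y = s b] the characteristic function is
    [exp (- x) cos y], which differs from [1 - x] by [O(x^2 + y^2)]. *)
Lemma expcos_sub (x y : R) : 0 <= x ->
  `|1 - expR (- x) * cos y - x| <= x ^+ 2 + y ^+ 2.
Proof.
move=> x0.
have h1 := expRN_ge x; have h2 := expRN_le x0; have h3 := expRN_le1 x0.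
have h4 := expR_ge0 (- x); have h5 := cos_subr1_ge0 y; have h6 := cos_subr1_le_sqr y.
have y2 := sqr_ge0 y; have x2 := sqr_ge0 x.
set E := expR (- x) in h1 h2 h3 h4 *.
have h7 : E * (1 - cos y) <= y ^+ 2 / 2.
  by apply: le_trans h6; rewrite ler_piMl.
have h8 : 0 <= E * (1 - cos y) by rewrite mulr_ge0.
have -> : 1 - E * cos y - x = (1 - E) + E * (1 - cos y) - x by ring.
by rewrite ler_norml; apply/andP; split; lra.
Qed.

Lemma char_exponent_gap (m : probability 'rV[R]_d R) s u : 0 <= s ->
  \int[m]_y cos (dotp u y) = complex.Re (cexp (s%:C * char_exponent b0 nu u)%C) ->
  `|gap nu m s (fun y => 1 - cos (dotp u y))| <=
  s ^+ 2 * (4 * exponent_bound ^+ 2 * (norm2 u ^+ 2 + norm2 u ^+ 4)).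
Proof.
move=> s0 mE; rewrite /gap RintegralB//; last 2 first.
- by apply: (@bounded_integrable R d m _ 1) => // y; rewrite normr1.
- apply: (@bounded_integrable R d m _ 1) => [|y]; last exact: cos_max.
  exact: measurable_cos_dotp.
rewrite Rintegral_cst//= probability_setT/= mulr1 mE.
have RE := Re_char_exponent u.
have h1 := Re_char_exponent_le u; have h2 := Im_char_exponent_le u.
set z := char_exponent b0 nu u in RE h2 *.
set a := Rintegral _ _ _ in RE h1 *.
have a0 : 0 <= a by apply: Rintegral_ge0 => y _; exact: cos_subr1_ge0.
have -> : complex.Re (cexp (s%:C * z)%C) = expR (- (s * a)) * cos (s * complex.Im z).
  by case: z RE h2 => zr zi /= -> _; rewrite !mul0r subr0 addr0 mulrN.
apply: (le_trans (expcos_sub _ (mulr_ge0 s0 a0))).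
rewrite !exprMn -mulrDr ler_wpM2l ?sqr_ge0//.
have k0 := exponent_bound_ge0; have ub0 := u_bound_ge0 u.
have p0 : 0 <= u_bound u * exponent_bound by rewrite mulr_ge0.
have a2 : a ^+ 2 <= (u_bound u * exponent_bound) ^+ 2 by rewrite lerXn2r ?nnegrE.
have z2 : complex.Im z ^+ 2 <= (u_bound u * exponent_bound) ^+ 2.
  rewrite -(real_normK (num_real (complex.Im z))).
  by rewrite lerXn2r ?nnegrE.
apply: (le_trans (lerD a2 z2)); rewrite exprMn.
have -> : norm2 u ^+ 4 = norm2 u ^+ 2 * norm2 u ^+ 2 by rewrite -exprD.
rewrite /u_bound; have := sqr_ge0 (norm2 u - norm2 u ^+ 2).
have := sqr_ge0 exponent_bound.
set n := norm2 u; set K := exponent_bound ^+ 2 => K0 n0.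
by nra.
Qed.

End characteristic_exponent.

(** * Independence and product measures *)

Definition to_mfun d1 d2 (T1 : measurableType d1) (T2 : measurableType d2)
    (f : T1 -> T2) (mf : measurable_fun setT f) : {mfun T1 >-> T2} :=
  HB.pack f (isMeasurableFun.Build _ _ _ _ f mf).

Section independent_pair.
Context {dT} {T : measurableType dT} {R : realType} (P : probability T R).
Context {d1} {T1 : measurableType d1} {d2} {T2 : measurableType d2}.
Variables (X : T -> T1) (Y : T -> T2) (Q : probability T2 R).
Hypotheses (mX : measurable_fun setT X) (mY : measurable_fun setT Y).

Let mXY : measurable_fun setT (fun w => (X w, Y w)).
Proof. exact: measurable_fun_pair. Qed.

(** Two finite measures on the product agree on rectangles, hence everywhere:
    [Z |-> P((X, Y) in Z and E)], and [c] times the joint law of [(X, Y)]. *)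
Lemma independent_pair_event (E : set T) (c : {nonneg R}) :
  measurable E ->
  (forall B A, measurable B -> measurable A ->
    P (X @^-1` B `&` Y @^-1` A) = (P (X @^-1` B) * Q A)%E) ->
  (forall B A, measurable B -> measurable A ->
    P (X @^-1` B `&` Y @^-1` A `&` E) = (P (X @^-1` B) * Q A * c%:num%:E)%E) ->
  forall Z, measurable Z ->
    P ([set w | Z (X w, Y w)] `&` E) = (P [set w | Z (X w, Y w)] * c%:num%:E)%E.
Proof.
move=> mE hXY hXYE Z mZ.
pose phi := to_mfun mXY.
pose law := distribution P (to_mfun mX).
pose push : {measure set (T1 * T2) -> \bar R} :=
  pushforward (mrestr P mE) phi.
pose m1 := push mXY.
pose m2 : {measure set (T1 * T2) -> \bar R} := mscale c (distribution P phi).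
have -> : P ([set w | Z (X w, Y w)] `&` E) = m1 Z by [].
transitivity (m2 Z); last by rewrite /m2 /= /mscale/= muleC.
rewrite -(@product_measure_unique _ _ _ _ _ law (mscale c Q) m1)//.
  apply: (@product_measure_unique _ _ _ _ _ law (mscale c Q) m2) => // B A mB mA.
  rewrite /m2 /= /mscale /= muleCA; congr (_ * _)%E.
  by rewrite /distribution /pushforward -hXY.
move=> B A mB mA; rewrite /= /mscale /= muleCA muleC.
by rewrite /law /distribution /pushforward/= -hXYE.
Qed.

Lemma independent_pair_integral (F : T1 * T2 -> \bar R) :
  (forall B A, measurable B -> measurable A ->
    P (X @^-1` B `&` Y @^-1` A) = (P (X @^-1` B) * Q A)%E) ->
  measurable_fun setT F -> (forall z, 0 <= F z)%E ->
  (\int[P]_w F (X w, Y w) = \int[P]_w \int[Q]_y F (X w, y))%E.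
Proof.
move=> hXY mF F0.
pose phi := to_mfun mXY.
pose law := distribution P (to_mfun mX).
have -> : (\int[P]_w F (X w, Y w) = \int[distribution P phi]_z F z)%E.
  by rewrite ge0_integral_distribution.
rewrite (eq_measure_integral (law \x Q)%E); last first.
  move=> Z mZ _; apply/esym; exact: product_measure_unique.
rewrite fubini_tonelli1// ge0_integral_distribution//.
  exact: measurable_fun_fubini_tonelli_F.
by move=> x; apply: integral_ge0.
Qed.

End independent_pair.

(** * Exponential moments of Lipschitz functions of independent sums *)

(** Bennett's argument: [exp (lam (phi - c))] is at most
    [1 + lam (phi - c) + rho^2 (e^(lam r) - 1 - lam r) / r^2] because
    [|phi - c| <= rho <= r], and [1 + x <= e^x] after integration. *)
Section bennett_step.
Context {R : realType} {d : nat} (Q : probability 'rV[R]_d R).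

Lemma bennett_step (phi rho : 'rV[R]_d -> R) (c r lam : R) :
  measurable_fun setT phi -> measurable_fun setT rho ->
  (forall y, `|phi y - c| <= rho y) -> (forall y, rho y <= r) ->
  0 < r -> 0 < lam ->
  \int[Q]_y expR (lam * phi y) <=
  expR (lam * \int[Q]_y phi y +
        (expR (lam * r) - 1 - lam * r) / r ^+ 2 * \int[Q]_y (rho y ^+ 2)).
Proof.
move=> mphi mrho hphi hrho r0 lam0.
have lr0 : 0 < lam * r by rewrite mulr_gt0.
set kap := (expR (lam * r) - 1 - lam * r) / r ^+ 2.
have kap0 : 0 <= kap.
  rewrite divr_ge0 ?sqr_ge0//; have := expR_ge1Dx (lam * r); lra.
have rho0 y : 0 <= rho y by rewrite (le_trans (normr_ge0 _) (hphi y)).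
have phib y : `|phi y| <= `|c| + r.
  rewrite -[phi y](subrK c) (le_trans (ler_normD _ _))// addrC lerD2l.
  by rewrite (le_trans (hphi y)).
have iphi : Q.-integrable setT (EFin \o phi) by exact: bounded_integrable phib.
have irho : Q.-integrable setT (EFin \o (fun y => rho y ^+ 2)).
  apply: (@bounded_integrable _ _ Q _ (r ^+ 2)) => [|y].
    exact: measurable_funX.
  by rewrite ger0_norm ?sqr_ge0// lerXn2r ?nnegrE// ltW.
have mexp : measurable_fun setT (fun y => expR (lam * phi y)).
  apply: measurableT_comp; first exact: measurable_expR.
  exact: measurable_funM.
have iexp : Q.-integrable setT (EFin \o (fun y => expR (lam * phi y))).
  apply: (@bounded_integrable _ _ Q _ (expR (lam * (`|c| + r)))) => // y.
  rewrite ger0_norm ?expR_ge0// ler_expR ler_pM2l//.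
  by rewrite (le_trans (ler_norm _)).
have i1 (a : R) : Q.-integrable setT (EFin \o (fun=> a)).
  by apply: (@bounded_integrable _ _ Q _ `|a|).
have icomb : Q.-integrable setT (EFin \o
    (fun y => (1 - lam * c) + (lam * phi y + kap * rho y ^+ 2))).
  apply: (@bounded_integrable _ _ Q _ (`|1 - lam * c| + (lam * (`|c| + r) + kap * r ^+ 2))).
    apply: measurable_funD => //; apply: measurable_funD.
      exact: measurable_funM.
    by apply: measurable_funM => //; exact: measurable_funX.
  move=> y; rewrite (le_trans (ler_normD _ _))// lerD2l (le_trans (ler_normD _ _))//.
  rewrite (normrM lam) (normrM kap) (ger0_norm (ltW lam0)) (ger0_norm kap0) lerD//.
    by rewrite ler_pM2l.
  by rewrite ler_wpM2l// ger0_norm ?sqr_ge0// lerXn2r ?nnegrE// ltW.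
have pointwise y : expR (- (lam * c)) * expR (lam * phi y) <=
    (1 - lam * c) + (lam * phi y + kap * rho y ^+ 2).
  rewrite -expRD.
  have -> : - (lam * c) + lam * phi y = lam * (phi y - c) by ring.
  have hx : `|lam * (phi y - c)| <= lam * r.
    by rewrite normrM (ger0_norm (ltW lam0)) ler_pM2l// (le_trans (hphi y)).
  have := expR_sub_le lr0 hx.
  have -> : (lam * (phi y - c) / (lam * r)) ^+ 2 * (expR (lam * r) - 1 - lam * r)
      = kap * (phi y - c) ^+ 2.
    by rewrite /kap; field; rewrite !gt_eqF.
  have : kap * (phi y - c) ^+ 2 <= kap * rho y ^+ 2.
    rewrite ler_wpM2l// -(real_normK (num_real (phi y - c))).
    by rewrite lerXn2r ?nnegrE.
  lra.
have h : expR (- (lam * c)) * \int[Q]_y expR (lam * phi y) <=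
    1 + (lam * \int[Q]_y phi y - lam * c + kap * \int[Q]_y (rho y ^+ 2)).
  rewrite -RintegralZl//.
  have iZ : Q.-integrable setT (EFin \o (fun y => expR (- (lam * c)) * expR (lam * phi y))).
    rewrite (_ : EFin \o _ = (fun y => (expR (- (lam * c)))%:E *
      (EFin \o (fun y => expR (lam * phi y)%R)) y)%E)//.
    exact: integrableZl.
  apply: (le_trans (le_Rintegral _ iZ icomb _)) => //.
  have ilphi : Q.-integrable setT (EFin \o (fun y => lam * phi y)).
    rewrite (_ : EFin \o _ = (fun y => lam%:E * (EFin \o phi) y)%E)//.
    exact: integrableZl.
  have ikrho : Q.-integrable setT (EFin \o (fun y => kap * rho y ^+ 2)).
    rewrite (_ : EFin \o _ = (fun y => kap%:E * (EFin \o (fun y => (rho y ^+ 2)%R)) y)%E)//.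
    exact: integrableZl.
  rewrite RintegralD//; last first.
    rewrite (_ : EFin \o _ = (EFin \o (fun y => lam * phi y)) \+
      (EFin \o (fun y => kap * rho y ^+ 2)))//.
    exact: integrableD.
  rewrite (RintegralD _ ilphi ikrho)// !RintegralZl// Rintegral_cst//=.
  rewrite probability_setT/=; lra.
have := expR_ge1Dx (lam * \int[Q]_y phi y - lam * c + kap * \int[Q]_y (rho y ^+ 2)).
move=> /(le_trans h).
have -> : lam * \int[Q]_y phi y - lam * c + kap * \int[Q]_y (rho y ^+ 2) =
  - (lam * c) + (lam * \int[Q]_y phi y + kap * \int[Q]_y (rho y ^+ 2)) by ring.
by rewrite expRD ler_pM2l// expR_gt0.
Qed.

End bennett_step.

Lemma integral_addc dT (T : measurableType dT) (R : realType)
    (m : probability T R) (h : T -> R) (M : R) :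
  m.-integrable setT (EFin \o h) ->
  (\int[m]_w (h w + M)%:E = ((\int[m]_w h w)%R + M)%:E)%E.
Proof.
move=> ih.
have ic : m.-integrable setT (EFin \o cst M).
  exact: finite_measure_integrable_cst.
under eq_integral do rewrite EFinD.
rewrite integralD//= integral_cst//= probability_setT mule1 EFinD fineK//.
exact: integrable_fin_num.
Qed.

Section independent_sum.
Context {dT} {T : measurableType dT} {R : realType} (P : probability T R).
Context {d : nat} (n : nat) (xi : nat -> {RV P >-> 'rV[R]_d}).
Variable Q : probability 'rV[R]_d R.
Hypothesis indep : forall A : nat -> set 'rV[R]_d, (forall i, measurable (A i)) ->
  P [set w | forall i, (0 <= i < n)%N -> A i (xi i w)] =
  (\prod_(0 <= i < n) fine (Q (A i)))%:E.
Variables (g : 'rV[R]_d -> 'rV[R]_d) (r : R).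
Hypotheses (mg : measurable_fun setT g) (r0 : 0 < r).
Hypothesis g_le : forall y, norm2 (g y) <= r.

Definition psum k w : 'rV[R]_d := \sum_(0 <= i < k) g (xi i w).

Lemma psumS k w : psum k.+1 w = psum k w + g (xi k w).
Proof. by rewrite /psum big_nat_recr. Qed.

Lemma measurable_psum k : measurable_fun setT (psum k).
Proof.
elim: k => [|k IH].
  rewrite (_ : psum 0 = cst 0); first exact: measurable_cst.
  by apply/funext => w; rewrite /psum big_geq.
rewrite (_ : psum k.+1 = (fun w => psum k w + g (xi k w))); last first.
  by apply/funext => w; exact: psumS.
apply: measurable_rVD => //; exact: measurableT_comp.
Qed.

Let later k (A : nat -> set 'rV[R]_d) : set T :=
  [set w | forall i, (k <= i < n)%N -> A i (xi i w)].

Let measurable_later k A : (forall i, measurable (A i)) -> measurable (later k A).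
Proof.
move=> mA.
rewrite (_ : later k A = \bigcap_(i in [set i | (k <= i < n)%N]) (xi i @^-1` A i)).
  apply: bigcap_measurableType => i _.
  by rewrite -[_ @^-1` _]setTI; exact: measurable_funP.
by apply/seteqP; split => w h i hi; exact: h.
Qed.

Let measurable_step : measurable_fun setT (fun z : 'rV[R]_d * 'rV[R]_d => z.1 + g z.2).
Proof.
apply: measurable_rVD; first exact: measurable_fst.
by apply: measurableT_comp => //; exact: measurable_snd.
Qed.

(** Strong enough to be proved by induction on [k]: the joint law of the partial
    sum and the next step is known by the case [k], and the event on the later
    steps comes along by [independent_pair_event]. *)
Lemma psum_independent_later k : (k <= n)%N -> forall B A, measurable B ->
  (forall i, measurable (A i)) ->
  P (psum k @^-1` B `&` later k A) =
  (P (psum k @^-1` B) * (\prod_(k <= i < n) fine (Q (A i)))%:E)%E.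
Proof.
elim: k => [_|k IH kn] B A mB mA.
  have [B0|B0] := pselect (B 0).
    rewrite (_ : psum 0 @^-1` B = setT); last first.
      by apply/seteqP; split => // w _; rewrite /= /psum big_geq.
    by rewrite setTI probability_setT mul1e indep.
  rewrite (_ : psum 0 @^-1` B = set0); last first.
    by apply/seteqP; split => // w; rewrite /= /psum big_geq.
  by rewrite set0I measure0 mul0e.
pose A1 (U : set 'rV[R]_d) i := if i == k then U else setT.
pose A2 (U : set 'rV[R]_d) i := if i == k then U else A i.
have mA1 U : measurable U -> forall i, measurable (A1 U i).
  by move=> mU i; rewrite /A1; case: ifP.
have mA2 U : measurable U -> forall i, measurable (A2 U i).
  by move=> mU i; rewrite /A2; case: ifP.
have l1 U : later k (A1 U) = xi k @^-1` U.
  apply/seteqP; split => w /=.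
    by move=> /(_ k); rewrite leqnn kn /A1 eqxx; exact.
  by move=> Uw i _; rewrite /A1; case: eqP => // ->.
have l2 U : later k (A2 U) = xi k @^-1` U `&` later k.+1 A.
  apply/seteqP; split => w /=.
    move=> h; split; first by have := h k; rewrite leqnn kn /A2 eqxx; exact.
    move=> i /andP[ki i_n]; have := h i; rewrite i_n (ltnW ki)/= /A2 gtn_eqF//.
    exact.
  move=> [Uw h] i /andP[ki i_n]; rewrite /A2; case: eqP => [-> //|/eqP ik].
  by apply: h; rewrite i_n ltn_neqAle eq_sym ik ki.
have p1 U : \prod_(k <= i < n) fine (Q (A1 U i)) = fine (Q U).
  rewrite big_ltn// {1}/A1 eqxx big1_seq ?mulr1// => i.
  rewrite mem_index_iota => /andP[_ /andP[ki _]].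
  by rewrite /A1 gtn_eqF// probability_setT.
have p2 U : \prod_(k <= i < n) fine (Q (A2 U i)) =
    fine (Q U) * \prod_(k.+1 <= i < n) fine (Q (A i)).
  rewrite big_ltn// {1}/A2 eqxx; congr (_ * _); apply: eq_big_nat => i /andP[ki _].
  by rewrite /A2 gtn_eqF.
have c0 : 0 <= \prod_(k.+1 <= i < n) fine (Q (A i)).
  by apply: prodr_ge0 => i _; rewrite fine_ge0.
have fQ U : measurable U -> (fine (Q U))%:E = Q U.
  by move=> mU; rewrite fineK// fin_num_measure.
pose Z : set ('rV[R]_d * 'rV[R]_d) := [set z | B (z.1 + g z.2)].
have mZ : measurable Z by rewrite -[Z]setTI; exact: measurable_step.
have -> : psum k.+1 @^-1` B = [set w | Z (psum k w, xi k w)].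
  by apply/seteqP; split => w; rewrite /Z /= psumS.
apply: (@independent_pair_event _ _ _ P _ _ _ _ (psum k) (xi k) Q
  (measurable_psum k) (measurable_funP (xi k)) (later k.+1 A) (NngNum c0)) => //.
- exact: measurable_later.
- by move=> U W mU mW; rewrite -l1 IH ?(ltnW kn)// ?p1 ?fQ//; exact: mA1.
- move=> U W mU mW; rewrite -setIA -l2 IH ?(ltnW kn)//; last exact: mA2.
  by rewrite p2 EFinM fQ// muleA.
Qed.

Lemma psum_step_integral k (F : 'rV[R]_d * 'rV[R]_d -> \bar R) : (k < n)%N ->
  measurable_fun setT F -> (forall z, 0 <= F z)%E ->
  (\int[P]_w F (psum k w, xi k w) = \int[P]_w \int[Q]_y F (psum k w, y))%E.
Proof.
move=> kn mF F0; apply: independent_pair_integral => //.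
  exact: measurable_psum.
move=> B U mB mU.
pose A1 i := if i == k then U else setT.
have mA1 i : measurable (A1 i) by rewrite /A1; case: ifP.
have -> : xi k @^-1` U = later k A1.
  apply/seteqP; split => w /=.
    by move=> Uw i _; rewrite /A1; case: eqP => // ->.
  by move=> /(_ k); rewrite leqnn kn /A1 eqxx; exact.
rewrite psum_independent_later ?(ltnW kn)//; congr (_ * _)%E.
rewrite big_ltn// {1}/A1 eqxx big1_seq ?mulr1 ?fineK ?fin_num_measure// => i.
rewrite mem_index_iota => /andP[_ /andP[ki _]].
by rewrite /A1 gtn_eqF// probability_setT.
Qed.

Lemma norm2_psum k w : norm2 (psum k w) <= k%:R * r.
Proof.
elim: k => [|k IH]; first by rewrite /psum big_geq// norm2_0 mul0r.
by rewrite psumS (le_trans (norm2D _ _))// -natr1 mulrDl mul1r lerD.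
Qed.

Let smooth (f : 'rV[R]_d -> R) x : R := \int[Q]_y f (x + g y).

Let measurable_shift (f : 'rV[R]_d -> R) x : lipschitz1 f ->
  measurable_fun setT (fun y => f (x + g y)).
Proof.
move=> lf; apply: measurableT_comp; first exact: lipschitz1_measurable.
exact: measurable_rVD.
Qed.

Let shift_bound f x y : lipschitz1 f -> `|f (x + g y) - f x| <= norm2 (g y).
Proof. by move=> lf; rewrite (le_trans (lf _ _))// addrC addKr. Qed.

Let shift_integrable f x : lipschitz1 f ->
  Q.-integrable setT (EFin \o (fun y => f (x + g y))).
Proof.
move=> lf; apply: (@bounded_integrable _ _ Q _ (`|f x| + r)) => [|y].
  exact: measurable_shift.
rewrite -[f _](subrK (f x)) (le_trans (ler_normD _ _))// addrC lerD2l.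
by rewrite (le_trans (shift_bound _ _ lf)).
Qed.

Let smooth_lipschitz f : lipschitz1 f -> lipschitz1 (smooth f).
Proof.
move=> lf x x'; rewrite /smooth -RintegralB//; [|exact: shift_integrable..].
have iB : Q.-integrable setT (EFin \o (fun y => f (x + g y) - f (x' + g y))).
  rewrite (_ : EFin \o _ = ((EFin \o (fun y => f (x + g y)%R)) \-
    (EFin \o (fun y => f (x' + g y)%R)))%E)//.
  by apply: integrableB => //; exact: shift_integrable.
apply: (le_trans (le_normr_Rintegral _ iB)) => //.
apply: (@le_trans _ _ (\int[Q]_y (cst (norm2 (x - x'))) y)).
  apply: le_Rintegral => //.
  - exact: (integrable_abse iB).
  - by apply: (@bounded_integrable _ _ Q _ `|norm2 (x - x')|).
  - move=> y _; rewrite (le_trans (lf _ _))//= opprD addrACA subrr addr0//.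
by rewrite Rintegral_cst//= probability_setT/= mulr1.
Qed.

Lemma psum_integrable f k : lipschitz1 f ->
  P.-integrable setT (EFin \o (fun w => f (psum k w))).
Proof.
move=> lf; apply: measurable_bounded_integrable => //.
- by rewrite (le_lt_trans (probability_le1 _ _))// ltry.
- apply: measurableT_comp; first exact: lipschitz1_measurable.
  exact: measurable_psum.
exists (`|f 0| + k%:R * r); split; first exact: num_real.
move=> x hx w _; apply: le_trans (ltW hx).
by rewrite (le_trans (lipschitz1_growth _ lf))// lerD2l norm2_psum.
Qed.

Let smooth_mean f k : (k < n)%N -> lipschitz1 f ->
  \int[P]_w smooth f (psum k w) = \int[P]_w f (psum k.+1 w).
Proof.
move=> kn lf.
(* Fubini is used for nonnegative functions; [M] bounds [- f] on the range of
   the partial sums. *)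
pose M : R := `|f 0| + k%:R * r + r.
have M0 : 0 <= M by rewrite !addr_ge0// ?mulr_ge0// ltW.
have fM x y : norm2 x <= k%:R * r -> 0 <= f (x + g y) + M.
  move=> xk; have := lipschitz1_growth (x + g y) lf; rewrite ler_norml => /andP[h _].
  have := norm2D x (g y); have := g_le y; rewrite /M; lra.
pose F (z : 'rV[R]_d * 'rV[R]_d) : \bar R := (Num.max 0 (f (z.1 + g z.2) + M))%:E.
have mF : measurable_fun setT F.
  apply/measurable_EFinP; apply: measurable_maxr; first exact: measurable_cst.
  apply: measurable_funD; last exact: measurable_cst.
  apply: measurableT_comp; first exact: lipschitz1_measurable.
  exact: measurable_step.
have F0 z : (0 <= F z)%E by rewrite lee_fin le_max lexx.
have key := psum_step_integral kn mF F0.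
have lhs : (\int[P]_w F (psum k w, xi k w) =
    ((\int[P]_w f (psum k.+1 w))%R + M)%:E)%E.
  rewrite -(integral_addc M (psum_integrable k.+1 lf)).
  by apply: eq_integral => w _; rewrite /F/= max_r ?fM ?norm2_psum// -psumS.
have rhs : (\int[P]_w \int[Q]_y F (psum k w, y) =
    ((\int[P]_w smooth f (psum k w))%R + M)%:E)%E.
  rewrite -(integral_addc M (psum_integrable k (smooth_lipschitz lf))).
  apply: eq_integral => w _; rewrite -(integral_addc M (shift_integrable (psum k w) lf)).
  by apply: eq_integral => y _; rewrite /F/= max_r ?fM ?norm2_psum.
by move: key; rewrite lhs rhs => -[/addIr].
Qed.

Let step_var : R := \int[Q]_y (norm2 (g y) ^+ 2).

(** The last step is integrated out by [bennett_step], which replaces [f] by its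
    average [smooth f] over that step; [smooth f] is again 1-Lipschitz and has
    the same mean along the shorter sum. *)
Lemma psum_mgf (lam : R) k f : 0 < lam -> (k <= n)%N -> lipschitz1 f ->
  (\int[P]_w (expR (lam * f (psum k w)))%:E <=
   (expR (lam * (\int[P]_w f (psum k w))%R +
     k%:R * ((expR (lam * r) - 1 - lam * r) / r ^+ 2 * step_var)))%:E)%E.
Proof.
move=> lam0; elim: k f => [|k IH] f kn lf.
  have p0 w : psum 0 w = 0 by rewrite /psum big_geq.
  under eq_integral do rewrite p0.
  under eq_Rintegral do rewrite p0.
  rewrite (Rintegral_cst P measurableT (f 0)) integral_cst//= probability_setT/=.
  by rewrite mule1 mulr1 mul0r addr0.
set beta := _ / _ * step_var in IH *.
pose F (z : 'rV[R]_d * 'rV[R]_d) : \bar R := (expR (lam * f (z.1 + g z.2)))%:E.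
have mF : measurable_fun setT F.
  apply/measurable_EFinP; apply: measurableT_comp; first exact: measurable_expR.
  apply: measurable_funM => //; apply: measurableT_comp.
    exact: lipschitz1_measurable.
  exact: measurable_step.
have F0 z : (0 <= F z)%E by rewrite lee_fin expR_ge0.
have -> : (\int[P]_w (expR (lam * f (psum k.+1 w)))%:E =
    \int[P]_w F (psum k w, xi k w))%E.
  by apply: eq_integral => w _; rewrite /F psumS.
rewrite (psum_step_integral kn mF F0).
apply: (@le_trans _ _ (\int[P]_w ((expR beta)%:E *
    (expR (lam * smooth f (psum k w)))%:E))%E).
  apply: ge0_le_integral => //.
  - by move=> w _; apply: integral_ge0 => y _; exact: F0.
  - apply: (measurableT_comp (measurable_fun_fubini_tonelli_F F mF F0)).
    exact: measurable_psum.
  - apply: measurable_funeM; apply/measurable_EFinP.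
    apply: measurableT_comp; first exact: measurable_expR.
    apply: measurable_funM => //; apply: measurableT_comp; last exact: measurable_psum.
    exact: lipschitz1_measurable (smooth_lipschitz lf).
  - move=> w _.
    have iexp : Q.-integrable setT (EFin \o (fun y => expR (lam * f (psum k w + g y)))).
      apply: (@bounded_integrable _ _ Q _ (expR (lam * (`|f (psum k w)| + r)))) => [|y].
        apply: measurableT_comp; first exact: measurable_expR.
        by apply: measurable_funM => //; exact: measurable_shift.
      rewrite ger0_norm ?expR_ge0// ler_expR ler_pM2l//.
      rewrite -[f _](subrK (f (psum k w))) addrC lerD ?ler_norm//.
      by rewrite (le_trans (ler_norm _))// (le_trans (shift_bound _ _ lf)).
    rewrite -EFinM -expRD /F/= -(@fineK _ (\int[Q]_y _)%E); last first.
      exact: integrable_fin_num iexp.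
    rewrite lee_fin [beta + _]addrC.
    apply: (@bennett_step _ _ Q _ (fun y => norm2 (g y)) (f (psum k w))) => //.
    - exact: measurable_shift.
    - by apply: measurableT_comp => //; exact: measurable_norm2.
    - by move=> y; exact: shift_bound.
rewrite ge0_integralZl//; last first.
  apply/measurable_EFinP; apply: measurableT_comp; first exact: measurable_expR.
  apply: measurable_funM => //; apply: measurableT_comp; last exact: measurable_psum.
  exact: lipschitz1_measurable (smooth_lipschitz lf).
apply: (le_trans (lee_wpmul2l _ (IH _ (ltnW kn) (smooth_lipschitz lf)))).
  by rewrite lee_fin expR_ge0.
rewrite smooth_mean// -EFinM -expRD lee_fin ler_expR -natr1.
by rewrite le_eqVlt; apply/orP; left; apply/eqP; ring.
Qed.

Lemma psum_concentration (lam x : R) f : 0 < lam -> lipschitz1 f ->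
  (P [set w | (x <= f (psum n w) - (\int[P]_w f (psum n w))%R)%R] <=
   (expR (n%:R * ((expR (lam * r) - 1 - lam * r) / r ^+ 2 * step_var) - lam * x))%:E)%E.
Proof.
move=> lam0 lf.
set m := (\int[P]_w f (psum n w))%R; set beta := _ / _ * step_var.
set D := [set w | _].
have mf : measurable_fun setT (fun w => f (psum n w)).
  apply: measurableT_comp; first exact: lipschitz1_measurable.
  exact: measurable_psum.
have mD : measurable D.
  rewrite /D -[X in measurable X]setTI (_ : [set w | _] =
    (fun w => f (psum n w)) @^-1` `[x + m, +oo[); first exact: mf.
  by apply/seteqP; split => w /=; rewrite in_itv/= andbT lerBrDr.
have mexp : measurable_fun setT (fun w => (expR (lam * f (psum n w)))%:E).
  apply/measurable_EFinP; apply: measurableT_comp; first exact: measurable_expR.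
  exact: measurable_funM.
rewrite -[D]setIT -[P _]mul1e setIC -integral_cst ?setTI//.
apply: (@le_trans _ _ (\int[P]_(w in D) ((expR (- (lam * (x + m))))%:E *
    (expR (lam * f (psum n w)))%:E))%E).
  apply: ge0_le_integral => //.
  - by apply: measurable_funTS; exact: measurable_funeM.
  - move=> w; rewrite /D/= => hw; rewrite -EFinM -expRD lee_fin.
    rewrite -expR0 ler_expR addrC -mulrBr mulr_ge0 ?(ltW lam0)//; lra.
apply: (@le_trans _ _ (\int[P]_w ((expR (- (lam * (x + m))))%:E *
    (expR (lam * f (psum n w)))%:E))%E).
  apply: ge0_subset_integral => //; first exact: measurable_funeM.

rewrite ge0_integralZl//.
apply: (le_trans (lee_wpmul2l _ (psum_mgf lam0 (leqnn n) lf))).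
  by rewrite lee_fin expR_ge0.
rewrite -/m -/beta -EFinM -expRD lee_fin ler_expR.
by rewrite le_eqVlt; apply/orP; left; apply/eqP; ring.
Qed.

End independent_sum.

(** * Truncating the steps of a random walk *)

Lemma ge0_sume_const (R : realDomainType) (n : nat) (x : \bar R) : (0 <= x)%E ->
  (\sum_(i < n) x = n%:R%:E * x)%E.
Proof.
move=> x0; elim: n => [|n IH]; first by rewrite big_ord0 mul0e.
by rewrite big_ord_recr/= IH -natr1 EFinD ge0_muleDl// ?mul1e// lee_fin.
Qed.

Section truncated_sum.
Context {dT} {T : measurableType dT} {R : realType} (P : probability T R).
Context {d : nat} (n : nat) (xi : nat -> {RV P >-> 'rV[R]_d}).
Variable Q : probability 'rV[R]_d R.
Hypothesis indep : forall A : nat -> set 'rV[R]_d, (forall i, measurable (A i)) ->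
  P [set w | forall i, (0 <= i < n)%N -> A i (xi i w)] =
  (\prod_(0 <= i < n) fine (Q (A i)))%:E.
Implicit Types (y : 'rV[R]_d) (r : R).

Definition truncate r y : 'rV[R]_d := if norm2 y <= r then y else 0.

Lemma truncate_le r y : 0 < r -> norm2 (truncate r y) <= r.
Proof. by move=> r0; rewrite /truncate; case: ifP => // _; rewrite norm2_0 ltW. Qed.

Lemma measurable_truncate r : measurable_fun setT (truncate r).
Proof.
apply: measurable_fun_rV => i.
rewrite (_ : (fun w => _) = (fun y : 'rV[R]_d => y 0 i * \1_[set y | norm2 y <= r] y)).
  apply: measurable_funM; first exact: measurable_coord.
  by apply: measurable_indic; exact: measurable_norm2_le.
apply/funext => y; rewrite /truncate indicE; case: ifPn => yr.
  by rewrite mem_set// mulr1.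
by rewrite memNset ?mulr0 ?mxE//; apply/negP.
Qed.

Lemma step_law i A : (i < n)%N -> measurable A -> P (xi i @^-1` A) = Q A.
Proof.
move=> i_n mA; pose A1 j := if j == i then A else setT.
have mA1 j : measurable (A1 j) by rewrite /A1; case: ifP.
have -> : xi i @^-1` A = [set w | forall j, (0 <= j < n)%N -> A1 j (xi j w)].
  apply/seteqP; split => w /=.
    by move=> Aw j _; rewrite /A1; case: eqP => // ->.
  by move=> /(_ i); rewrite i_n /A1 eqxx; exact.
rewrite indep// (bigD1_seq i) ?mem_index_iota ?iota_uniq//= {1}/A1 eqxx big1.
  by rewrite mulr1 fineK// fin_num_measure.
by move=> j ji; rewrite /A1 (negbTE ji) probability_setT.
Qed.

Lemma step_integral i (h : 'rV[R]_d -> \bar R) : (i < n)%N ->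
  measurable_fun setT h -> (forall y, 0 <= h y)%E ->
  (\int[P]_w h (xi i w) = \int[Q]_y h y)%E.
Proof.
move=> i_n mh h0.
rewrite -(@ge0_integral_distribution _ _ _ _ _ P (xi i))//.
by apply: eq_measure_integral => A mA _; exact: step_law.
Qed.

Lemma exists_large_step_le r :
  (P [set w | exists2 i, (i < n)%N & (r < norm2 (xi i w))%R] <=
   n%:R%:E * Q [set y | (r < norm2 y)%R])%E.
Proof.
set U := [set y : 'rV[R]_d | r < norm2 y].
have mU : measurable U by exact: measurable_norm2_lt.
have mXU i : measurable (xi i @^-1` U).
  by rewrite -[_ @^-1` _]setTI; exact: measurable_funP.
have -> : [set w | exists2 i, (i < n)%N & (r < norm2 (xi i w))%R] =
    \big[setU/set0]_(i < n) (xi i @^-1` U).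
  by rewrite -(bigcup_mkord n (fun i => xi i @^-1` U));
    apply/seteqP; split => w [i i_n h]; exists i.
apply: (@le_trans _ _ (\sum_(i < n) P (xi i @^-1` U))%E).
  exact: (@Boole_inequality _ _ _ P (fun i => xi i @^-1` U)).
rewrite (eq_bigr (fun=> Q U)); last by move=> i _; rewrite step_law.
by rewrite ge0_sume_const.
Qed.

Let full w : 'rV[R]_d := psum xi id n w.

Let measurable_full : measurable_fun setT full.
Proof. by apply: measurable_psum; exact: measurable_id. Qed.

(** The norm of the difference of the two sums is at most the total length of the
    steps that are truncated. *)
Lemma truncation_mean r (f : 'rV[R]_d -> R) (eta : R) : 0 < r -> lipschitz1 f ->
  P.-integrable setT (EFin \o (fun w => f (full w))) ->
  (n%:R%:E * \int[Q]_(y in [set y | (r < norm2 y)%R]) (norm2 y)%:E <= eta%:E)%E ->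
  \int[P]_w f (psum xi (truncate r) n w) <= \int[P]_w f (full w) + eta.
Proof.
move=> r0 lf ifull heta.
have mt := measurable_truncate r.
have tr y := truncate_le y r0.
have itrunc := @psum_integrable _ _ _ P _ xi _ _ mt tr f n lf.
rewrite -lerBlDl -RintegralB//.
pose rest y := norm2 y * \1_[set y | r < norm2 y] y.
have mrest : measurable_fun setT rest.
  apply: measurable_funM; first exact: measurable_norm2.
  by apply: measurable_indic; exact: measurable_norm2_lt.
have rest0 y : 0 <= rest y by rewrite mulr_ge0 ?norm2_ge0.
have restE y : norm2 (truncate r y - y) = rest y.
  rewrite /truncate /rest indicE; have [yr|yr] := leP (norm2 y) r.
    by rewrite subrr norm2_0 memNset ?mulr0//=; apply/negP; rewrite -leNgt.
  by rewrite sub0r norm2N mem_set// mulr1.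
have bound w : f (psum xi (truncate r) n w) - f (full w) <=
    \sum_(i < n) rest (xi i w).
  apply: (le_trans (ler_norm _)); apply: (le_trans (lf _ _)).
  rewrite /full /psum -sumrB big_mkord (le_trans (norm2_sum _))//.
  by apply: ler_sum => i _; rewrite restE.
have sumE : (\int[P]_w (\sum_(i < n) rest (xi i w))%:E <= eta%:E)%E.
  under eq_integral do rewrite -sumEFin.
  have mri (i : 'I_n) : measurable_fun setT (fun w => (rest (xi i w))%:E).
    by apply/measurable_EFinP; exact: measurableT_comp.
  have ri0 (i : 'I_n) w : setT w -> (0 <= (rest (xi i w))%:E)%E by rewrite lee_fin.
  rewrite ge0_integral_sum//.
  rewrite (eq_bigr (fun=> \int[Q]_y (rest y)%:E)%E); last first.
    move=> i _; apply: (@step_integral i (EFin \o rest)) => //.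
    exact/measurable_EFinP.
  rewrite ge0_sume_const; last by apply: integral_ge0 => y _; rewrite lee_fin.
  apply: le_trans heta; rewrite le_eqVlt; apply/orP; left; apply/eqP.
  congr (_ * _)%E; rewrite [RHS]integral_mkcond; apply: eq_integral => y _.
  rewrite patchE /rest indicE; case: ifPn => _ /=; first by rewrite mulr1.
  by rewrite mulr0.
have sum0 w : 0 <= \sum_(i < n) rest (xi i w) by exact: sumr_ge0.
have msum : measurable_fun setT (fun w => \sum_(i < n) rest (xi i w)).
  by apply: measurable_sum => i; exact: measurableT_comp.
have isum : P.-integrable setT (EFin \o (fun w => \sum_(i < n) rest (xi i w))).
  apply/integrableP; split; first exact/measurable_EFinP.
  apply: (@le_lt_trans _ _ eta%:E); last exact: ltry.
  by under eq_integral do rewrite /= ger0_norm//.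
apply: (@le_trans _ _ (\int[P]_w \sum_(i < n) rest (xi i w))).
  apply: le_Rintegral => //.
  rewrite (_ : EFin \o _ = ((EFin \o (fun w => f (psum xi (truncate r) n w))) \-
    (EFin \o (fun w => f (full w))))%E)//.
  exact: integrableB.
by rewrite -lee_fin /Rintegral fineK//; exact: integrable_fin_num.
Qed.

(** Union bound: either some step is longer than [r], or the sum coincides with
    the sum of the truncated steps, which deviates from its own mean by at least
    [x - eta]. *)
Lemma truncated_deviation r lam x (p v eta : R) (Z : probability 'rV[R]_d R)
    (f : 'rV[R]_d -> R) :
  0 < r -> 0 < lam -> lipschitz1 f ->
  (forall B, measurable B -> P (full @^-1` B) = Z B) ->
  Z.-integrable setT (EFin \o f) ->
  (n%:R%:E * Q [set y | (r < norm2 y)%R] <= p%:E)%E ->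
  (n%:R%:E * \int[Q]_(y in [set y | (norm2 y <= r)%R]) (norm2 y ^+ 2)%:E <= v%:E)%E ->
  (n%:R%:E * \int[Q]_(y in [set y | (r < norm2 y)%R]) (norm2 y)%:E <= eta%:E)%E ->
  (Z [set y | (x <= f y - (\int[Z]_y f y)%R)%R] <=
   (p + expR (v * ((expR (lam * r) - 1 - lam * r) / r ^+ 2) - lam * (x - eta)))%:E)%E.
Proof.
move=> r0 lam0 lf ZE iZ hp hv heta.
have mt := measurable_truncate r.
have tr y := truncate_le y r0.
have mf := lipschitz1_measurable lf.
pose law := distribution P (to_mfun measurable_full).
have ZI (h : 'rV[R]_d -> \bar R) : (\int[Z]_y h y = \int[law]_y h y)%E.
  by apply: eq_measure_integral => B mB _; apply/esym; exact: ZE.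
have ilaw : law.-integrable setT (EFin \o f).
  case/integrableP: iZ => mZ fin; apply/integrableP; split => //.
  by rewrite -ZI.
have ifull : P.-integrable setT (EFin \o (fun w => f (full w))).
  apply/integrableP; split.
    apply/measurable_EFinP; exact: measurableT_comp.
  case/integrableP: ilaw => _; rewrite ge0_integral_distribution//.
  by apply: measurableT_comp => //; exact/measurable_EFinP.
set m := (\int[Z]_y f y)%R.
have mE : m = \int[P]_w f (full w).
  rewrite /m /Rintegral ZI integral_distribution//.
  exact/measurable_EFinP.
have hmean := truncation_mean r0 lf ifull heta.
rewrite -mE in hmean.
have mB : measurable [set y | (x <= f y - m)%R].
  rewrite -[X in measurable X]setTI (_ : [set y | _] = f @^-1` `[x + m, +oo[).
    exact: mf.
  by apply/seteqP; split => y /=; rewrite in_itv/= andbT lerBrDr.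
rewrite -ZE//.
set S := psum xi (truncate r) n.
set mS := (\int[P]_w f (S w))%R in hmean.
set D1 := [set w | exists2 i, (i < n)%N & (r < norm2 (xi i w))%R].
set D2 := [set w | x - eta <= f (S w) - mS].
have mD2 : measurable D2.
  rewrite -[D2]setTI (_ : D2 = (fun w => f (S w)) @^-1` `[(x - eta) + mS, +oo[).
    by apply: measurableT_comp => //; exact: measurable_psum.
  by apply/seteqP; split => w; rewrite /D2 /= in_itv/= andbT lerBrDr.
have mD1 : measurable D1.
  rewrite (_ : D1 = \bigcup_(i in [set i | (i < n)%N]) (xi i @^-1` [set y | r < norm2 y])).
    apply: bigcup_measurable => i _; rewrite -[_ @^-1` _]setTI.
    by apply: measurable_funP => //; exact: measurable_norm2_lt.
  by apply/seteqP; split => w [i ? ?]; exists i.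
have sub : full @^-1` [set y | x <= f y - m] `<=` D1 `|` D2.
  move=> w /= hw; have [|nD1] := pselect (D1 w); first by left.
  right; rewrite /D2 /=.
  have -> : S w = full w.
    rewrite /S /full /psum; apply: eq_big_nat => i /andP[_ i_n].
    rewrite /truncate; case: leP => // h; exfalso; apply: nD1; by exists i.
  lra.
apply: (@le_trans _ _ (P (D1 `|` D2))).
  apply: le_measure => //; rewrite inE.
    by rewrite -[X in measurable X]setTI; exact: measurable_full.
  exact: measurableU.
apply: (le_trans (measureU2 _ _ _)) => //; rewrite EFinD leeD//.
  exact: le_trans (exists_large_step_le r) hp.
apply: (le_trans (psum_concentration indep mt r0 tr (x - eta) lam0 lf)).
rewrite lee_fin ler_expR lerD2r.
set kap := _ / r ^+ 2.
have kap0 : 0 <= kap.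
  rewrite divr_ge0 ?sqr_ge0//; have := expR_ge1Dx (lam * r); lra.
rewrite mulrCA mulrC ler_wpM2r//.
rewrite -lee_fin EFinM; apply: le_trans hv.
rewrite lee_pmul//.
  by rewrite lee_fin fine_ge0// integral_ge0// => y _; rewrite lee_fin sqr_ge0.
rewrite /Rintegral.
have mq : measurable_fun setT (fun y => (norm2 (truncate r y) ^+ 2)%:E).
  apply/measurable_EFinP; apply: measurable_funX; apply: measurableT_comp => //.
  exact: measurable_norm2.
rewrite fineK; last first.
  apply: integrable_fin_num => //.
  apply: (@bounded_integrable _ _ Q _ (r ^+ 2)) => [|y].
    exact/measurable_EFinP.
  by rewrite ger0_norm ?sqr_ge0// lerXn2r ?nnegrE ?norm2_ge0// ltW.
rewrite [leRHS]integral_mkcond le_eqVlt; apply/orP; left; apply/eqP.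
apply: eq_integral => y _; rewrite patchE /truncate.
have [yr|yr] := leP (norm2 y) r; first by rewrite mem_set.
by rewrite memNset/= ?norm2_0 ?expr0n//=; apply/negP; rewrite -ltNge.
Qed.

End truncated_sum.

(** * The truncated variance and the function [g_c] *)

Section truncated_variance.
Context {R : realType} {d : nat} (nu : {measure set 'rV[R]_d -> \bar R}).
Hypothesis nu_levy : levy_measure nu.
Implicit Types (r e x : R).

Lemma V_fineK r : ((fine (V_ nu r))%:E = V_ nu r)%E.
Proof.
rewrite fineK// ge0_fin_numE ?levy_V_fin//.
by apply: integral_ge0 => y _; rewrite lee_fin sqr_ge0.
Qed.

Let sq_ind r : 'rV[R]_d -> R := fun y => norm2 y ^+ 2 * \1_[set y | norm2 y <= r] y.

Let sq_ind_ge0 r y : 0 <= sq_ind r y.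
Proof. by rewrite mulr_ge0// sqr_ge0. Qed.

Let measurable_sq_ind r : measurable_fun setT (sq_ind r).
Proof.
apply: measurable_funM; first by apply: measurable_funX; exact: measurable_norm2.
by apply: measurable_indic; exact: measurable_norm2_le.
Qed.

Let V_sq_ind r : V_ nu r = (\int[nu]_y (sq_ind r y)%:E)%E.
Proof.
rewrite /V_ integral_mkcond; apply: eq_integral => y _.
by rewrite patchE /sq_ind indicE; case: ifPn => _; rewrite ?mulr1 ?mulr0.
Qed.

Let sq_ind_le r x y : r <= x -> sq_ind r y <= sq_ind x y.
Proof.
move=> rx; rewrite ler_wpM2l ?sqr_ge0// !indicE ler_nat.
have [yr|yr] := leP (norm2 y) r.
  by rewrite !mem_set//=; exact: le_trans rx.
by rewrite (@memNset _ [set y | norm2 y <= r])//=; apply/negP; rewrite -ltNge.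
Qed.

Lemma V_le r x : r <= x -> fine (V_ nu r) <= fine (V_ nu x).
Proof.
move=> rx; rewrite -lee_fin !V_fineK !V_sq_ind; apply: ge0_le_integral => //.
- by move=> y _; rewrite lee_fin.
- exact/measurable_EFinP.
- exact/measurable_EFinP.
- by move=> y _; rewrite lee_fin; exact: sq_ind_le.
Qed.

Lemma V_right_continuous r e : 0 < e ->
  exists2 del : R, 0 < del & fine (V_ nu (r + del)) <= fine (V_ nu r) + e.
Proof.
move=> e0.
pose del n : R := n.+1%:R^-1.
have del0 n : 0 < del n by rewrite invr_gt0 ltr0n.
have lim y : sq_ind (r + del n) y @[n --> \oo] --> sq_ind r y.
  have [yr|yr] := leP (norm2 y) r.
    apply: cvg_near_cst; apply: nearW => n; rewrite /sq_ind !indicE !mem_set//=.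
    by rewrite (le_trans yr)// lerDl (ltW (del0 n)).
  have : \forall n \near \oo, del n < norm2 y - r.
    have := @cvg_harmonic R; move/cvgrPdist_lt => /(_ (norm2 y - r)).
    rewrite subr_gt0 => /(_ yr); apply: filterS => n.
    by rewrite sub0r normrN ger0_norm// (ltW (del0 n)).
  move=> hn; apply: cvg_near_cst; near=> n.
  have hdel : del n < norm2 y - r by near: n.
  rewrite /sq_ind !indicE !memNset//=; apply/negP; rewrite -ltNge//.
  by rewrite -ltrBrDl.
have iV : nu.-integrable setT (EFin \o sq_ind (r + 1)).
  apply/integrableP; split; first exact/measurable_EFinP.
  apply: le_lt_trans (levy_V_fin nu_levy (r + 1)); rewrite V_sq_ind.
  by rewrite le_eqVlt; apply/orP; left; apply/eqP; apply: eq_integral => y _ /=;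
    rewrite ger0_norm.
have [_ _ cV] : [/\ nu.-integrable setT (EFin \o sq_ind r),
   (\int[nu]_y `|(sq_ind (r + del n) y)%:E - (sq_ind r y)%:E|)%E @[n --> \oo] --> 0%E &
   (\int[nu]_y (sq_ind (r + del n) y)%:E)%E @[n --> \oo] --> (\int[nu]_y (sq_ind r y)%:E)%E].
  apply: (@dominated_convergence _ _ _ nu setT measurableT
      (fun n => EFin \o sq_ind (r + del n)) (EFin \o sq_ind r)
      (EFin \o sq_ind (r + 1))) => //.
  - by move=> n; exact/measurable_EFinP.
  - exact/measurable_EFinP.
  - by apply: aeW => y _; apply: cvg_EFin; [exact: nearW|exact: lim].
  - apply: aeW => y n _; rewrite /= lee_fin ger0_norm//; apply: sq_ind_le.
    by rewrite lerD2l invf_le1// ler1n.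
have cV' : fine (V_ nu (r + del n)) @[n --> \oo] --> fine (V_ nu r).
  apply: fine_cvg; rewrite V_fineK V_sq_ind.
  by under eq_fun do rewrite V_sq_ind.
have /cvgrPdist_le/(_ _ e0)[N _ hN] := cV'.
exists (del N) => //.
by have := hN N (leqnn N); rewrite ler_distl => /andP[]; lra.
Unshelve. all: by end_near. Qed.

(** The set whose infimum is [r] contains points arbitrarily close to [r] on
    its right, and [V] is right-continuous. *)
Lemma h_attained c t r : 0 < c -> 0 < t -> 0 < r -> h_ nu c t = r%:E ->
  fine (V_ nu r) = c / t * r ^+ 2.
Proof.
move=> c0 t0 r0 hr.
have ct0 : 0 < c / t by rewrite divr_gt0.
have near_r e : 0 < e -> exists x, [/\ r <= x, x < r + e &
    fine (V_ nu x) = c / t * x ^+ 2].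
  move=> e0; have : (h_ nu c t < (r + e)%:E)%E by rewrite hr lte_fin ltrDl.
  move=> /ereal_inf_lt[_ [x [x0 hx] <-]]; rewrite lte_fin => xre.
  exists x; split => //.
    by rewrite -lee_fin -hr; apply: ereal_inf_lbound; exists x.
  have x2 : x ^+ 2 != 0 by rewrite expf_neq0// gt_eqF.
  move: hx; rewrite -V_fineK -EFinM => -[hx].
  by rewrite -hx mulfVK.
apply/eqP; rewrite eq_le; apply/andP; split; apply/ler_addgt0Pr => e e0.
- pose del := Num.min 1 (e / (c / t * (2 * r + 1))).
  have q0 : 0 < c / t * (2 * r + 1) by rewrite mulr_gt0//; lra.
  have del0 : 0 < del by rewrite lt_min ltr01 divr_gt0.
  have [x [rx xr Vx]] := near_r del del0.
  apply: (le_trans (V_le rx)); rewrite Vx.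
  have d1 : del <= 1 by rewrite ge_min lexx.
  have d2 : del * (c / t * (2 * r + 1)) <= e.
    by rewrite -ler_pdivlMr// ge_min lexx orbT.
  apply: le_trans (lerD (lexx _) d2).
  have -> : c / t * r ^+ 2 + del * (c / t * (2 * r + 1)) =
     c / t * (r ^+ 2 + del * (2 * r + 1)) by ring.
  rewrite ler_pM2l//; nra.
- have [del del0 hdel] := V_right_continuous r e0.
  have [x [rx xr Vx]] := near_r del del0.
  apply: le_trans hdel; apply: le_trans (V_le (ltW xr)); rewrite Vx.
  by rewrite ler_pM2l// lerXn2r ?nnegrE ?(ltW r0)// (le_trans (ltW r0)).
Qed.

End truncated_variance.

Section bennett_function.
Context {R : realType}.
Implicit Types (x y c b : R).

Lemma bennett_kernel_le lam x y : 0 < lam -> 0 < x -> x <= y ->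
  (expR (lam * x) - 1 - lam * x) / x ^+ 2 <= (expR (lam * y) - 1 - lam * y) / y ^+ 2.
Proof.
move=> lam0 x0 xy; have y0 : 0 < y by exact: lt_le_trans xy.
rewrite ler_pdivrMr ?exprn_gt0//.
have := @expR_sub_le R (lam * x) (lam * y) (mulr_gt0 lam0 y0).
rewrite ger0_norm ?mulr_ge0 ?(ltW lam0) ?(ltW x0)// ler_pM2l// => /(_ xy).
move=> /le_trans; apply; rewrite le_eqVlt; apply/orP; left; apply/eqP.
by field; rewrite !gt_eqF.
Qed.

(** Intermediate value theorem on [[0, Y]]: with [Y / c >= e^2] the logarithm is
    at least 2, so the left-hand side is at most [- Y <= ln x]. *)
Lemma g_exists c x : 0 < c -> 0 < x -> x <= 1 ->
  exists y, 0 <= y /\ y - (y + c) * ln (1 + y / c) = ln x.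
Proof.
move=> c0 x0 x1.
pose F y := y - (y + c) * ln (1 + y / c).
have lx0 : ln x <= 0 by exact: ln_le0.
pose Y := c * expR 2 - ln x.
have e2 : 0 < expR 2 :> R by exact: expR_gt0.
have Y0 : 0 <= Y by rewrite subr_ge0 (le_trans lx0)// mulr_ge0// ltW.
have FY : F Y <= ln x.
  have h : 2 <= ln (1 + Y / c).
    rewrite -[leLHS]expRK ler_ln ?posrE//; last first.
      by rewrite ltr_pwDl// divr_ge0// ltW.
    apply: (@le_trans _ _ (Y / c)); last by rewrite lerDr.
    by rewrite ler_pdivlMr// /Y mulrC lerDl oppr_ge0.
  have : (Y + c) * 2 <= (Y + c) * ln (1 + Y / c).
    by rewrite ler_wpM2l// addr_ge0// ltW.
  have : 0 <= c * expR 2 by rewrite mulr_ge0 ?ltW.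
  by rewrite /F /Y; lra.
have F0 : F 0 = 0 by rewrite /F mul0r addr0 ln1 mulr0 subr0.
have cF : {within `[0, Y], continuous F}.
  apply: continuous_in_subspaceT => y; rewrite inE/= in_itv/= => /andP[y0 _].
  apply: cvgB; first exact: cvg_id.
  apply: cvgM; first by apply: cvgD; [exact: cvg_id|exact: cvg_cst].
  apply: (@continuous_comp R R R (fun y : R => 1 + y / c) (@ln R) y).
    apply: cvgD; first exact: cvg_cst.
    by apply: cvgM; [exact: cvg_id|exact: cvg_cst].
  by apply: continuous_ln; rewrite ltr_pwDl// divr_ge0// ltW.
have [] := @IVT _ F 0 Y (ln x) Y0 cF.
  by rewrite F0 ge_min FY orbT le_max lx0.
move=> y; rewrite in_itv/= => /andP[y0 _] Fy.
by exists y.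
Qed.

End bennett_function.

(** * Increments of the process and the deviation inequality *)

Section increments.
Context {dT} {T : measurableType dT} {R : realType} (P : probability T R).
Context {d : nat} (X : R -> {RV P >-> 'rV[R]_d}).
Hypothesis X_levy : levy_process X.
Variables (t : R) (n : nat).
Hypothesis t0 : 0 < t.

Let grid i : R := t * i%:R / n.+1%:R.

Let measurable_increment i : measurable_fun setT (fun w => X (grid i.+1) w - X (grid i) w).
Proof. by apply: measurable_rVB; exact: measurable_funP. Qed.

Definition increment i : {RV P >-> 'rV[R]_d} := to_mfun (measurable_increment i).

Let n0 : 0 < n.+1%:R :> R. Proof. by rewrite ltr0n. Qed.

Let grid_ge0 i : 0 <= grid i.
Proof. by rewrite divr_ge0 ?mulr_ge0// ltW. Qed.

Let grid_le i : grid i <= grid i.+1.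
Proof. by rewrite ler_pM2r ?invr_gt0// ler_pM2l// ler_nat. Qed.

Lemma increment_independent (A : nat -> set 'rV[R]_d) : (forall i, measurable (A i)) ->
  P [set w | forall i, (0 <= i < n.+1)%N -> A i (increment i w)] =
  (\prod_(0 <= i < n.+1) fine (distribution P (X (t / n.+1%:R)) (A i)))%:E.
Proof.
move=> mA.
have := @levy_independent _ _ _ _ _ _ X_levy n.+1 grid (grid_ge0 0) grid_le
  (fun i => A i) (fun i => mA i).
have -> : \bigcap_i ((fun w => X (grid (i : 'I_n.+1).+1) w - X (grid i) w) @^-1` A i) =
    [set w | forall i, (0 <= i < n.+1)%N -> A i (increment i w)].
  apply/seteqP; split => w /= h i; last by move=> _; apply: h => /=.
  by move=> i_n; exact: (h (Ordinal i_n) I).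
move=> ->; rewrite big_mkord -prodEFin.
apply: eq_bigr => i _; rewrite fineK ?fin_num_measure//.
rewrite /distribution /pushforward.
have := @levy_stationary _ _ _ _ _ _ X_levy (grid i) (grid i.+1) (grid_ge0 i)
  (grid_le i) (A i) (mA i).
have -> : grid i.+1 - grid i = t / n.+1%:R.
  by rewrite /grid -natr1; field; rewrite gt_eqF//; have := n0; rewrite -natr1.
exact.
Qed.

(** The increments add up to [X_t - X_0], which has the law of [X_t] by
    stationarity. *)
Lemma increments_law (B : set 'rV[R]_d) : measurable B ->
  P ((fun w => psum increment id n.+1 w) @^-1` B) = distribution P (X t) B.
Proof.
move=> mB.
have := @levy_stationary _ _ _ _ _ _ X_levy 0 t (lexx 0) (ltW t0) B mB.
rewrite subr0 => h; transitivity (P [set w | B (X t w - X 0 w)]); last exact: h.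
congr (P _); apply/funext => w.
rewrite /preimage/=; congr B.
rewrite /psum /= telescope_sumr// /grid.
by rewrite mulr0 mul0r mulfK// gt_eqF.
Qed.

End increments.

Section deviation.
Context {R : realType} {dT : measure_display} {T : measurableType dT}.
Variables (P : probability T R) (d : nat) (X : R -> {RV P >-> 'rV[R]_d}).
Variables (b0 : 'rV[R]_d) (nu : {measure set 'rV[R]_d -> \bar R}).
Hypotheses (X_levy : levy_process X) (nu_levy : levy_measure nu).
Hypothesis X_char : forall (t : R) (u : 'rV[R]_d), 0 <= t ->
  cintegral P (fun w => cexp ((dotp u (X t w)) *i)%C)
  = cexp (t%:C * char_exponent b0 nu u)%C.
Hypothesis X_mean : forall t : R, 0 <= t -> ('E_P[fun w => norm2 (X t w)] < +oo)%E.
Variable K : R.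
Hypothesis hK : forall r : R, 0 < r ->
  (M_ nu r <= K%:E * (V_ nu r * (r^-1)%:E))%E.

Let mu (s : R) : probability 'rV[R]_d R := distribution P (X s).

Let M_fin r : 0 < r -> (M_ nu r < +oo)%E.
Proof.
move=> r0; apply: (le_lt_trans (hK r0)).
by rewrite -(V_fineK nu_levy) -!EFinM ltry.
Qed.

Let M_le r : 0 < r -> fine (M_ nu r) <= K * (fine (V_ nu r) / r).
Proof.
move=> r0; rewrite -lee_fin fineK; last first.
  rewrite ge0_fin_numE ?M_fin//.
  by apply: integral_ge0 => y _; rewrite lee_fin norm2_ge0.
by apply: (le_trans (hK r0)); rewrite -(V_fineK nu_levy) -!EFinM.
Qed.

Let C : R := 4 * exponent_bound nu b0 ^+ 2.

Let C0 : 0 <= C.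
Proof. by rewrite mulr_ge0// sqr_ge0. Qed.

Let mu_cos (s : R) u : 0 <= s ->
  `|gap nu (mu s) s (fun y => 1 - cos (dotp u y))| <=
  s ^+ 2 * (C * (norm2 u ^+ 2 + norm2 u ^+ 4)).
Proof.
move=> s0; apply: char_exponent_gap => //; first exact: M_fin ltr01.
have mc := @measurable_cos_dotp R d u.
have ic : (mu s).-integrable setT (EFin \o (fun y => cos (dotp u y))).
  by apply: (@bounded_integrable _ _ (mu s) _ 1) => // y; exact: cos_max.
have -> : \int[mu s]_y cos (dotp u y) = \int[P]_w cos (dotp u (X s w)).
  rewrite /Rintegral integral_distribution//; first exact/measurable_EFinP.
  apply/integrableP; split.
    by apply/measurable_EFinP; exact: (measurableT_comp mc (measurable_funP (X s))).
  case/integrableP: ic => _; rewrite ge0_integral_distribution//.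
  by apply: measurableT_comp => //; exact/measurable_EFinP.
rewrite -X_char//= /cintegral/=; apply: eq_Rintegral => w _.
by rewrite expR0 mul1r.
Qed.

Let lipschitz_integrable f t : 0 <= t -> lipschitz1 f ->
  (mu t).-integrable setT (EFin \o f).
Proof.
move=> t0 lf; have mf := lipschitz1_measurable lf.
have inorm : (mu t).-integrable setT (EFin \o (fun y : 'rV[R]_d => `|f 0| + norm2 y)).
  have icst : (mu t).-integrable setT (EFin \o cst `|f 0|).
    by apply: (@bounded_integrable _ _ (mu t) _ `|f 0|) => // y; rewrite /= normr_id.
  rewrite (_ : EFin \o _ = (EFin \o cst `|f 0|) \+ (EFin \o (@norm2 R d)))//.
  apply: integrableD => //.
  apply/integrableP; split; first by apply/measurable_EFinP; exact: measurable_norm2.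
  have mn : measurable_fun setT (fun y : 'rV[R]_d => (norm2 y)%:E).
    by apply/measurable_EFinP; exact: measurable_norm2.
  rewrite (eq_integral (fun y => (norm2 y)%:E)); last first.
    by move=> y _; rewrite /= ger0_norm// norm2_ge0.
  have := X_mean t0; rewrite unlock ge0_integral_distribution// => y.
  by rewrite lee_fin norm2_ge0.
apply: (le_integrable _ _ _ inorm) => //; first exact/measurable_EFinP.
move=> y _ /=; rewrite lee_fin (le_trans (lipschitz1_growth y lf))//.
exact: ler_norm.
Qed.

(** The number of increments is taken large enough for the small-time bounds to
    hold within [e] at time [t / n]. They need a truncation level above [r],
    chosen at most [r + e] and so close to [r] that [V] grows by at most [e]. *)
Lemma deviation_approx f t r lam x e : lipschitz1 f -> 0 < t -> 0 < r ->
  0 < lam -> 0 < e ->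
  (mu t [set y | (x <= f y - (\int[mu t]_y f y)%R)%R] <=
   (t * (fine (nubar nu r) + e) +
    expR (t * (fine (V_ nu r) + 2 * e) *
      ((expR (lam * (r + e)) - 1 - lam * (r + e)) / (r + e) ^+ 2) -
      lam * (x - t * (fine (M_ nu r) + 2 * e))))%:E)%E.
Proof.
move=> lf t0 r0 lam0 e0.
have [del del0 hdel] := V_right_continuous nu_levy r e0.
pose l : R := r + Num.min e (del / 2).
have rl : r < l by rewrite ltrDl lt_min e0 divr_gt0.
have le_l : l <= r + e by rewrite lerD2l ge_min lexx.
have ldel : l < r + del.
  rewrite ltrD2l (@le_lt_trans _ _ (del / 2))//; last by lra.
  by rewrite ge_min lexx orbT.
have l0 : 0 < l by exact: lt_trans rl.
have [L0 L00 hL] := small_time_uniform_integrability nu_levy (M_fin ltr01) C0 mu_cos e0.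
pose L := Num.max l L0.
have lL : l <= L by rewrite le_max lexx.
have near_s : \forall s \near 0^'+, [/\
    (mu s [set y | (l < norm2 y)%R] <= (s * (fine (nubar nu r) + e))%:E)%E,
    (\int[mu s]_(y in [set y | (norm2 y <= l)%R]) (norm2 y ^+ 2)%:E <=
      (s * (fine (V_ nu r) + 2 * e))%:E)%E &
    (\int[mu s]_(y in [set y | (l < norm2 y)%R]) (norm2 y)%:E <=
      (s * (fine (M_ nu r) + 2 * e))%:E)%E].
  near=> s; have s0 : 0 < s by []; split.
  - by near: s; exact: (small_time_tail nu_levy C0 mu_cos).
  - apply: (@le_trans _ _ (s * (fine (V_ nu (r + del)) + e))%:E); last first.
      by rewrite lee_fin ler_pM2l//; lra.
    by near: s; exact: (small_time_second_moment nu_levy C0 mu_cos).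
  - have h1 : (\int[mu s]_(y in [set y | (l < norm2 y)%R]) (Num.min (norm2 y) L)%:E <=
        (s * (fine (M_ nu r) + e))%:E)%E.
      near: s; apply: (small_time_truncated_mean nu_levy C0 mu_cos) => //.
      exact: M_fin.
    have h2 : (\int[mu s]_(y in [set y | (L0 < norm2 y)%R]) (norm2 y)%:E <= (e * s)%:E)%E.
      by near: s; exact: hL.
    have mlt q := @measurable_norm2_lt R d q.
    have mn : measurable_fun setT (fun y : 'rV[R]_d => (norm2 y)%:E).
      by apply/measurable_EFinP; exact: measurable_norm2.
    have mmin : measurable_fun setT (fun y : 'rV[R]_d => (Num.min (norm2 y) L)%:E).
      apply/measurable_EFinP; apply: measurable_minr; last exact: measurable_cst.
      exact: measurable_norm2.
    have min0 (y : 'rV[R]_d) : 0 <= Num.min (norm2 y) L.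
      by rewrite le_min norm2_ge0 (le_trans (ltW l0)).
    apply: (@le_trans _ _ (\int[mu s]_y
      (((fun y => (Num.min (norm2 y) L)%:E) \_ [set y | (l < norm2 y)%R]) y +
       ((fun y => (norm2 y)%:E) \_ [set y | (L0 < norm2 y)%R]) y))%E).
      rewrite integral_mkcond; apply: ge0_le_integral => //.
      - move=> y _; rewrite patchE; case: ifP => // _.
        by rewrite lee_fin norm2_ge0.
      - by apply/(measurable_restrictT _ _).1 => //; exact: measurable_funTS.
      - by apply: emeasurable_funD;
           apply/(measurable_restrictT _ _).1 => //; exact: measurable_funTS.
      - move=> y _; rewrite !patchE.
        have [yl|yl] := leP (norm2 y) l.
          rewrite memNset/=; last by apply/negP; rewrite -leNgt.
          by rewrite add0e; case: ifP => // _; rewrite lee_fin norm2_ge0.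
        rewrite mem_set//; have [yL|yL] := leP (norm2 y) L0.
          rewrite memNset/=; last by apply/negP; rewrite -leNgt.
          by rewrite adde0 lee_fin le_min lexx le_max yL orbT.
        by rewrite mem_set// -EFinD lee_fin lerDr.
    rewrite ge0_integralD//; last 4 first.
    - by move=> y _; rewrite patchE; case: ifP => // _; rewrite lee_fin.
    - by apply/(measurable_restrictT _ _).1 => //; exact: measurable_funTS.
    - by move=> y _; rewrite patchE; case: ifP => // _; rewrite lee_fin norm2_ge0.
    - by apply/(measurable_restrictT _ _).1 => //; exact: measurable_funTS.
    rewrite -!integral_mkcond; apply: (le_trans (leeD h1 h2)).
    by rewrite -EFinD lee_fin; lra.
have [n hn] : exists n : nat, [/\
    (mu (t / n.+1%:R) [set y | (l < norm2 y)%R] <=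
      (t / n.+1%:R * (fine (nubar nu r) + e))%:E)%E,
    (\int[mu (t / n.+1%:R)]_(y in [set y | (norm2 y <= l)%R]) (norm2 y ^+ 2)%:E <=
      (t / n.+1%:R * (fine (V_ nu r) + 2 * e))%:E)%E &
    (\int[mu (t / n.+1%:R)]_(y in [set y | (l < norm2 y)%R]) (norm2 y)%:E <=
      (t / n.+1%:R * (fine (M_ nu r) + 2 * e))%:E)%E].
  case: near_s => q /= q0 hq.
  exists (Num.bound (t / q)); apply: hq => /=; last by rewrite divr_gt0.
  rewrite sub0r normrN ger0_norm ?divr_ge0 ?(ltW t0)// ltr_pdivrMr// mulrC.
  rewrite -ltr_pdivrMr// (lt_trans (archi_boundP _)) ?divr_ge0 ?(ltW t0) ?(ltW q0)//.
  by rewrite ltr_nat.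
case: hn => hp hv heta.
have n0 : 0 < n.+1%:R :> R by rewrite ltr0n.
have scale (a : \bar R) (c : R) : (a <= (t / n.+1%:R * c)%:E)%E ->
    (n.+1%:R%:E * a <= (t * c)%:E)%E.
  move=> h; apply: (@le_trans _ _ (n.+1%:R%:E * (t / n.+1%:R * c)%:E)%E).
    by apply: lee_wpmul2l => //; rewrite lee_fin ltW.
  rewrite -EFinM lee_fin le_eqVlt; apply/orP; left; apply/eqP.
  by field; rewrite gt_eqF//; have := n0; rewrite -natr1.
have := @truncated_deviation _ _ _ P d n.+1 (increment X t n) (mu (t / n.+1%:R))
  (increment_independent X_levy n t0) l lam x _ _ _ (mu t) f l0 lam0 lf
  (@increments_law _ _ _ _ _ _ X_levy t n t0) (lipschitz_integrable (ltW t0) lf)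
  (scale _ _ hp) (scale _ _ hv) (scale _ _ heta).
move=> /le_trans; apply; rewrite lee_fin lerD2l ler_expR lerD2r.
apply: ler_wpM2l; last exact: bennett_kernel_le.
by rewrite mulr_ge0 ?(ltW t0)// addr_ge0 ?mulr_ge0 ?(ltW e0)// fine_ge0//
  integral_ge0// => y _; rewrite lee_fin sqr_ge0.
Unshelve. all: by end_near. Qed.

(** [deviation_approx] with [lam = ln (1 + b/c) / r], which minimizes the bound,
    as [e] tends to [0]. *)
Lemma deviation (A b c t r : R) : 0 < b -> 0 < c -> 0 < t ->
  0 < r -> h_ nu c t = r%:E ->
  (nubar nu r <= A%:E * (V_ nu r * ((r ^+ 2)^-1)%:E))%E ->
  forall f : 'rV[R]_d -> R, lipschitz1 f ->
  (P [set w | ((b + c * K) * r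
                <= f (X t w) - fine 'E_P[fun w' => f (X t w')])%R]
   <= (A * c + expR (b - (b + c) * ln (1 + b / c)))%:E)%E.
Proof.
move=> b_gt0 c0 t0 r0 hr hA f lf.
have mf := lipschitz1_measurable lf.
have VE := h_attained nu_levy c0 t0 r0 hr.
have r2 : 0 < r ^+ 2 by rewrite exprn_gt0.
set N := fine (nubar nu r); set V := fine (V_ nu r) in VE; set M := fine (M_ nu r).
have NE : t * N <= A * c.
  have : N <= A * (V / r ^+ 2).
    rewrite -lee_fin fineK ?ge0_fin_numE ?levy_tail_fin//.
    by apply: (le_trans hA); rewrite -(V_fineK nu_levy) -!EFinM.
  rewrite VE mulfK ?gt_eqF// => h.
  have -> : A * c = t * (A * (c / t)) by field; rewrite gt_eqF.
  by rewrite ler_pM2l.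
have ME : t * M <= c * K * r.
  have := M_le r0; rewrite -/M -/V VE => h.
  have -> : c * K * r = t * (K * (c / t * r ^+ 2 / r)) by field; rewrite !gt_eqF.
  by rewrite ler_pM2l.
pose lam := ln (1 + b / c) / r.
have bc : 0 < b / c by rewrite divr_gt0.
have lam0 : 0 < lam by rewrite divr_gt0// ln_gt0// ltrDl.
set x := (b + c * K) * r.
have meanE : fine 'E_P[fun w' => f (X t w')] = (\int[mu t]_y f y)%R.
  rewrite unlock /Rintegral /mu integral_distribution//.
    exact/measurable_EFinP.
  have /integrableP[_ fin] := lipschitz_integrable (ltW t0) lf.
  apply/integrableP; split.
    by apply/measurable_EFinP; exact: (measurableT_comp mf (measurable_funP (X t))).
  move: fin; rewrite ge0_integral_distribution//.
  by apply: measurableT_comp => //; exact/measurable_EFinP.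
rewrite meanE.
rewrite -[X in (X <= _)%E]/(mu t [set y | (x <= f y - (\int[mu t]_y f y)%R)%R]).
set p := mu t _.
have pfin : p \is a fin_num.
  apply: fin_num_measure.
  rewrite -[X in measurable X]setTI (_ : [set y | _] =
    f @^-1` `[x + (\int[mu t]_y f y), +oo[); first exact: mf.
  by apply/seteqP; split => y /=; rewrite in_itv/= andbT lerBrDr.
(* The bound of [deviation_approx]; it is continuous in [e] at [0]. *)
pose Phi (e : R) := A * c + t * e + expR (t * (V + 2 * e) *
  ((expR (lam * (r + e)) - 1 - lam * (r + e)) / (r + e) ^+ 2) -
  lam * (b * r - t * (2 * e))).
have pPhi e : 0 < e -> fine p <= Phi e.
  move=> e0; rewrite -lee_fin fineK//.
  apply: (le_trans (deviation_approx x lf t0 r0 lam0 e0)).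
  rewrite -/N -/V -/M lee_fin; apply: lerD; first by rewrite mulrDr lerD2r.
  rewrite ler_expR lerD2l lerN2 ler_pM2l// /x; lra.
have Phi0 : Phi 0 = A * c + expR (b - (b + c) * ln (1 + b / c)).
  rewrite /Phi !mulr0 !addr0 subr0; congr (_ + expR _).
  have -> : lam * r = ln (1 + b / c) by rewrite mulfVK// gt_eqF.
  rewrite lnK ?posrE ?addr_gt0// VE /lam.
  by field; rewrite !gt_eqF.
rewrite -(fineK pfin) lee_fin -Phi0.
have cPhi : Phi e @[e --> 0^'+] --> Phi 0.
  apply: cvg_at_right_filter.
  have cid : e @[e --> (0 : R)] --> (0 : R) by exact: cvg_id.
  have cr : r + e @[e --> (0 : R)] --> r + 0 by apply: cvgD; [exact: cvg_cst|].
  have cl : lam * (r + e) @[e --> (0 : R)] --> lam * (r + 0) by exact: cvgMr.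
  apply: cvgD; first by apply: cvgD; [exact: cvg_cst|exact: cvgMr].
  apply: continuous_cvg; first exact: continuous_expR.
  apply: cvgB.
    apply: cvgM.
      by apply: cvgMr; apply: cvgD; [exact: cvg_cst|exact: cvgMr].
    apply: cvgM.
      apply: cvgB => //; apply: cvgB; last exact: cvg_cst.
      by apply: continuous_cvg => //; exact: continuous_expR.
    apply: cvgV; first by rewrite addr0 gt_eqF.
    by rewrite expr2; under eq_fun do rewrite expr2; exact: cvgM.
  apply: cvgMr; apply: cvgB; first exact: cvg_cst.
  by apply: cvgMr; exact: cvgMr.
apply: ler_cvg_to (cvg_cst (fine p)) cPhi _.
by near=> e; apply: pPhi.
Unshelve. all: by end_near. Qed.

End deviation.

Theorem theorem3 (R : realType) (dT : measure_display)
    (T : measurableType dT) (P : probability T R) (d : nat)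
    (X : R -> {RV P >-> 'rV[R]_d})
    (b0 : 'rV[R]_d) (nu : {measure set 'rV[R]_d -> \bar R})
    (X_levy : levy_process X)
    (nu_levy : levy_measure nu)
    (X_char : forall (t : R) (u : 'rV[R]_d), 0 <= t ->
      cintegral P (fun w => cexp ((dotp u (X t w)) *i)%C)
      = cexp (t%:C * char_exponent b0 nu u)%C)
    (X_centered : forall t : R, 0 <= t -> centered P (X t))
    (K : R)
    (hK : forall r : R, 0 < r ->
      (M_ nu r <= K%:E * (V_ nu r * (r^-1)%:E))%E)
    (A : R) (A_gt0 : 0 < A) :
  (forall b c t r : R, 0 < b -> 0 < c -> 0 < t ->
     0 < r -> h_ nu c t = r%:E ->
     (nubar nu r <= A%:E * (V_ nu r * ((r ^+ 2)^-1)%:E))%E ->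
     forall f : 'rV[R]_d -> R, lipschitz1 f ->
     (P [set w | ((b + c * K) * r
                  <= f (X t w) - fine 'E_P[fun w' => f (X t w')])%R]
      <= (A * c + expR (b - (b + c) * ln (1 + b / c)))%:E)%E)
  /\
  (forall q t r : R, 0 < q -> q <= 2 -> 0 < t ->
     0 < r -> h_ nu (q / (2 * A)) t = r%:E ->
     (nubar nu r <= A%:E * (V_ nu r * ((r ^+ 2)^-1)%:E))%E ->
     forall f : 'rV[R]_d -> R, lipschitz1 f ->
     forall x : R,
     (q * K / (2 * A) + g_ (q / (2 * A)) (q / 2)) * r <= x ->
     (P [set w | (x <= f (X t w) - fine 'E_P[fun w' => f (X t w')])%R]
      <= q%:E)%E).
Proof.
have X_mean t : 0 <= t -> ('E_P[fun w => norm2 (X t w)] < +oo)%E.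
  by move=> t0; case: (X_centered t t0).
have dev := deviation X_levy nu_levy X_char X_mean hK.
split=> [b c t r b_gt0 c0 t0 r0 hr hA f lf|q t r q0 q2 t0 r0 hr hA f lf x hx].
  exact: dev.
have c0 : 0 < q / (2 * A) by rewrite divr_gt0 ?mulr_gt0.
set c := q / (2 * A) in hr hx c0.
have q20 : 0 < q / 2 by rewrite divr_gt0.
have q21 : q / 2 <= 1 by rewrite ler_pdivrMr// mul1r.
have [g0 gE] : 0 <= g_ c (q / 2) /\
    g_ c (q / 2) - (g_ c (q / 2) + c) * ln (1 + g_ c (q / 2) / c) = ln (q / 2).
  have [y hy] := g_exists c0 q20 q21.
  exact: (@xgetPex _ 0 [set y | 0 <= y /\ y - (y + c) * ln (1 + y / c) = ln (q / 2)]
    (ex_intro _ y hy)).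
set b := g_ c (q / 2) in g0 gE hx.
move: g0; rewrite le_eqVlt => /predU1P[b_eq0|b_gt0].
  have qE : q = 2.
    move: gE; rewrite -b_eq0 mul0r addr0 ln1 mulr0 subr0 => /esym/eqP.
    by rewrite ln_eq0// => /eqP h; lra.
  rewrite (le_trans (probability_le1 _ _))//; last by rewrite qE lee_fin; lra.
  rewrite -[X in measurable X]setTI (_ : [set w | _] = (fun w => f (X t w)) @^-1`
    `[x + fine 'E_P[fun w' => f (X t w')], +oo[).
    apply: measurableT_comp => //; exact: lipschitz1_measurable.
  by apply/seteqP; split => w /=; rewrite in_itv/= andbT lerBrDr.
have mE (z : R) : measurable [set w | z <= f (X t w) - fine 'E_P[fun w' => f (X t w')]].
  rewrite -[X in measurable X]setTI (_ : [set w | _] = (fun w => f (X t w)) @^-1`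
    `[z + fine 'E_P[fun w' => f (X t w')], +oo[).
    apply: measurableT_comp => //; exact: lipschitz1_measurable.
  by apply/seteqP; split => w /=; rewrite in_itv/= andbT lerBrDr.
apply: (@le_trans _ _ (P [set w | ((b + c * K) * r
    <= f (X t w) - fine 'E_P[fun w' => f (X t w')])%R])).
  apply: le_measure; rewrite ?inE//.
  move=> w /=; apply: le_trans; apply: le_trans hx.
  by rewrite ler_pM2r// addrC lerD2r /c mulrAC.
apply: (le_trans (dev _ b c t r b_gt0 c0 t0 r0 hr hA f lf)).
rewrite lee_fin gE lnK ?posrE// /c.
rewrite le_eqVlt; apply/orP; left; apply/eqP; field.
by rewrite gt_eqF.
Qed.
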